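(* Let $\alpha>1$ be fixed and let $p$ be a positive integer. For each $u_0\in H^{\alpha/2}(\mathbb{R})$, the local solution of the Cauchy problem $$u_t+u_x+\tfrac12(u^{p+1})_x+\tfrac34D^\alpha u_x+\tfrac54D^\alpha u_t=0,\qquad u(x,0)=u_0(x),$$ has maximal existence time $T'=+\infty$; that is, $u\in C([0,+\infty);H^{\alpha/2}(\mathbb{R}))$.
   Context: $D^\alpha$ is the Fourier multiplier with symbol $|\xi|^\alpha$ on $\mathbb{R}$; functions are real-valued. A solution in $C([0,T'),H^r(\mathbb{R}))$ is understood through the Duhamel formula: $u(t)=S(t)u_0-\frac12\int_0^tS(t-\tau)\big[\partial_x(I+\frac54D^\alpha)^{-1}u^{p+1}\big](\tau)\,d\tau$, where $S(t)$ is the Fourier multiplier with symbol $\exp\Big(-i\xi t\,\frac{1+\frac34|\xi|^\alpha}{1+\frac54|\xi|^\alpha}\Big)$. For $\alpha>1$ and $u_0\in H^{\alpha/2}(\mathbb{R})$ there is a unique local solution in $C([0,T'),H^{\alpha/2}(\mathbb{R}))$ for some $T'=T'(\|u_0\|_{H^{\alpha/2}})>0$. *)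

(* Defs.v *)
From HB Require Import structures.
From mathcomp Require Import all_boot all_order all_algebra.
From mathcomp Require Import all_classical all_reals all_analysis.
From mathcomp Require Import complex.
Import Order.TTheory GRing.Theory Num.Theory.
Import numFieldNormedType.Exports.

Set Implicit Arguments.
Unset Strict Implicit.
Unset Printing Implicit Defensive.

Local Open Scope classical_set_scope.
Local Open Scope ring_scope.
Local Open Scope complex_scope.

Section Fourier.
Context {R : realType}.

Local Notation mu := (@lebesgue_measure R).

Definition expi (theta : R) : R[i] := cos theta +i* sin theta.

Definition cintegral (D : set R) (f : R -> R[i]) : R[i] :=
  (\int[mu]_(x in D) complex.Re (f x)) +i* (\int[mu]_(x in D) complex.Im (f x)).

Definition cL2norm (g : R -> R[i]) : \bar R :=
  'N[mu]_2%:E[(fun x => (Normc.normc (g x))%:E)]%E.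

Definition cL2 (g : R -> R[i]) : Prop :=
  [/\ measurable_fun setT (fun x => complex.Re (g x)),
      measurable_fun setT (fun x => complex.Im (g x))
    & (cL2norm g < +oo)%E].

(* Plancherel's definition: the transform of [f] in L^2 is the L^2 limit of
   the transforms of the truncations of [f], with kernel exp(- i x xi). *)
Definition is_fourier (f : R -> R) (g : R -> R[i]) : Prop :=
  cL2 g /\
  (fun n : nat => cL2norm (fun xi =>
     cintegral `[- n%:R, n%:R] (fun x => (f x)%:C * expi (- (x * xi))) - g xi))
    @ \oo --> 0%E.

(* A representative, chosen up to a.e. equality. *)
Definition fourier (f : R -> R) : R -> R[i] :=
  xget (fun=> 0) [set g | is_fourier f g].

(* Intended for [s >= 0]. The value is [+oo] off L^2, where [fourier] would be
   a default value. *)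
Definition sobolev_norm (s : R) (f : R -> R) : \bar R :=
  if f \in Lfun mu 2%:E then
    cL2norm (fun xi => ((1 + xi ^+ 2) `^ (s / 2))%:C * fourier f xi)
  else +oo%E.

Definition sobolev (s : R) (f : R -> R) : Prop := (sobolev_norm s f < +oo)%E.

(* The result is real valued, so this is meant for symbols [m] such that
   m(- xi) is the conjugate of m(xi). *)
Definition fourier_mult (m : R -> R[i]) (f : R -> R) : R -> R :=
  xget (fun=> 0)
    [set h | h \in Lfun mu 2%:E /\
             {ae mu, forall xi, fourier h xi = m xi * fourier f xi}].

(* Riemann integral of an H^s-valued function on [a, b]: limit, in H^s norm,
   of the sums over tagged partitions a = d 0 <= c 0 <= d 1 <= ... <= d n = b
   as the mesh goes to 0. *)
Definition is_sobolev_integral (s : R) (F : R -> R -> R) (a b : R)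
    (J : R -> R) : Prop :=
  forall e : R, 0 < e -> exists2 delta : R, 0 < delta &
    forall (n : nat) (d c : nat -> R), d 0%N = a -> d n = b ->
      (forall k, (k < n)%N ->
         [/\ d k <= c k, c k <= d k.+1 & d k.+1 - d k < delta]) ->
      (sobolev_norm s (fun x =>
         ((\sum_(k < n) (d k.+1 - d k) * F (c k) x) - J x)%R) < e%:E)%E.

(* The elements of C([0, T), H^s). *)
Definition sobolev_continuous (s : R) (T : \bar R) (u : R -> R -> R) : Prop :=
  forall t0 : R, 0 <= t0 -> (t0%:E < T)%E ->
    sobolev s (u t0) /\
    (fun t => sobolev_norm s (fun x => u t x - u t0 x))
      @ within [set t | 0 <= t /\ (t%:E < T)%E] (nbhs t0) --> 0%E.

End Fourier.

Section CauchyProblem.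
Context {R : realType}.
Variables (alpha : R) (p : nat).

Local Notation mu := (@lebesgue_measure R).

(* S(t); D^alpha has symbol |xi|^alpha. *)
Definition propagator (t : R) : (R -> R) -> R -> R :=
  fourier_mult (fun xi =>
    expi (- (xi * t * ((1 + 3 / 4 * `|xi| `^ alpha) /
                       (1 + 5 / 4 * `|xi| `^ alpha))))).

(* d_x (I + 5/4 D^alpha)^-1 *)
Definition smoothed_dx : (R -> R) -> R -> R :=
  fourier_mult (fun xi => 0 +i* (xi / (1 + 5 / 4 * `|xi| `^ alpha))).

(* [u t] is the function [x |-> u(x, t)]. *)
Definition is_solution (u0 : R -> R) (T : \bar R) (u : R -> R -> R) : Prop :=
  sobolev_continuous (alpha / 2) T u /\
  forall t : R, 0 <= t -> (t%:E < T)%E ->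
    exists2 J : R -> R,
      is_sobolev_integral (alpha / 2)
        (fun tau => propagator (t - tau)
                      (smoothed_dx (fun x => u tau x ^+ p.+1))) 0 t J &
      {ae mu, forall x, u t x = propagator t u0 x - 1 / 2 * J x}.

(* [u] is the local solution and [T] its maximal existence time: [u] solves the
   problem on [0, T), and every solution on some [0, T1) is a restriction of
   [u]. *)
Definition is_maximal_solution (u0 : R -> R) (T : \bar R) (u : R -> R -> R) :
    Prop :=
  [/\ (0 < T)%E, is_solution u0 T u
    & forall (T1 : \bar R) (w : R -> R -> R),
        (0 < T1)%E -> is_solution u0 T1 w ->
        (T1 <= T)%E /\
        forall t : R, 0 <= t -> (t%:E < T1)%E ->
          {ae mu, forall x, w t x = u t x}].

End CauchyProblem.

(* Main.v *)
(* The Fourier transform is replaced by the real Hartley transform, with kernel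
   cas = cos + sin: it is symmetric, its square is 2 pi, and f^ is the even part
   of Hf minus i times its odd part. With w = sqrt(1 + 5/4 |xi|^alpha), the state
   G = w Hu of u lives in L^2, and |G| is equivalent to the norm of u in
   H^(alpha/2). The linear group acts on states by isometries, and in the
   interaction picture v(t) = S(-t) G(t) Duhamel's formula becomes an ordinary
   differential equation v' = S(-t) N(S(t) v) in L^2.

   Since alpha > 1, 1/w is in L^2, so u is bounded by |G|, and
   |u(. + h) - u|^2 <= |h|^s |G|^2 with s = min(alpha, 2) > 1. As |xi|/w is
   dominated by 1 + |xi|^(1/2), a dyadic sum of such increments of u^(p+1) bounds
   N(G) in L^2 and shows that N is locally Lipschitz. The energy |G|^2 is
   conserved: <G, N(G)> is the limit of multiples of
   1/h <u(. + h) - u(. - h), u^(p+1)>, whose integrand is, up to terms of zero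
   integral, O((u(x + h) - u(x))^2), so that the quotient is O(h^(s - 1)).
   Truncating N outside a large ball makes it globally Lipschitz, hence the flow
   global, and by conservation the truncation is never felt. *)

(* Two losses of regularity shape the argument. The generator of the linear group has a symbol
   growing like [xi], so it is not a bounded operator; only after it is removed by the interaction
   picture is the remaining field locally Lipschitz. For [alpha < 2] that field still costs a
   fraction of a derivative, since [xi / w] grows like [|xi|^(1 - alpha/2)]. This exponent is below
   1/2, whereas the increments of [u] have order above 1/2, so pointwise inequalities for powers
   suffice. For the energy, [u_x] need not be in L^2 and [u^(p+1) u_x] cannot be integrated
   directly; symmetric difference quotients replace the derivative.

   Uniqueness is part of the claim, and a competing solution is known only through an integral that
   is a limit of Riemann sums in the Sobolev norm. Hence a derivative is encoded by an estimate on
   short intervals with an arbitrary tag, which for continuous integrands amounts to the convergence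
   of such sums. A competitor then conserves the energy as well, so it solves the truncated
   equation, where Gronwall's argument applies. Functions are not identified almost everywhere, so
   the scalar product is only semidefinite. *)
Require Import Defs.
From mathcomp Require Import all_boot all_order all_algebra.
From mathcomp Require Import all_classical all_reals all_analysis.
From mathcomp Require Import measurable_realfun complex zify ring lra.
Import Order.TTheory GRing.Theory Num.Theory.
Import numFieldNormedType.Exports.

Set Implicit Arguments.
Unset Strict Implicit.
Unset Printing Implicit Defensive.

Local Open Scope classical_set_scope.
Local Open Scope ring_scope.

(** * Square-integrable functions on the line *)

Section toolkit.
Context {R : realType}.
Local Notation mu := (@lebesgue_measure R).
Implicit Types f g h : R -> R.

Definition msr f := measurable_fun [set: R] f.
Definition intg f := mu.-integrable setT (EFin \o f).
Definition ae_eqR f g := {ae mu, forall x, f x = g x}.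
Definition L2 f := msr f /\ intg (fun x => f x ^+ 2).
Definition ip f g := \int[mu]_x (f x * g x).

Lemma ae_imp (P Q : R -> Prop) : (forall x, P x -> Q x) ->
  {ae mu, forall x, P x} -> {ae mu, forall x, Q x}.
Proof.
by apply: (@filterS _ _ (ae_filter_ringOfSetsType (mu : {measure set _ -> \bar R}))).
Qed.

Lemma ae_imp2 (P Q S : R -> Prop) : (forall x, P x -> Q x -> S x) ->
  {ae mu, forall x, P x} -> {ae mu, forall x, Q x} -> {ae mu, forall x, S x}.
Proof.
by apply: (@filterS2 _ _ (ae_filter_ringOfSetsType (mu : {measure set _ -> \bar R}))).
Qed.

Lemma intg_msr f : intg f -> msr f.
Proof. by move=> /integrableP[] /measurable_EFinP. Qed.

Lemma intg_le f g : msr f -> intg g -> (forall x, `|f x| <= g x) -> intg f.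
Proof.
move=> mf ig fg; apply: (le_integrable _ _ _ ig) => //; first exact/measurable_EFinP.
by move=> x _ /=; rewrite lee_fin (le_trans (fg x))// ler_norm.
Qed.

Lemma intgD f g : intg f -> intg g -> intg (fun x => f x + g x).
Proof. by move=> fi gi; exact: (integrableD measurableT fi gi). Qed.

Lemma intgZ a f : intg f -> intg (fun x => a * f x).
Proof. by move=> fi; exact: (integrableZl measurableT a fi). Qed.

Lemma intgN f : intg f -> intg (fun x => - f x).
Proof. by move=> /(intgZ (-1)); congr intg; apply/funext => x; rewrite mulN1r. Qed.

Lemma intgB f g : intg f -> intg g -> intg (fun x => f x - g x).
Proof. by move=> fi /intgN; exact: intgD. Qed.

Lemma intg_norm f : intg f -> intg (fun x => `|f x|).
Proof.
move=> fi; apply: (le_integrable _ _ _ fi) => //.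
  apply/measurable_EFinP; apply: measurableT_comp => //; exact: intg_msr.
by move=> x _ /=; rewrite normr_id.
Qed.

Lemma intg_mulb f h M : intg f -> msr h -> (forall x, `|h x| <= M) ->
  intg (fun x => h x * f x).
Proof.
move=> fi mh hM; apply: (@intg_le _ (fun x => M * `|f x|)).
- by apply: measurable_funM => //; exact: intg_msr.
- exact/intgZ/intg_norm.
- by move=> x; rewrite normrM ler_wpM2r.
Qed.

Lemma intg0 : intg (fun=> 0).
Proof. exact: integrable0. Qed.

Lemma intg_sum n (F : nat -> R -> R) : (forall k, intg (F k)) ->
  intg (fun x => \sum_(k < n) F k x).
Proof.
move=> h; elim: n => [|n ih].
  by under eq_fun do rewrite big_ord0; exact: intg0.
by under eq_fun do rewrite big_ord_recr/=; exact: intgD.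
Qed.

Lemma int_D f g : intg f -> intg g ->
  \int[mu]_x (f x + g x) = \int[mu]_x f x + \int[mu]_x g x.
Proof. by move=> fi gi; rewrite RintegralD. Qed.

Lemma int_B f g : intg f -> intg g ->
  \int[mu]_x (f x - g x) = \int[mu]_x f x - \int[mu]_x g x.
Proof. by move=> fi gi; rewrite RintegralB. Qed.

Lemma int_Z a f : intg f -> \int[mu]_x (a * f x) = a * \int[mu]_x f x.
Proof. by move=> fi; rewrite RintegralZl. Qed.

Lemma int_le f g : intg f -> intg g -> (forall x, f x <= g x) ->
  \int[mu]_x f x <= \int[mu]_x g x.
Proof. by move=> fi gi fg; apply: le_Rintegral. Qed.

Lemma int_ge0 f : (forall x, 0 <= f x) -> 0 <= \int[mu]_x f x.
Proof. by move=> f0; apply: Rintegral_ge0. Qed.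

Lemma int_norm f : intg f -> `|\int[mu]_x f x| <= \int[mu]_x `|f x|.
Proof. by move=> fi; apply: le_normr_Rintegral. Qed.

Lemma EFin_int f : intg f -> (\int[mu]_x f x)%:E = (\int[mu]_x (f x)%:E)%E.
Proof. by move=> fi; rewrite /Rintegral fineK//; exact: integrable_fin_num. Qed.

Lemma intg_ge0 f : msr f -> (forall x, 0 <= f x) ->
  intg f <-> (\int[mu]_x (f x)%:E < +oo)%E.
Proof.
move=> mf f0; split=> [/integrableP[_]|h].
  by under eq_integral do rewrite /= ger0_norm ?f0//.
apply/integrableP; split; first exact/measurable_EFinP.
by under eq_integral do rewrite /= ger0_norm ?f0//.
Qed.

Lemma intg_ge0_le f c : msr f -> (forall x, 0 <= f x) ->
  (\int[mu]_x (f x)%:E <= c%:E)%E -> intg f /\ \int[mu]_x f x <= c.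
Proof.
move=> mf f0 h; have fi : intg f by apply/intg_ge0 => //; rewrite (le_lt_trans h)// ltry.
by split => //; rewrite -lee_fin EFin_int.
Qed.

Lemma ae_refl f : ae_eqR f f. Proof. exact: aeW. Qed.

Lemma ae_sym f g : ae_eqR f g -> ae_eqR g f.
Proof. by apply: ae_imp => x ->. Qed.

Lemma ae_trans f g h : ae_eqR f g -> ae_eqR g h -> ae_eqR f h.
Proof. by apply: ae_imp2 => x -> ->. Qed.

Lemma int_ae f g : msr f -> msr g -> ae_eqR f g ->
  \int[mu]_x f x = \int[mu]_x g x.
Proof.
move=> mf mg fg; rewrite /Rintegral; congr fine; apply: ae_eq_integral => //; try exact/measurable_EFinP.
by apply: ae_imp fg => x /= -> _.
Qed.

Lemma intg_ae f g : msr g -> ae_eqR f g -> intg f -> intg g.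
Proof.
move=> mg fg fi; apply/integrableP; split; first exact/measurable_EFinP.
have /integrableP[_] := fi; apply: le_lt_trans.
rewrite le_eqVlt; apply/orP; left; apply/eqP; apply: ae_eq_integral => //.
- by apply: measurableT_comp => //; exact/measurable_EFinP.
- by apply: measurableT_comp => //; apply/measurable_EFinP; exact: intg_msr.
- by apply: ae_imp fg => x /= -> _.
Qed.

Lemma int_ae0 f : intg f -> (forall x, 0 <= f x) -> \int[mu]_x f x = 0 ->
  ae_eqR f (fun=> 0).
Proof.
move=> fi f0 If; have : (\int[mu]_x `|(f x)%:E| = 0)%E.
  under eq_integral do rewrite /= ger0_norm//.
  by rewrite -EFin_int// If.
move/(ae_eq_integral_abs mu measurableT (f := EFin \o f)) => /(_ _)[].
  by apply/measurable_EFinP; exact: intg_msr.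
move=> N [mN N0 sN]; exists N; split => //; apply: subset_trans sN => x /=.
by apply: contra_not => /(_ I) [].
Qed.

Lemma msrD f g : msr f -> msr g -> msr (fun x => f x + g x).
Proof. exact: measurable_funD. Qed.
Lemma msrB f g : msr f -> msr g -> msr (fun x => f x - g x).
Proof. exact: measurable_funB. Qed.
Lemma msrM f g : msr f -> msr g -> msr (fun x => f x * g x).
Proof. exact: measurable_funM. Qed.
Lemma msrX n f : msr f -> msr (fun x => f x ^+ n).
Proof. exact: measurable_funX. Qed.
Lemma msr_cst c : msr (fun=> c).
Proof. exact: measurable_cst. Qed.
Lemma msr_norm f : msr f -> msr (fun x => `|f x|).
Proof. by move=> mf; exact: measurableT_comp. Qed.
Lemma msr_comp f h : msr f -> msr h -> msr (fun x => f (h x)).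
Proof. by move=> mf mh; exact: (measurableT_comp mf mh). Qed.
Lemma msr_cont f : continuous f -> msr f.
Proof. exact: continuous_measurable_fun. Qed.
Lemma msr_id : msr id. Proof. exact: measurable_id. Qed.
Lemma msrN f : msr f -> msr (fun x => - f x).
Proof. by move=> mf; exact: (measurableT_comp _ mf). Qed.

Lemma msr_opp : msr -%R. Proof. exact: oppr_measurable. Qed.

Lemma msr_shift c : msr (fun x => x + c).
Proof. by apply: msrD; [exact: msr_id|exact: msr_cst]. Qed.

Lemma L2_msr f : L2 f -> msr f. Proof. by case. Qed.

Lemma L2M f g : L2 f -> L2 g -> intg (fun x => f x * g x).
Proof.
move=> [mf fi] [mg gi].
apply: (@intg_le _ (fun x => f x ^+ 2 + g x ^+ 2)); [exact: msrM|exact: intgD|].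
move=> x; rewrite normrM -(real_normK (num_real (f x))) -(real_normK (num_real (g x))).
have := sqr_ge0 (`|f x| - `|g x|); have := sqr_ge0 (`|f x| + `|g x|); nra.
Qed.

Lemma L2D f g : L2 f -> L2 g -> L2 (fun x => f x + g x).
Proof.
move=> fL gL; split; first by apply: msrD; exact: L2_msr.
have -> : (fun x => (f x + g x) ^+ 2) = (fun x => (f x ^+ 2 + g x ^+ 2) + 2 * (f x * g x)).
  by apply/funext => x; ring.
by apply: intgD; [apply: intgD; [apply fL|apply gL]|exact/intgZ/L2M].
Qed.

Lemma L2_mulb f h M : L2 f -> msr h -> (forall x, `|h x| <= M) ->
  L2 (fun x => h x * f x).
Proof.
move=> [mf fi] mh hM; split; first exact: msrM.
under eq_fun do rewrite exprMn.
apply: (@intg_mulb _ _ (M ^+ 2)) => //; first exact: msrX.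
move=> x; rewrite normrX lerXn2r// nnegrE//.
by rewrite (le_trans _ (hM x)).
Qed.

Lemma L2Z a f : L2 f -> L2 (fun x => a * f x).
Proof. by move=> fL; apply: (@L2_mulb _ _ `|a|) => //; exact: msr_cst. Qed.

Lemma L2N f : L2 f -> L2 (fun x => - f x).
Proof. by move=> /(L2Z (-1)); congr L2; apply/funext => x; rewrite mulN1r. Qed.

Lemma L2B f g : L2 f -> L2 g -> L2 (fun x => f x - g x).
Proof. by move=> fi /L2N; exact: L2D. Qed.

Lemma L20 : L2 (fun=> 0).
Proof. by split; [exact: msr_cst|under eq_fun do rewrite expr0n; exact: intg0]. Qed.

Lemma L2_le f g : msr f -> L2 g -> (forall x, `|f x| <= `|g x|) -> L2 f.
Proof.
move=> mf [mg gi] fg; split => //; apply: intg_le gi _; first exact: msrX.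
by move=> x; rewrite normrX -(real_normK (num_real (g x))) lerXn2r ?nnegrE.
Qed.

Lemma L2_ae f g : msr g -> ae_eqR f g -> L2 f -> L2 g.
Proof.
move=> mg fg [mf fi]; split => //; apply: intg_ae fi; first exact: msrX.
by apply: ae_imp fg => x ->.
Qed.

Lemma ipC f g : ip f g = ip g f.
Proof. by rewrite /ip; under eq_Rintegral do rewrite mulrC. Qed.

Lemma ipDl f g h : L2 f -> L2 g -> L2 h ->
  ip (fun x => f x + g x) h = ip f h + ip g h.
Proof.
move=> fL gL hL; rewrite /ip -int_D; [|exact: L2M|exact: L2M].
by under eq_Rintegral do rewrite mulrDl.
Qed.

Lemma ipZl a f h : L2 f -> L2 h -> ip (fun x => a * f x) h = a * ip f h.
Proof.
move=> fL hL; rewrite /ip -int_Z; last exact: L2M.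
by under eq_Rintegral do rewrite -mulrA.
Qed.

Lemma ipNl f h : L2 f -> L2 h -> ip (fun x => - f x) h = - ip f h.
Proof.
move=> fL hL; rewrite -mulN1r -ipZl//; congr ip.
by apply/funext => x; rewrite mulN1r.
Qed.

Lemma ipBl f g h : L2 f -> L2 g -> L2 h ->
  ip (fun x => f x - g x) h = ip f h - ip g h.
Proof. by move=> fL gL hL; rewrite ipDl ?ipNl//; exact: L2N. Qed.

Lemma ip_sqr f : ip f f = \int[mu]_x (f x ^+ 2).
Proof. by rewrite /ip; under eq_Rintegral do rewrite -expr2. Qed.

Lemma ip_ge0 f : 0 <= ip f f.
Proof. by rewrite ip_sqr; apply: int_ge0 => x; exact: sqr_ge0. Qed.

Lemma ip_eq0 f : L2 f -> ip f f = 0 -> ae_eqR f (fun=> 0).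
Proof.
move=> fL; rewrite ip_sqr => /int_ae0 h.
apply: ae_imp (h _ _) => [x /eqP|//|x]; last exact: sqr_ge0.
  by rewrite sqrf_eq0 => /eqP.
by case: fL.
Qed.

Lemma ip_ae f f' g g' : L2 f -> L2 f' -> L2 g -> L2 g' ->
  ae_eqR f f' -> ae_eqR g g' -> ip f g = ip f' g'.
Proof.
move=> fL fL' gL gL' ff gg; apply: int_ae; try by apply: msrM; exact: L2_msr.
by apply: ae_imp2 ff gg => x -> ->.
Qed.


(** By uniqueness of the Lebesgue measure, it is enough to compare both measures on half-open
    intervals. *)
Lemma lebesgue_measure_shift c (A : set R) : measurable A ->
  pushforward mu (fun x : R => x + c : measurableTypeR R) A = mu A.
Proof.
move=> mA; apply/esym/lebesgue_measure_unique => //=; first exact: msr_shift.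
move=> _ X [[a b] /= ab <-]; rewrite /pushforward/=.
rewrite lebesgue_measure_itv/=.
have -> : (fun x : R => x + c) @^-1` `]a, b] = `]a - c, b - c]%classic.
  by apply/seteqP; split => x /=; rewrite !in_itv/= ltrBlDr lerBrDr.
by rewrite lebesgue_measure_itv/= !lte_fin ltrD2r; case: ifPn => // _; congr EFin; ring.
Qed.

Lemma eint_shift c (f : R -> \bar R) : measurable_fun [set: R] f -> (forall x, 0 <= f x)%E ->
  (\int[mu]_x f (x + c)%R = \int[mu]_x f x)%E.
Proof.
move=> mf f0.
have := @ge0_integral_pushforward _ _ _ _ R (fun x : measurableTypeR R => x + c : measurableTypeR R)
  (msr_shift c) mu setT f measurableT mf (fun y _ => f0 y).
rewrite preimage_setT => <-.
by apply: esym; apply: eq_measure_integral; [exact: (msr_shift c)|move=> ? A mA _; rewrite -[LHS](lebesgue_measure_shift c mA)].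
Qed.

Lemma eint_opp (f : R -> \bar R) : measurable_fun [set: R] f -> (forall x, 0 <= f x)%E ->
  (\int[mu]_x f (- x)%R = \int[mu]_x f x)%E.
Proof.
move=> mf f0.
have := @ge0_integral_pushforward _ _ _ _ R (fun x : measurableTypeR R => - x : measurableTypeR R)
  msr_opp mu setT f measurableT mf (fun y _ => f0 y).
rewrite preimage_setT => <-.
by apply: esym; apply: eq_measure_integral; [exact: (msr_opp)|move=> ? A mA _; rewrite -[LHS](lebesgue_measureN mA)].
Qed.

Lemma intg_shift c f : intg f -> intg (fun x => f (x + c)).
Proof.
move=> fi; have mf := intg_msr fi; apply/integrableP; split.
  by apply/measurable_EFinP; apply: msr_comp => //; exact: msr_shift.
rewrite (@eint_shift c (fun x => `|(f x)%:E|%E)) => //; first by case/integrableP: fi.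
by apply: measurableT_comp => //; exact/measurable_EFinP.
Qed.

Lemma intg_opp f : intg f -> intg (fun x => f (- x)).
Proof.
move=> fi; have mf := intg_msr fi; apply/integrableP; split.
  by apply/measurable_EFinP; apply: msr_comp => //; exact: msr_opp.
rewrite (@eint_opp (fun x => `|(f x)%:E|%E)) => //; first by case/integrableP: fi.
by apply: measurableT_comp => //; exact/measurable_EFinP.
Qed.

Lemma int_shift c f : intg f -> \int[mu]_x f (x + c) = \int[mu]_x f x.
Proof.
move=> fi; rewrite /Rintegral; congr fine.
have := @integral_pushforward _ _ _ _ R (fun x : measurableTypeR R => x + c : measurableTypeR R)
  (msr_shift c) mu setT (EFin \o f) _ _ measurableT.
rewrite preimage_setT => <-.
- by apply: esym; apply: eq_measure_integral; [exact: (msr_shift c)|move=> ? A mA _; rewrite -[LHS](lebesgue_measure_shift c mA)].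
- by apply/measurable_EFinP; exact: intg_msr.
- exact: (intg_shift c fi).
Qed.

Lemma int_opp f : intg f -> \int[mu]_x f (- x) = \int[mu]_x f x.
Proof.
move=> fi; rewrite /Rintegral; congr fine.
have := @integral_pushforward _ _ _ _ R (fun x : measurableTypeR R => - x : measurableTypeR R)
  msr_opp mu setT (EFin \o f) _ _ measurableT.
rewrite preimage_setT => <-.
- by apply: esym; apply: eq_measure_integral; [exact: (msr_opp)|move=> ? A mA _; rewrite -[LHS](lebesgue_measureN mA)].
- by apply/measurable_EFinP; exact: intg_msr.
- exact: (intg_opp fi).
Qed.

Lemma int_odd f : intg f -> (forall x, f (- x) = - f x) -> \int[mu]_x f x = 0.
Proof.
move=> fi fodd; have := int_opp fi.
under eq_Rintegral do rewrite fodd -mulN1r.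
by rewrite int_Z// => h; lra.
Qed.

Lemma L2_shift c f : L2 f -> L2 (fun x => f (x + c)).
Proof.
move=> [mf fi]; split; first by apply: msr_comp => //; exact: msr_shift.
exact: (intg_shift c fi).
Qed.

Lemma L2_opp f : L2 f -> L2 (fun x => f (- x)).
Proof.
move=> [mf fi]; split; first by apply: msr_comp => //; exact: msr_opp.
exact: (intg_opp fi).
Qed.

Lemma ip_shift c f g : L2 f -> L2 g -> ip (fun x => f (x + c)) (fun x => g (x + c)) = ip f g.
Proof. by move=> fL gL; exact: (int_shift c (L2M fL gL)). Qed.

Lemma ip_opp f g : L2 f -> L2 g -> ip (fun x => f (- x)) (fun x => g (- x)) = ip f g.
Proof. by move=> fL gL; exact: (int_opp (L2M fL gL)). Qed.

Lemma ae_opp (P : R -> Prop) : {ae mu, forall x, P x} -> {ae mu, forall x, P (- x)}.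
Proof.
move=> [N [mN N0 sN]]; exists ((fun x => - x) @^-1` N); split.
- by rewrite -[X in measurable X]setTI; exact: msr_opp.
- by rewrite -N0; exact: lebesgue_measureN.
- by move=> x /= h; apply: sN.
Qed.

(** For [c > 0] the polynomial is evaluated at its vertex [- b / c]. For [c = 0] and [b != 0] it is
    affine and takes the value -1 at the point chosen below. The degenerate case matters because the
    scalar products to which this is applied are only semidefinite. *)
Lemma quad_discr (a b c : R) : 0 <= c -> (forall t, 0 <= a + 2 * b * t + c * t ^+ 2) -> b ^+ 2 <= a * c.
Proof.
move=> c0 h; have [cp|] := ltP 0 c.
  have h1 := h (- (b / c)).
  have : 0 <= (a + 2 * b * (- (b / c)) + c * (- (b / c)) ^+ 2) * c by rewrite mulr_ge0// ltW.
  have -> : (a + 2 * b * (- (b / c)) + c * (- (b / c)) ^+ 2) * c = a * c - b ^+ 2.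
    by field; rewrite gt_eqF.
  by rewrite subr_ge0.
move=> c1; have c00 : c = 0 by apply/eqP; rewrite eq_le c0 c1.
subst c; rewrite mulr0.
have [->|bn0] := eqVneq b 0; first by rewrite expr0n.
have := h (- (a + 1) / (2 * b)); rewrite mul0r addr0.
have -> : a + 2 * b * (- (a + 1) / (2 * b)) = -1 by field; exact: bn0.
by rewrite oppr_ge0 ler10.
Qed.

Lemma cauchy_schwarz f g : L2 f -> L2 g -> ip f g ^+ 2 <= ip f f * ip g g.
Proof.
move=> fL gL; apply: quad_discr; first exact: ip_ge0.
move=> t; have := ip_ge0 (fun x => f x + t * g x).
have tgL := L2Z t gL.
rewrite ipDl//; last exact: L2D.
rewrite ipZl//; last exact: L2D.
rewrite !(ipC _ (fun x => f x + t * g x)) !ipDl// !ipZl// (ipC g f).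
by congr (_ <= _); ring.
Qed.

End toolkit.

(** * Limit theorems, Fubini's theorem and completeness of L^2 *)

Section convergence.
Context {R : realType}.
Local Notation mu := (@lebesgue_measure R).
Implicit Types f g h : R -> R.

Lemma cvgn_eps (u : nat -> R) l : u @ \oo --> l <->
  forall e, 0 < e -> exists N, forall n, (N <= n)%N -> `|u n - l| <= e.
Proof.
split=> [/cvgrPdist_le h e e0|h].
  by have [N _ NP] := h e e0; exists N => n Nn; rewrite distrC; exact: NP.
apply/cvgrPdist_le => e e0; have [N NP] := h e e0; exists N => // n Nn.
by rewrite distrC; exact: NP.
Qed.

Lemma cvg_sqr (u : nat -> R) (l : R) : u @ \oo --> l -> (fun n => u n ^+ 2) @ \oo --> l ^+ 2.
Proof. by move=> ul; rewrite expr2; under eq_fun do rewrite expr2; exact: cvgM. Qed.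

Lemma cvg_EFinR (u : nat -> R) l : u @ \oo --> l -> (u n)%:E @[n --> \oo] --> l%:E.
Proof. by move=> ul; apply/fine_cvgP; split => //; exact: nearW. Qed.

Lemma dom_cvg (F : nat -> R -> R) f g : (forall n, msr (F n)) -> msr f ->
  {ae mu, forall x, F ^~ x @ \oo --> f x} -> intg g ->
  (forall n x, `|F n x| <= g x) ->
  intg f /\ (fun n => \int[mu]_x F n x) @ \oo --> \int[mu]_x f x.
Proof.
move=> mF mf Ff gi Fg.
have [] := @dominated_convergence _ _ R mu setT measurableT
  (fun n x => (F n x)%:E) (EFin \o f) (EFin \o g).
- by move=> n; apply/measurable_EFinP; exact: mF.
- exact/measurable_EFinP.
- apply: ae_imp Ff => x Fx _; exact: cvg_EFinR Fx.
- exact: gi.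
- by apply: aeW => x n _ /=; rewrite lee_fin.
move=> fi _ h; split => //.
suff : ((\int[mu]_x F n x)%:E @[n --> \oo] --> (\int[mu]_x f x)%:E)%E.
  by move/fine_cvgP => [].
have Fi n : intg (F n) by apply: intg_le gi (Fg n).
rewrite EFin_int//; apply: cvg_trans h; apply: near_eq_cvg.
by apply: nearW => n /=; rewrite EFin_int.
Qed.

(** Without a dominating function, integrability of the limit is a conclusion: this is how limits
    are shown to belong to L^2. *)
Lemma fatouR (F : nat -> R -> R) g c : (forall n, intg (F n)) ->
  (forall n x, 0 <= F n x) -> msr g -> (forall x, 0 <= g x) ->
  {ae mu, forall x, F ^~ x @ \oo --> g x} ->
  (forall n, \int[mu]_x F n x <= c) -> intg g /\ \int[mu]_x g x <= c.
Proof.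
move=> Fi F0 mg g0 Fg Fc; apply: intg_ge0_le => //.
have -> : (\int[mu]_x (g x)%:E = \int[mu]_x limn_einf (fun n => (F n x)%:E))%E.
  apply: ae_eq_integral => //; first exact/measurable_EFinP.
    apply: measurableT_comp => //.
    apply: (measurable_fun_limn_esup (f := fun n x => (- (F n x)%:E)%E)) => n.
    by apply: measurableT_comp => //; apply/measurable_EFinP; exact: intg_msr.
  apply: ae_imp Fg => x /cvg_EFinR Fx _.
  by have [-> _] := cvg_limn_einf_sup Fx.
apply: le_trans (fatou _ _ _ _) _ => //.
- by move=> n; apply/measurable_EFinP; exact: intg_msr.
- by move=> n x _; rewrite lee_fin.
rewrite limn_einf_lim; apply: lime_le; first exact: is_cvg_einfs.
apply: nearW => n; apply: le_trans (_ : _ <= (\int[mu]_x (F n x)%:E))%E _.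
  by apply: ereal_inf_lbound; exists n => //=.
by rewrite -EFin_int// lee_fin.
Qed.

(** Integrability is asked of every slice, not of almost every one, so that the real-valued inner
    integrals coincide everywhere with the extended ones. *)
Lemma fubiniR (F : R -> R -> R) :
  measurable_fun [set: R * R] (fun z : R * R => F z.1 z.2) ->
  (forall x, intg (F x)) -> (forall y, intg (F ^~ y)) ->
  (\int[mu]_x \int[mu]_y `|F x y|%:E < +oo)%E ->
  [/\ intg (fun x => \int[mu]_y F x y), intg (fun y => \int[mu]_x F x y) &
   \int[mu]_x \int[mu]_y F x y = \int[mu]_y \int[mu]_x F x y].
Proof.
move=> mF F1 F2 Ffin.
pose G := fun z : R * R => (F z.1 z.2)%:E.
have iG : (mu \x mu)%E.-integrable setT G.
  apply/integrable12ltyP; first exact/measurable_EFinP.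
  exact: Ffin.
have E1 : (fun x => \int[mu]_y G (x, y))%E = EFin \o (fun x => \int[mu]_y F x y).
  by apply/funext => x /=; rewrite EFin_int.
have E2 : (fun y => \int[mu]_x G (x, y))%E = EFin \o (fun y => \int[mu]_x F x y).
  by apply/funext => y /=; rewrite (EFin_int (F2 y)).
have i1 : intg (fun x => \int[mu]_y F x y).
  by rewrite /intg -E1; exact: (integrable_fubini_F iG).
have i2 : intg (fun x => \int[mu]_y F y x).
  rewrite /intg -E2.
  have mG' : measurable_fun [set: R * R] (fun z : R * R => G (z.2, z.1)).
    by apply/measurable_EFinP; exact: (measurableT_comp mF (measurable_fun_pair measurable_snd measurable_fst)).
  have iG' : (mu \x mu)%E.-integrable setT (fun z : R * R => G (z.2, z.1)).
    apply/integrable12ltyP; first exact: mG'.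
    have := @fubini_tonelli _ _ _ _ R mu mu (fun z : R * R => `|F z.1 z.2|%:E).
    by move=> /= <- //; apply/measurable_EFinP; exact: measurableT_comp.
  exact: (integrable_fubini_F iG').
split; [exact: i1|exact: i2|apply: EFin_inj].
rewrite (EFin_int i1) (EFin_int i2).
transitivity (\int[mu]_x \int[mu]_y G (x, y))%E; first by rewrite E1.
by rewrite (Fubini iG) E2.
Qed.

Definition n2 f := ip f f.

Lemma msr2_fst f : msr f -> measurable_fun [set: R * R] (fun z : R * R => f z.1).
Proof. by move=> mf; exact: (measurableT_comp mf measurable_fst). Qed.

Lemma msr2_snd f : msr f -> measurable_fun [set: R * R] (fun z : R * R => f z.2).
Proof. by move=> mf; exact: (measurableT_comp mf measurable_snd). Qed.

Lemma n2_ge0 f : 0 <= n2 f. Proof. exact: ip_ge0. Qed.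

Lemma geometric_eseries_half_lty :
  (\sum_(0 <= k <oo) (2 / (2 ^ (k + 1))%:R : R)%:E < +oo)%E.
Proof.
have /cvg_lim -> // := @cvg_geometric_eseries_half R 2 0.
by rewrite ltry.
Qed.

(** Riesz-Fischer. Along a fast subsequence the increments [d k] satisfy [n2 (d k) <= 2^-k / 4^k],
    so the sum of the [4^k d_k^2] is integrable, hence finite almost everywhere. There each [|d k|]
    is at most a constant times [2^-k] and the subsequence converges. *)
Lemma L2_complete (f : nat -> R -> R) : (forall n, L2 (f n)) ->
  (forall e, 0 < e -> exists N, forall m n, (N <= m)%N -> (N <= n)%N ->
     n2 (fun x => f m x - f n x) <= e) ->
  exists2 g, L2 g & forall e, 0 < e -> exists N, forall n, (N <= n)%N ->
     n2 (fun x => g x - f n x) <= e.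
Proof.
move=> fL fC.
have ep k : 0 < (2 / (2 ^ (k + 1))%:R : R) / 4 ^+ k.
  by rewrite !divr_gt0// ?exprn_gt0// ltr0n expn_gt0.
have [N NP] : {N : nat -> nat & forall k m n, (N k <= m)%N -> (N k <= n)%N ->
    n2 (fun x => f m x - f n x) <= (2 / (2 ^ (k + 1))%:R : R) / 4 ^+ k}.
  exists (fun k => sval (cid (fC _ (ep k)))) => k m n.
  by case: cid => /= M h; exact: h.
(* Summing all thresholds up to [k], and [k] itself, makes [phi] nondecreasing, unbounded and at
   least [N k]. *)
pose phi k := (k + \sum_(i < k.+1) N i)%N.
have phiN k : (N k <= phi k)%N by rewrite /phi big_ord_recr/=; lia.
have phiS k : (phi k <= phi k.+1)%N by rewrite /phi [in leqRHS]big_ord_recr/=; lia.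
have phik k : (k <= phi k)%N by rewrite /phi leq_addr.
pose d k x := f (phi k.+1) x - f (phi k) x.
have dL k : L2 (d k) by apply: L2B.
have d2 k : n2 (d k) <= (2 / (2 ^ (k + 1))%:R : R) / 4 ^+ k.
  by apply: NP => //; exact: leq_trans (phiN k) (phiS k).
pose s k x := 4 ^+ k * d k x ^+ 2.
have s0 k x : 0 <= s k x by rewrite mulr_ge0 ?sqr_ge0// exprn_ge0.
have si k : intg (s k) by apply: intgZ; case: (dL k).
have ms k : measurable_fun [set: R] (fun x => (s k x)%:E).
  by apply/measurable_EFinP; exact: intg_msr.
pose S x := (\sum_(0 <= k <oo) (s k x)%:E)%E.
have mS : measurable_fun [set: R] S.
  by apply: ge0_emeasurable_sum => // k x _ _; rewrite lee_fin.
have S0 x : (0 <= S x)%E by apply: nneseries_ge0 => k _ _; rewrite lee_fin.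
have Sfin : (\int[mu]_x S x < +oo)%E.
  rewrite integral_nneseries//; last by move=> k x _; rewrite lee_fin.
  apply: le_lt_trans geometric_eseries_half_lty.
  apply: lee_nneseries => [k _ _|k _].
    by apply: integral_ge0 => x _; rewrite lee_fin.
  rewrite -EFin_int// lee_fin /s int_Z; last by case: (dL k).
  by rewrite -ip_sqr mulrC -ler_pdivlMr ?exprn_gt0// d2.
have iS : mu.-integrable setT S.
  by apply/integrableP; split => //; under eq_integral do rewrite gee0_abs//.
have aeS := integrable_ae measurableT iS.
(* As the finite part of an upper limit, [g] is measurable without any knowledge of where the
   subsequence converges. *)
pose F x := limn_esup (fun k => (f (phi k) x)%:E).
pose g x := fine (F x).
have mF : measurable_fun [set: R] F.
  apply: (measurable_fun_limn_esup (f := fun k x => (f (phi k) x)%:E)) => k.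
  by apply/measurable_EFinP; exact: L2_msr.
have mg : msr g by exact: measurableT_comp.
have aeg : {ae mu, forall x, (fun k => f (phi k) x) @ \oo --> g x}.
  apply: ae_imp aeS => x /(_ I) Sx.
  suff /cvg_ex[l fl] : cvgn (fun k => f (phi k) x).
    rewrite /g /F; have fl' := cvg_EFinR fl.
    by have [_ ->] := cvg_limn_einf_sup fl'.
  (* A single term [4^k d_k^2] is at most [S x]; the factor [1 + S] stands in for the square root of
     [S]. *)
  have dS k : `|d k x| <= geometric (1 + fine (S x)) 2^-1 k.
    have : s k x <= fine (S x).
      rewrite -lee_fin fineK//; apply: le_trans (nneseries_lim_ge k.+1 _) => [|i _ _].
        rewrite big_nat_recr//= leeDr// sume_ge0// => i _; by rewrite lee_fin.
      by rewrite lee_fin.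
    rewrite /s /geometric/= => h.
    have F0 : 0 <= fine (S x) by exact: fine_ge0.
    have -> : (1 + fine (S x)) * 2^-1 ^+ k = (1 + fine (S x)) / 2 ^+ k by rewrite exprVn.
    rewrite ler_pdivlMr ?exprn_gt0//.
    rewrite -(ger0_norm (_ : 0 <= (2 : R) ^+ k)) ?exprn_ge0// -normrM.
    have h2 : (d k x * 2 ^+ k) ^+ 2 <= fine (S x).
      by rewrite exprMn -exprM mulnC exprM mulrC (_ : 2 ^+ 2 = 4) //; ring.
    rewrite -[leLHS]normr_id ler_norml; have := normr_ge0 (d k x * 2 ^+ k).
    rewrite -real_normK ?num_real// in h2; nra.
  have : cvgn (series (d ^~ x)).
    apply: normed_cvg; apply: series_le_cvg dS _ => //.
      by move=> n; rewrite /geometric/= mulr_ge0// ?exprn_ge0// addr_ge0// fine_ge0.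
    by apply: is_cvg_geometric_series; rewrite ger0_norm// invf_lt1// ltr1n.
  have -> : series (d ^~ x) = (fun k => f (phi k) x - f (phi 0%N) x).
    exact: (telescopeK (fun k => f (phi k) x)).
  move=> /cvg_ex[l hl]; apply/cvg_ex; exists (l + f (phi 0%N) x).
  have -> : (fun k => f (phi k) x) =
      (fun k => f (phi k) x - f (phi 0%N) x) \+ cst (f (phi 0%N) x).
    by apply/funext => k /=; rewrite subrK.
  exact: cvgD hl (cvg_cst _).
(* The shift by [M] puts the whole subsequence past the Cauchy threshold, and Fatou's lemma carries
   the bound to the limit. *)
have key e : 0 < e -> exists N, forall n, (N <= n)%N ->
    intg (fun x => (g x - f n x) ^+ 2) /\ \int[mu]_x ((g x - f n x) ^+ 2) <= e.
  move=> e0; have [M MP] := fC _ e0; exists M => n Mn.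
  apply: (@fatouR (fun k x => (f (phi (k + M)%N) x - f n x) ^+ 2)).
  - by move=> k; have [] := L2B (fL (phi (k + M)%N)) (fL n).
  - by move=> k x; exact: sqr_ge0.
  - by apply: msrX; apply: msrB => //; exact: L2_msr.
  - by move=> x; exact: sqr_ge0.
  - apply: ae_imp aeg => x gx.
    have {}gx : (fun k => f (phi (k + M)%N) x) @ \oo --> g x.
      by move: gx; rewrite -(cvg_shiftn M).
    by apply: cvg_sqr; apply: cvgB gx (cvg_cst _).
  - move=> k; rewrite -ip_sqr; apply: MP => //.
    by rewrite (leq_trans _ (phik _))// leq_addl.
have gL : L2 g.
  have [M /(_ M (leqnn _))[gM _]] := key 1 ltr01.
  have := L2D (conj (msrB mg (L2_msr (fL M))) gM : L2 _) (fL M).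
  by congr L2; apply/funext => x; rewrite subrK.
exists g => // e e0; have [M MP] := key e e0; exists M => n Mn.
by rewrite /n2 ip_sqr; have [] := MP n Mn.
Qed.

End convergence.

(** * The Hartley transform *)

Section hartley1.
Context {R : realType}.
Local Notation mu := (@lebesgue_measure R).
Implicit Types f g h : R -> R.

Lemma fubini_dom (F : R -> R -> R) (G : R -> R) :
  measurable_fun [set: R * R] (fun z : R * R => F z.1 z.2) ->
  (forall x, intg (F x)) -> (forall y, intg (F ^~ y)) ->
  (forall x, \int[mu]_y `|F x y| <= G x) -> intg G ->
  [/\ intg (fun x => \int[mu]_y F x y), intg (fun y => \int[mu]_x F x y) &
   \int[mu]_x \int[mu]_y F x y = \int[mu]_y \int[mu]_x F x y].
Proof.
move=> mF F1 F2 FG iG; apply: fubiniR => //.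
apply: le_lt_trans (_ : _ <= \int[mu]_x (G x)%:E)%E _; last by rewrite -EFin_int// ltry.
apply: ge0_le_integral => //.
- by move=> x _; apply: integral_ge0 => y _; rewrite lee_fin.
- apply: (@measurable_fun_fubini_tonelli_F _ _ _ _ R mu (fun z : R * R => `|F z.1 z.2|%:E)).
    by apply/measurable_EFinP; apply: measurableT_comp.
  by move=> z; rewrite lee_fin.
- by apply/measurable_EFinP; exact: intg_msr.
- move=> x _; rewrite -EFin_int ?lee_fin//; exact: intg_norm.
Qed.

Lemma derive_continuous (f df : R -> R) :
  (forall x : R, is_derive x 1 f (df x)) -> continuous f.
Proof.
move=> h x; apply: differentiable_continuous; apply/derivable1_diffP.
by have [] := h x.
Qed.

Definition cas (x : R) : R := cos x + sin x.

Lemma continuous_cas : continuous cas.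
Proof. by move=> x; apply: cvgD; [exact: continuous_cos|exact: continuous_sin]. Qed.

Lemma msr_cas : msr cas. Proof. by apply: msr_cont; exact: continuous_cas. Qed.

Lemma cas_le2 x : `|cas x| <= 2.
Proof.
rewrite (le_trans (ler_normD _ _))// (_ : 2 = 1 + 1)// lerD//.
  by rewrite ler_norml cos_geN1 cos_le1.
by rewrite ler_norml sin_geN1 sin_le1.
Qed.

Lemma casM x y : cas x * cas y = cos (x - y) + sin (x + y).
Proof. by rewrite /cas cosB sinD; ring. Qed.

Lemma casD x y : cas (x + y) = cos y * cas x + sin y * cas (- x).
Proof. by rewrite /cas cosD sinD cosN sinN; ring. Qed.

Definition hartley1 f : R -> R := fun xi => \int[mu]_x (f x * cas (x * xi)).

Lemma intg_cas f xi : intg f -> intg (fun x => f x * cas (x * xi)).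
Proof.
move=> fi; under eq_fun do rewrite mulrC.
apply: (@intg_mulb _ f (fun x => cas (x * xi)) 2) => //; last by move=> x; exact: cas_le2.
apply: msr_comp; first exact: msr_cas.
by apply: msrM; [exact: msr_id|exact: msr_cst].
Qed.

Lemma intg_cas_sym f xi : intg f -> intg (fun x => f x * cas (xi * x)).
Proof. by move=> fi; under eq_fun do rewrite (mulrC xi); exact: intg_cas. Qed.

Lemma hartley1_bound f xi : intg f -> `|hartley1 f xi| <= 2 * \int[mu]_x `|f x|.
Proof.
move=> fi; have fc := intg_cas xi fi; apply: le_trans (int_norm fc) _.
rewrite -int_Z; last exact: intg_norm.
apply: int_le; [exact: intg_norm|exact/intgZ/intg_norm|].
by move=> x; rewrite normrM mulrC ler_wpM2r// cas_le2.
Qed.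

(** Multiplication formula: Fubini with the bounded symmetric kernel [cas (x * y)]. The
    integrability statement is also the source of the measurability of [hartley1]. *)
Lemma hartley1_mult f g : intg f -> intg g ->
  intg (fun xi => g xi * hartley1 f xi) /\ ip g (hartley1 f) = ip f (hartley1 g).
Proof.
move=> fi gi.
have mf := intg_msr fi; have mg := intg_msr gi.
have [] := @fubini_dom (fun x y => f x * (g y * cas (x * y)))
   (fun x => (2 * \int[mu]_y `|g y|) * `|f x|).
- apply: measurable_funM; first exact: (msr2_fst mf).
  apply: measurable_funM; first exact: (msr2_snd mg).
  apply: measurableT_comp; first exact: msr_cas.
  by apply: measurable_funM; [exact: measurable_fst|exact: measurable_snd].
- by move=> x; apply/intgZ/intg_cas_sym.
- move=> y; under eq_fun do rewrite mulrCA; exact/intgZ/intg_cas.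
- move=> x; rewrite -int_Z; last exact: intg_norm.
  rewrite mulrC -int_Z; last exact/intgZ/intg_norm.
  apply: int_le; [by apply/intg_norm/intgZ/intg_cas_sym|exact/intgZ/intgZ/intg_norm|].
  move=> y; rewrite !normrM ler_wpM2l// mulrC ler_wpM2r//; exact: cas_le2.
- exact/intgZ/intg_norm.
move=> i1 i2 e.
have E1 : (fun x => \int[mu]_y (f x * (g y * cas (x * y)))) = (fun x => f x * hartley1 g x).
  apply/funext => x; rewrite int_Z; last exact: intg_cas_sym.
  by congr (_ * _); apply: eq_Rintegral => y _; rewrite (mulrC x).
have E2 : (fun y => \int[mu]_x (f x * (g y * cas (x * y)))) = (fun y => g y * hartley1 f y).
  apply/funext => y; rewrite -int_Z; last exact: intg_cas.
  by apply: eq_Rintegral => x _; rewrite mulrCA.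
move: i2 e; rewrite E2 => i2 e; split; first exact: i2.
by rewrite /ip -e E1.
Qed.

End hartley1.

(** * Abel's summability factor and the Poisson kernel *)

Section poisson.
Context {R : realType}.
Local Notation mu := (@lebesgue_measure R).
Variable e : R.
Hypothesis e0 : 0 < e.

(** Abel's factor regularizes the inversion integral; its cosine transform is the Poisson kernel
    below, of total mass 2 pi. *)
Definition abel (xi : R) : R := expR (- (e * `|xi|)).
Definition poisson (z : R) : R := 2 * e / (e ^+ 2 + z ^+ 2).

Lemma pe_neq0 : e != 0.
Proof. by rewrite gt_eqF. Qed.

Lemma sqrD_gt0 z : 0 < e ^+ 2 + z ^+ 2.
Proof. by rewrite ltr_wpDr ?sqr_ge0// exprn_gt0. Qed.

Lemma sqrD_neq0 z : e ^+ 2 + z ^+ 2 != 0.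
Proof. by rewrite gt_eqF// sqrD_gt0. Qed.

(** An antiderivative of [exp (- e x) (1 + cos (z x))]. The summand 1 makes the integrand
    nonnegative, so that the fundamental theorem on a half-line applies; its contribution is
    subtracted afterwards. *)
Definition abel_prim (z x : R) := - expR (- (e * x)) / e +
  expR (- (e * x)) * (z * sin (z * x) - e * cos (z * x)) / (e ^+ 2 + z ^+ 2).

Lemma is_derive_abel_prim (z x : R) : is_derive x 1 (abel_prim z) (expR (- (e * x)) * (1 + cos (z * x))).
Proof.
rewrite /abel_prim; apply: is_derive_eq; rewrite /GRing.scale/=; field.
by rewrite pe_neq0 sqrD_neq0.
Qed.

Lemma cvg_expRN : expR (- (e * x)) @[x --> +oo] --> (0 : R).
Proof.
have h : (e * x) @[x --> +oo] --> +oo by apply: gt0_cvgMry e0 cvg_id.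
exact: (cvg_comp _ _ h (@cvgr_expR R)).
Qed.

Lemma abel_prim_cvg z : abel_prim z x @[x --> +oo] --> 0.
Proof.
pose M := e^-1 + (`|z| + e) / (e ^+ 2 + z ^+ 2).
have FM x : `|abel_prim z x| <= M * expR (- (e * x)).
  rewrite (le_trans (ler_normD _ _))// mulrDl lerD//.
    by rewrite normrM normrN (ger0_norm (expR_ge0 _)) normfV (gtr0_norm e0) mulrC.
  rewrite !normrM (ger0_norm (expR_ge0 _)) normfV (gtr0_norm (sqrD_gt0 z)).
  rewrite -mulrA mulrC ler_wpM2r ?expR_ge0// ler_wpM2r ?invr_ge0 ?(ltW (sqrD_gt0 _))//.
  rewrite (le_trans (ler_normB _ _))// !normrM lerD//.
    by rewrite ler_piMr// ler_norml sin_geN1 sin_le1.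
  by rewrite (gtr0_norm e0) ler_piMr ?(ltW e0)// ler_norml cos_geN1 cos_le1.
apply: norm_cvg0.
apply: (@squeeze_cvgr _ _ _ _ (cst 0) (fun x => M * expR (- (e * x)))).
- by apply: nearW => x /=; rewrite normr_ge0 FM.
- exact: cvg_cst.
- by rewrite -(mulr0 M); apply: cvgMl_tmp; exact: cvg_expRN.
Qed.

Lemma continuous_abel_cos (z : R) :
  continuous (fun x : R => expR (- (e * x)) * (1 + cos (z * x))).
Proof. by apply: derive_continuous => x; apply: is_derive_eq. Qed.

Lemma continuous_cosM (z : R) : continuous (fun x : R => cos (z * x)).
Proof. by apply: derive_continuous => x; apply: is_derive_eq. Qed.

Lemma continuous_sinM (z : R) : continuous (fun x : R => sin (z * x)).
Proof. by apply: derive_continuous => x; apply: is_derive_eq. Qed.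

Lemma continuous_abel : continuous abel.
Proof.
move=> x; apply: (@cvg_comp _ _ _ (fun x : R => `|x|) (fun x => expR (- (e * x))) _ _ _ (@norm_continuous _ R x)).
have : continuous (fun x : R => expR (- (e * x))) by apply: derive_continuous => y; apply: is_derive_eq.
exact.
Qed.

Lemma eint_abel_cos z : (\int[mu]_xi (abel xi * (1 + cos (z * xi)))%:E =
  (2 / e + poisson z)%:E)%E.
Proof.
rewrite ge0_symfun_integralT; first last.
- by move=> x; rewrite /abel/= normrN mulrN cosN.
- move=> x; apply: cvgM; first exact: continuous_abel.
  by apply: cvgD; [exact: cvg_cst|exact: continuous_cosM].
- move=> x; rewrite mulr_ge0 ?expR_ge0// -lerBlDl sub0r; exact: cos_geN1.
have -> : [set x : R | 0 <= x] = `[0, +oo[%classic.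
  by apply/seteqP; split => x /=; rewrite in_itv/= andbT.
under eq_integral.
  move=> x; rewrite inE/= in_itv/= andbT => x0; rewrite /abel ger0_norm//; over.
rewrite (ge0_continuous_FTC2y _ _ (abel_prim_cvg z)).
- rewrite -EFinB -EFinM /abel_prim /poisson mulr0 oppr0 expR0 mulr0 sin0 cos0; congr EFin.
  by field; rewrite pe_neq0 sqrD_neq0.
- by move=> x x0; rewrite mulr_ge0 ?expR_ge0// -lerBlDl sub0r; exact: cos_geN1.
- by apply: continuous_subspaceT; exact: continuous_abel_cos.
- by move=> x _; exact: ex_derive.
- apply: cvg_at_right_filter; apply: differentiable_continuous; apply/derivable1_diffP.
  exact: ex_derive.
- by move=> x _; rewrite derive1E; have [] := is_derive_abel_prim z x.
Qed.

Lemma msr_abel : msr abel.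
Proof.
by apply: msr_cont; exact: continuous_abel.
Qed.

Lemma abel_ge0 x : 0 <= abel x. Proof. exact: expR_ge0. Qed.

Lemma abel_le1 x : abel x <= 1.
Proof. by rewrite /abel -expR0 ler_expR oppr_le0 mulr_ge0// ltW. Qed.

Lemma msr_cosM (z : R) : msr (fun x => cos (z * x)).
Proof. by apply: msr_cont; exact: continuous_cosM. Qed.

Lemma msr_sinM (z : R) : msr (fun x => sin (z * x)).
Proof. by apply: msr_cont; exact: continuous_sinM. Qed.

Lemma intg_abel_1cos z : intg (fun x => abel x * (1 + cos (z * x))).
Proof.
apply/intg_ge0.
- by apply: msrM; [exact: msr_abel|apply: msrD; [exact: msr_cst|exact: msr_cosM]].
- by move=> x; rewrite mulr_ge0 ?expR_ge0// -lerBlDl sub0r; exact: cos_geN1.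
- by rewrite eint_abel_cos ltry.
Qed.

Lemma intg_abel : intg abel.
Proof.
have := intgZ (2^-1) (intg_abel_1cos 0); congr intg; apply/funext => x.
by rewrite mul0r cos0; field.
Qed.

Lemma intg_abel_cos z : intg (fun x => abel x * cos (z * x)).
Proof.
have := intgB (intg_abel_1cos z) intg_abel; congr intg; apply/funext => x; ring.
Qed.

Lemma int_abel : \int[mu]_x abel x = 2 / e.
Proof.
have h : \int[mu]_x (abel x * (1 + cos (0 * x))) = 2 / e + poisson 0.
  by apply: EFin_inj; rewrite (EFin_int (intg_abel_1cos 0)) eint_abel_cos.
have : \int[mu]_x (2 * abel x) = 2 / e + poisson 0.
  by rewrite -h; apply: eq_Rintegral => x _; rewrite mul0r cos0; ring.
rewrite int_Z; last exact: intg_abel.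
rewrite /poisson expr0n/= addr0 => h2.
have -> : 2 / e = 2^-1 * (2 / e + 2 * e / e ^+ 2) by field; exact: pe_neq0.
by rewrite -h2; field.
Qed.

Lemma int_abel_cos z : \int[mu]_x (abel x * cos (z * x)) = poisson z.
Proof.
have h : \int[mu]_x (abel x * (1 + cos (z * x))) = 2 / e + poisson z.
  by apply: EFin_inj; rewrite (EFin_int (intg_abel_1cos z)) eint_abel_cos.
have -> : \int[mu]_x (abel x * cos (z * x)) =
   \int[mu]_x (abel x * (1 + cos (z * x)) - abel x).
  by apply: eq_Rintegral => x _; ring.
rewrite int_B; [|exact: intg_abel_1cos|exact: intg_abel].
by rewrite h int_abel; ring.
Qed.

Lemma poisson_ge0 z : 0 <= poisson z.
Proof. by rewrite /poisson !mulr_ge0// ?invr_ge0 ltW// sqrD_gt0. Qed.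

Lemma is_derive_2atan (x : R) : is_derive x 1 (fun x => 2 * atan (x / e)) (poisson x).
Proof.
apply: is_derive_eq; rewrite /GRing.scale/= /poisson; field.
by rewrite pe_neq0 sqrD_neq0.
Qed.

Lemma continuous_poisson : continuous poisson.
Proof.
move=> x; apply: cvgM; first exact: cvg_cst.
apply: cvgV; first exact: sqrD_neq0.
by apply: cvgD; [exact: cvg_cst|exact: exprn_continuous].
Qed.

Lemma eint_poisson : (\int[mu]_z (poisson z)%:E = (2 * pi)%:E)%E.
Proof.
rewrite ge0_symfun_integralT; first last.
- by move=> x; rewrite /poisson/= sqrrN.
- exact: continuous_poisson.
- exact: poisson_ge0.
have -> : [set x : R | 0 <= x] = `[0, +oo[%classic.
  by apply/seteqP; split => x /=; rewrite in_itv/= andbT.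
have h : 2 * atan (x / e) @[x --> +oo] --> 2 * (pi / 2).
  apply: cvgMl_tmp; apply: (@cvg_comp _ _ _ (fun x => x / e) (@atan R) _ _ _ _ (@cvgy_atan R)).
  by apply: gt0_cvgMly cvg_id; rewrite invr_gt0.
rewrite (ge0_continuous_FTC2y _ _ h).
- rewrite -EFinB -EFinM mul0r atan0; congr EFin; by field.
- by move=> x x0; exact: poisson_ge0.
- by apply: continuous_subspaceT; exact: continuous_poisson.
- by move=> x _; exact: ex_derive.
- apply: cvg_at_right_filter.
  by have /(_ 0) := @derive_continuous R (fun x => 2 * atan (x / e)) poisson is_derive_2atan.
- by move=> x _; rewrite derive1E; have [] := is_derive_2atan x.
Qed.

Lemma intg_poisson : intg poisson.
Proof.
apply/intg_ge0; [by apply: msr_cont; exact: continuous_poisson|exact: poisson_ge0|].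
by rewrite eint_poisson ltry.
Qed.

Lemma int_poisson : \int[mu]_z poisson z = 2 * pi.
Proof. by apply: EFin_inj; rewrite (EFin_int intg_poisson) eint_poisson. Qed.

(** By [casM] the integrand splits into an even term in [cos ((x - y) * xi)], which gives the
    Poisson kernel, and an odd term in [sin ((x + y) * xi)], which integrates to 0. Only the
    difference [x - y] survives, and this is what makes the square of the transform a multiple of
    the identity. *)
Lemma hartley1_abel_cas x y :
  hartley1 (fun xi => abel xi * cas (x * xi)) y = poisson (x - y).
Proof.
rewrite /hartley1 -int_abel_cos.
have i2 : intg (fun xi => abel xi * sin ((x + y) * xi)).
  under eq_fun do rewrite mulrC; apply: (@intg_mulb _ _ _ 1); first exact: intg_abel.
    exact: msr_sinM.
  by move=> z; rewrite ler_norml sin_geN1 sin_le1.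
have -> : \int[mu]_xi (abel xi * cas (x * xi) * cas (xi * y)) =
    \int[mu]_xi (abel xi * cos ((x - y) * xi) + abel xi * sin ((x + y) * xi)).
  apply: eq_Rintegral => xi _; rewrite -mulrA casM mulrDr (mulrC xi).
  by rewrite mulrBl mulrDl.
rewrite int_D//; last exact: intg_abel_cos.
rewrite (int_odd i2) ?addr0// => z.
by rewrite /abel normrN mulrN sinN mulrN.
Qed.

End poisson.

(** * Plancherel's identity for integrable functions of L^2 *)

Section plancherel1.
Context {R : realType}.
Local Notation mu := (@lebesgue_measure R).
Implicit Types f g h : R -> R.

(** Lebesgue's number lemma with a relation in place of an open cover. It yields uniform continuity
    both for real functions and for curves in a semi-inner product space. *)
Lemma lebesgue_number (a b : R) (Q : R -> R -> Prop) :
  (forall x, a <= x <= b -> exists2 d : R, 0 < d & forall s t, a <= s <= b -> a <= t <= b ->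
     `|s - x| < d -> `|t - x| < d -> Q s t) ->
  exists2 d : R, 0 < d & forall s t, a <= s <= b -> a <= t <= b -> `|s - t| < d -> Q s t.
Proof.
move=> H.
have : near_covering (`[a, b]%classic : set R).
  by apply: (compact_near_coveringP _).1; exact: segment_compact.
move=> /(_ R ((0 : R)^'+) (fun d t => a <= t <= b -> forall s, a <= s <= b -> `|s - t| < d -> Q s t) _) [].
  move=> x /=; rewrite in_itv/= => xab; have [d d0 hd] := H x xab.
  have d20 : 0 < d / 2 by rewrite divr_gt0.
  exists ([set t | a <= t <= b -> `|t - x| < d / 2], [set e | e < d / 2]) => /=.
    split; last exact: nbhs_right_lt.
    by exists (d / 2) => //= t; rewrite /ball_/= distrC.
  move=> [t e] /= [xt ed] tab s sab st.
  have xt2 := xt tab; apply: hd => //; last by lra.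
  have := ler_normD (s - t) (t - x); rewrite addrA subrK; lra.
move=> d /= d0 hd; exists (d / 2) => [|s t sab tab st]; first by rewrite divr_gt0.
apply: (hd (d / 2) _ _ t) => //=; last by rewrite divr_gt0.
by rewrite sub0r normrN ger0_norm; lra.
Qed.

(** Fubini's theorem gives the measurability of [abel 1] times the transform, and the nowhere
    vanishing factor is divided out. *)
Lemma hartley1_msr f : intg f -> msr (hartley1 f).
Proof.
move=> fi; have [/intg_msr m1 _] := hartley1_mult fi (intg_abel (@ltr01 R)).
have -> : hartley1 f = fun xi => expR `|xi| * (abel 1 xi * hartley1 f xi).
  by apply/funext => xi; rewrite /abel mul1r mulrA -expRD subrr expR0 mul1r.
apply: msrM m1; apply: msr_cont => x.
by apply: (@cvg_comp _ _ _ (fun x : R => `|x|) expR _ _ _ (@norm_continuous _ R x)); exact: continuous_expR.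
Qed.

Lemma intg_abel_hartley1 f e : 0 < e -> intg f ->
  intg (fun xi => abel e xi * hartley1 f xi).
Proof.
move=> e0 fi; under eq_fun do rewrite mulrC.
apply: (intg_mulb (intg_abel e0)); first exact: hartley1_msr.
by move=> xi; exact: hartley1_bound.
Qed.

Lemma intg_abel_hartley1_sqr f e : 0 < e -> intg f ->
  intg (fun xi => abel e xi * hartley1 f xi ^+ 2).
Proof.
move=> e0 fi; under eq_fun do rewrite expr2 mulrA mulrC.
apply: (intg_mulb (intg_abel_hartley1 e0 fi)); first exact: hartley1_msr.
by move=> xi; exact: hartley1_bound.
Qed.

Definition autocorr f z := \int[mu]_x (f x * f (x + z)).

Lemma poisson_le (e z : R) : 0 < e -> poisson e z <= 2 / e.
Proof.
move=> e0; rewrite /poisson ler_pdivrMr ?sqrD_gt0//.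
have -> : 2 / e * (e ^+ 2 + z ^+ 2) = 2 * e + 2 / e * z ^+ 2 by field; rewrite gt_eqF.
by rewrite lerDl mulr_ge0 ?sqr_ge0// divr_ge0// ltW.
Qed.

(** Plancherel's identity with an Abel factor. Two uses of the multiplication formula turn the
    left-hand side into the double integral of [f x * f y] against the Poisson kernel of [y - x];
    the substitution [y = x + z] and Fubini's theorem leave the autocorrelation. *)
Lemma abel_hartley1_sqrE f e : 0 < e -> intg f -> L2 f ->
  intg (fun z => poisson e z * autocorr f z) /\
  \int[mu]_xi (abel e xi * hartley1 f xi ^+ 2) = \int[mu]_z (poisson e z * autocorr f z).
Proof.
move=> e0 fi fL; have mf := intg_msr fi.
have mK : msr (poisson e) by apply: msr_cont; exact: continuous_poisson.
have K0 := poisson_ge0 e0.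
have Kb z : `|poisson e z| <= 2 / e by rewrite ger0_norm// poisson_le.
have [] := @fubini_dom R (fun x z => f x * (f (x + z) * poisson e z))
   (fun x => (2 / e * \int[mu]_y `|f y|) * `|f x|).
- apply: measurable_funM; first exact: (msr2_fst mf).
  apply: measurable_funM; last exact: (msr2_snd mK).
  apply: measurableT_comp; first exact: mf.
  by apply: measurable_funD; [exact: measurable_fst|exact: measurable_snd].
- move=> x; apply: intgZ; under eq_fun do rewrite mulrC.
  apply: (@intg_mulb _ _ _ (2 / e)) => //.
  under eq_fun do rewrite addrC; exact: intg_shift.
- move=> z; under eq_fun do rewrite mulrA mulrC; apply: intgZ.
  by apply: L2M => //; exact: L2_shift.
- move=> x.
  have fs : intg (fun z => f (x + z)) by under eq_fun do rewrite addrC; exact: intg_shift.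
  have <- : \int[mu]_z `|f (x + z)| = \int[mu]_y `|f y|.
    rewrite -(int_shift x (intg_norm fi)).
    by apply: eq_Rintegral => z _; rewrite addrC.
  rewrite -int_Z; last exact: intg_norm.
  rewrite mulrC -int_Z; last exact/intgZ/intg_norm.
  apply: int_le; [apply/intg_norm/intgZ|exact/intgZ/intgZ/intg_norm|].
    by under eq_fun do rewrite mulrC; exact: (intg_mulb fs mK Kb).
  move=> z; rewrite 2!normrM ler_wpM2l// mulrC ler_wpM2r//; exact: Kb.
- exact/intgZ/intg_norm.
move=> _ i2 E.
have E2 : (fun z => \int[mu]_x (f x * (f (x + z) * poisson e z))) =
    (fun z => poisson e z * autocorr f z).
  apply/funext => z.
  have ff : intg (fun x => f x * f (x + z)) by exact: (L2M fL (L2_shift z fL)).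
  by rewrite /autocorr -(int_Z _ ff); apply: eq_Rintegral => x _; ring.
rewrite E2 in i2 E; split => //; rewrite -E.
have ia := intg_abel_hartley1 e0 fi.
transitivity (ip (fun xi => abel e xi * hartley1 f xi) (hartley1 f)).
  by apply: eq_Rintegral => xi _; rewrite expr2 mulrA.
have [_ ->] := hartley1_mult fi ia.
apply: eq_Rintegral => x _; rewrite int_Z; last first.
  have fs : intg (fun z => f (x + z)) by under eq_fun do rewrite addrC; exact: intg_shift.
  by under eq_fun do rewrite mulrC; exact: (intg_mulb fs mK Kb).
congr (_ * _).
have ic : intg (fun xi => abel e xi * cas (x * xi)).
  by apply: intg_cas_sym; exact: intg_abel.
transitivity (ip (fun xi => abel e xi * cas (x * xi)) (hartley1 f)).
  by apply: eq_Rintegral => xi _; rewrite (mulrC x); ring.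
have [_ ->] := hartley1_mult fi ic.
transitivity (\int[mu]_y (f y * poisson e (y - x))).
  apply: eq_Rintegral => y _; rewrite hartley1_abel_cas//.
  by congr (_ * _); rewrite /poisson -[in LHS]opprB sqrrN.
rewrite -(@int_shift R x).
  by apply: eq_Rintegral => z _; rewrite addrK addrC.
under eq_fun do rewrite mulrC.
apply: (@intg_mulb R f _ (2 / e)) => //.
by apply: msr_comp mK _; exact: msr_shift.
Qed.

Lemma n2_shift c f : L2 f -> n2 (fun x => f (x + c)) = n2 f.
Proof. by move=> fL; exact: ip_shift. Qed.

Lemma n2B f g : L2 f -> L2 g -> n2 (fun x => f x - g x) = n2 f + n2 g - 2 * ip f g.
Proof.
move=> fL gL; have dL := L2B fL gL.
by rewrite /n2 ipBl// (ipC f) (ipC g) !ipBl// (ipC g f); ring.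
Qed.

Lemma n2D f g : L2 f -> L2 g -> n2 (fun x => f x + g x) = n2 f + n2 g + 2 * ip f g.
Proof.
move=> fL gL; have dL := L2D fL gL.
by rewrite /n2 ipDl// (ipC f) (ipC g) !ipDl// (ipC g f); ring.
Qed.

Lemma n2D_le f g : L2 f -> L2 g -> n2 (fun x => f x + g x) <= 2 * n2 f + 2 * n2 g.
Proof.
move=> fL gL; have := n2_ge0 (fun x => f x - g x).
by rewrite n2B// n2D//; lra.
Qed.

Lemma autocorrE f z : L2 f ->
  autocorr f z = n2 f - 2^-1 * n2 (fun x => f (x + z) - f x).
Proof.
move=> fL; rewrite n2B//; last exact: L2_shift.
rewrite n2_shift// (ipC _ f) /autocorr /ip; lra.
Qed.

Lemma autocorr_norm_le f z : L2 f -> `|autocorr f z| <= n2 f.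
Proof.
move=> fL; rewrite ler_norml; apply/andP; split.
  have := n2_ge0 (fun x => f (x + z) + f x).
  rewrite n2D//; last exact: L2_shift.
  rewrite n2_shift// (ipC _ f) /autocorr /ip; lra.
by rewrite autocorrE// gerBl mulr_ge0 ?n2_ge0.
Qed.

Lemma abel_cvg1 xi : (fun n => abel (n.+1%:R^-1) xi) @ \oo --> (1 : R).
Proof.
have h : (fun n : nat => n.+1%:R^-1 * - `|xi|) @ \oo --> (0 : R).
  by rewrite -(mul0r (- `|xi|)); apply: cvgMr_tmp; exact: (@cvg_harmonic R).
rewrite -[X in _ --> X](@expR0 R) /abel.
under eq_fun do rewrite -mulrN.
apply: (@cvg_comp _ _ _ (fun n : nat => n.+1%:R^-1 * - `|xi|) expR _ _ _ h).
exact: continuous_expR.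
Qed.

(** The autocorrelation is at most [n2 f] and the Poisson kernel has mass 2 pi, so the regularized
    integrals are bounded uniformly. Fatou's lemma removes the Abel factor. *)
Lemma hartley1_L2_le f : intg f -> L2 f ->
  L2 (hartley1 f) /\ n2 (hartley1 f) <= 2 * pi * n2 f.
Proof.
move=> fi fL.
have mH := hartley1_msr fi.
have [] := @fatouR R (fun n xi => abel (n.+1%:R^-1) xi * hartley1 f xi ^+ 2)
  (fun xi => hartley1 f xi ^+ 2) (2 * pi * n2 f).
- by move=> n; apply: intg_abel_hartley1_sqr.
- by move=> n x; rewrite mulr_ge0 ?sqr_ge0 ?abel_ge0.
- exact: msrX.
- by move=> x; exact: sqr_ge0.
- apply: aeW => xi; rewrite -[X in _ --> X]mul1r.
  by apply: cvgMr_tmp; exact: abel_cvg1.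
- move=> n; have e0 : 0 < n.+1%:R^-1 :> R by [].
  have [i1 ->] := abel_hartley1_sqrE e0 fi fL.
  rewrite -(int_poisson e0) mulrC -int_Z; last exact: intg_poisson.
  apply: int_le => //; first by apply: intgZ; exact: intg_poisson.
  move=> z; rewrite mulrC ler_wpM2r ?poisson_ge0//.
  by rewrite (le_trans (ler_norm _))// autocorr_norm_le.
by move=> i1 h; split; [split|rewrite /n2 ip_sqr].
Qed.

Definition trunc (n : nat) f x := f x * \1_(`[- n%:R, n%:R]%classic : set R) x.
(** The second cut, in the value of [f], makes the function bounded as well as of bounded support;
    continuity of translations is proved for such functions first. *)
Definition btrunc (n : nat) f x := trunc n f x * \1_(f @^-1` `[- n%:R, n%:R]%classic : set R) x.

Lemma msr_indic (A : set R) : measurable A -> msr (\1_A : R -> R).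
Proof. exact: measurable_indic. Qed.

Lemma measurable_pre_itv f (i : interval R) : msr f -> measurable (f @^-1` [set` i]).
Proof. by move=> mf; rewrite -[X in measurable X]setTI; apply: mf. Qed.

Lemma indic_norm1 (A : set R) x : `|\1_A x : R| <= 1.
Proof. by rewrite indicE; case: (x \in A); rewrite ?normr1 ?normr0. Qed.

Lemma L2_indic f (A : set R) : measurable A -> L2 f -> L2 (fun x => f x * \1_A x).
Proof.
move=> mA fL; under eq_fun do rewrite mulrC.
by apply: (L2_mulb fL (msr_indic mA)) => x; exact: indic_norm1.
Qed.

Lemma trunc_L2 n f : L2 f -> L2 (trunc n f).
Proof. by move=> fL; apply: L2_indic. Qed.

Lemma intg_indic_itv (a b : R) : intg (\1_(`[a, b]%classic : set R) : R -> R).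
Proof.
apply/intg_ge0; [exact: msr_indic|by move=> x|].
rewrite integral_indic// setIT; apply: compact_finite_measure; exact: segment_compact.
Qed.

Lemma L2_indic_itv (a b : R) : L2 (\1_(`[a, b]%classic : set R) : R -> R).
Proof.
split; first exact: msr_indic.
have := intg_indic_itv a b; congr intg; apply/funext => x.
by rewrite indicE; case: (x \in _); rewrite ?expr1n ?expr0n.
Qed.

Lemma trunc_intg n f : L2 f -> intg (trunc n f).
Proof. by move=> fL; apply: L2M => //; exact: L2_indic_itv. Qed.

Lemma L2_dom_cvg (F : nat -> R -> R) f g : (forall n, msr (F n)) -> msr f ->
  {ae mu, forall x, F ^~ x @ \oo --> f x} -> L2 g -> (forall n x, `|F n x - f x| <= `|g x|) ->
  (fun n => n2 (fun x => F n x - f x)) @ \oo --> (0 : R).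
Proof.
move=> mF mf Ff [mg gi] Fg.
have [|||||] := @dom_cvg R (fun n x => (F n x - f x) ^+ 2) (fun=> 0) (fun x => g x ^+ 2).
- by move=> n; apply: msrX; exact: msrB.
- exact: msr_cst.
- apply: ae_imp Ff => x Fx.
  have -> : (0 : R) = (f x - f x) ^+ 2 by rewrite subrr expr0n.
  by apply: cvg_sqr; apply: cvgB => //; exact: cvg_cst.
- exact: gi.
- move=> n x; rewrite normrX -(real_normK (num_real (g x))).
  by rewrite lerXn2r ?nnegrE.
move=> _; rewrite /Rintegral integral0/=.
by under eq_fun do rewrite -/(Rintegral _ _ _) -ip_sqr.
Qed.

Lemma indic_itv_near (x : R) : exists N, forall n : nat, (N <= n)%N ->
  \1_(`[- n%:R, n%:R]%classic : set R) x = 1 :> R.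
Proof.
exists (Num.bound `|x|) => n Nn; rewrite indicE mem_set//= in_itv/= -ler_norml.
apply: ltW; apply: lt_le_trans (_ : (Num.bound `|x|)%:R <= _).
  exact: archi_boundP.
by rewrite ler_nat.
Qed.

Lemma trunc_near f x : (trunc ^~ f) ^~ x @ \oo --> f x.
Proof.
apply/cvgn_eps => e e0; have [N NP] := indic_itv_near x; exists N => n Nn.
by rewrite /trunc NP// mulr1 subrr normr0 ltW.
Qed.

Lemma btrunc_near f x : (btrunc ^~ f) ^~ x @ \oo --> f x.
Proof.
apply/cvgn_eps => e e0; have [N NP] := indic_itv_near x.
have [M MP] := indic_itv_near (f x).
exists (maxn N M) => n; rewrite geq_max => /andP[Nn Mn].
have := MP n Mn; rewrite /btrunc /trunc NP// mulr1 !indicE /preimage => h.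
have -> : (x \in [set t | `[- n%:R, n%:R]%classic (f t)]) = (f x \in (`[- n%:R, n%:R]%classic : set R)).
  by apply/idP/idP; rewrite !inE.
by rewrite h mulr1 subrr normr0 ltW.
Qed.

Lemma btrunc_L2 n f : L2 f -> L2 (btrunc n f).
Proof. by move=> fL; apply: L2_indic; [apply: measurable_pre_itv; exact: L2_msr|exact: trunc_L2]. Qed.

Lemma trunc_cvg f : L2 f -> (fun n => n2 (fun x => trunc n f x - f x)) @ \oo --> (0 : R).
Proof.
move=> fL; apply: (@L2_dom_cvg _ _ f) => //; try by case: fL.
- by move=> n; apply: L2_msr; exact: trunc_L2.
- by apply: aeW => x; exact: trunc_near.
- move=> n x; rewrite /trunc indicE; case: (x \in _); rewrite ?mulr1 ?mulr0 ?subrr ?normr0//.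
  by rewrite sub0r normrN.
Qed.

Lemma btrunc_cvg f : L2 f -> (fun n => n2 (fun x => btrunc n f x - f x)) @ \oo --> (0 : R).
Proof.
move=> fL; apply: (@L2_dom_cvg _ _ f) => //; try by case: fL.
- by move=> n; apply: L2_msr; exact: btrunc_L2.
- by apply: aeW => x; exact: btrunc_near.
- move=> n x; rewrite /btrunc /trunc !indicE; case: (x \in _); case: (x \in _);
  by rewrite ?mulr1 ?mulr0 ?mul0r ?subrr ?normr0// sub0r normrN.
Qed.


(** Approximation by a continuous [g] is available in L^1 only. Boundedness of [f] converts it: the
    squared increment is at most [2 M] times the increment, which is compared with that of [g],
    uniformly continuous on a segment. *)
Lemma L2_shift_cvg_bounded f N M : L2 f -> 0 < N -> 0 < M -> (forall x, `|f x| <= M) ->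
  (forall x, N < `|x| -> f x = 0) -> forall e, 0 < e ->
  exists2 d : R, 0 < d & forall z, `|z| < d -> n2 (fun x => f (x + z) - f x) <= e.
Proof.
move=> fL N0 M0 fM fN e e0.
(* For [|z| < 1] the increment vanishes off [E1] below, and for [x] in [E1] both [x] and [x + z] lie
   in [E]. *)
pose E := `[- (N + 2), N + 2]%classic : set R.
pose E1 := `[- (N + 1), N + 1]%classic : set R.
have mE : measurable (E : set (measurableTypeR R)) by exact: measurable_itv.
have Efin : (mu E < +oo)%E by apply: compact_finite_measure; exact: segment_compact.
have fE : intg (fun x => f x * \1_E x) by apply: L2M => //; exact: L2_indic_itv.
have fiE : mu.-integrable E (EFin \o f).
  have fi : intg f.
    move: fE; congr intg; apply/funext => x; rewrite indicE.
    case: (boolP (x \in E)) => [|xE]; rewrite ?mulr1// mulr0 fN//.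
    rewrite ltNge; apply: contra xE => xN; rewrite inE /E/= in_itv/= -ler_norml.
    by rewrite (le_trans xN)// lerDl.
  exact: integrableS fi.
have [g_ [cg ig gf]] := approximation_continuous_integrable mE Efin fiE.
(* Two L^1 errors [eta] and a uniform error [eta] over [E1], of length [2 (N + 1)], all multiplied
   by [2 M], then add up to exactly [e]. *)
pose c := 2 * M * (2 * (N + 1) + 2).
have c0 : 0 < c by rewrite /c !mulr_gt0// addr_gt0// mulr_gt0// addr_gt0.
pose eta := e / c.
have eta0 : 0 < eta by rewrite divr_gt0.
have [n hn] : exists n, (\int[mu]_(z in E) `|(f z - g_ n z)%:E| <= eta%:E)%E.
  move/fine_cvgP : gf => [[k _ kfin] /cvgr0Pnorm_le /(_ _ eta0)[m _ mP]].
  exists (k + m)%N; have /= := mP (k + m)%N (leq_addl _ _).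
  rewrite ger0_norm; last by apply: fine_ge0; apply: integral_ge0.
  by rewrite -lee_fin fineK// kfin//= leq_addr.
have {gf} := hn; set g := g_ n => gE.
have gc : continuous g by exact: cg.
pose h x := `|f x - g x| * \1_E x.
have hi : intg h.
  have : mu.-integrable E (EFin \o (fun x => `|f x - g x|)).
    have := integrable_abse (integrableB mE fiE (ig n)).
    exact: eq_integrable.
  move/(integrable_mkcond _ mE); rewrite /intg; congr (integrable _ _ _).
  apply/funext => x; rewrite patchE /= /h indicE; case: (x \in E) => /=; rewrite ?mulr1 ?mulr0//.
have h_le : \int[mu]_x h x <= eta.
  rewrite -lee_fin EFin_int//; apply: le_trans gE.
  rewrite [leRHS]integral_mkcond le_eqVlt; apply/orP; left; apply/eqP.
  apply: eq_integral => x _; rewrite patchE /h indicE.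
  by case: (x \in E); rewrite /= ?mulr1 ?mulr0.
have [d d0 hd] : exists2 d : R, 0 < d & forall s t, - (N + 2) <= s <= N + 2 ->
    - (N + 2) <= t <= N + 2 -> `|s - t| < d -> `|g s - g t| <= eta.
  apply: lebesgue_number => x _.
  have /cvgrPdist_lt /(_ (eta / 2)) := gc x.
  move=> /(_ _)/nbhs_ballP[|d /= d0 dP]; first by rewrite divr_gt0.
  exists d => // s t _ _ sx tx.
  have h1 : `|g x - g s| < eta / 2 by apply: dP; rewrite /ball/= distrC.
  have h2 : `|g x - g t| < eta / 2 by apply: dP; rewrite /ball/= distrC.
  have -> : g s - g t = (g x - g t) - (g x - g s) by ring.
  rewrite (le_trans (ler_normB _ _))//; lra.
exists (Num.min 1 d) => [|z]; first by rewrite lt_min ltr01.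
rewrite lt_min => /andP[z1 zd].
have dL : L2 (fun x => f (x + z) - f x) by apply: L2B => //; exact: L2_shift.
have key x : (f (x + z) - f x) ^+ 2 <= 2 * M * (h (x + z) + eta * \1_E1 x + h x).
  have zl := ler_normD (x + z) (- z); rewrite addrK normrN in zl.
  have [xE1|xE1] := boolP (x \in E1); last first.
    have Nx : N + 1 < `|x|.
      rewrite ltNge; apply: contra xE1 => xN; rewrite inE /E1/= in_itv/= -ler_norml//.
    have xz : N < `|x + z| by clear - Nx zl z1; lra.
    have xN : N < `|x| by clear - Nx; lra.
    rewrite (fN _ xz) (fN _ xN).
    rewrite subrr expr0n/= mulr_ge0 ?mulr_ge0 ?(ltW M0)// !addr_ge0//.
    + by rewrite /h mulr_ge0// indicE.
    + by rewrite mulr_ge0 ?(ltW eta0)// indicE.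
    + by rewrite /h mulr_ge0// indicE.
  have Nx : `|x| <= N + 1 by move: xE1; rewrite inE /E1/= in_itv/= -ler_norml.
  have zu := ler_normD x z.
  have xE : x \in E by rewrite inE /E/= in_itv/= -ler_norml; lra.
  have xzE : x + z \in E by rewrite inE /E/= in_itv/= -ler_norml; lra.
  rewrite /h !indicE xE xzE xE1 !mulr1.
  have g1 : `|g (x + z) - g x| <= eta.
    apply: hd; [by rewrite -ler_norml; lra|by rewrite -ler_norml; lra|].
    by rewrite addrC addKr.
  have f1 : `|f (x + z) - f x| <= `|f (x + z) - g (x + z)| + eta + `|f x - g x|.
    have -> : f (x + z) - f x = (f (x + z) - g (x + z)) + (g (x + z) - g x) - (f x - g x) by ring.
    rewrite (le_trans (ler_normB _ _))// lerD2r (le_trans (ler_normD _ _))// lerD2l//.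
  have f2 : `|f (x + z) - f x| <= 2 * M.
    by rewrite (le_trans (ler_normB _ _))//; have := fM x; have := fM (x + z); lra.
  rewrite -(real_normK (num_real (f (x + z) - f x))) expr2.
  by apply: ler_pM.
rewrite /n2 ip_sqr; apply: le_trans (int_le _ _ key) _.
- by case: dL.
- apply/intgZ/intgD => //; apply: intgD; first exact: intg_shift.
  by apply: intgZ; exact: intg_indic_itv.
have ii : intg (\1_E1 : R -> R) by exact: intg_indic_itv.
have hs : intg (fun x => h (x + z)) by exact: intg_shift.
rewrite int_Z; last by apply: intgD => //; apply: intgD => //; exact: intgZ.
rewrite int_D//; last by apply: intgD => //; exact: intgZ.
rewrite int_D//; last exact: intgZ.
rewrite (int_shift z hi) int_Z//.
have -> : \int[mu]_x (\1_E1 x : R) = 2 * (N + 1).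
  have -> : 2 * (N + 1) = fine (mu E1).
    rewrite /E1 lebesgue_measure_itv/= lte_fin ifT; last by lra.
    by rewrite -EFinB/=; ring.
  have mE1 : measurable (E1 : set (measurableTypeR R)) by exact: measurable_itv.
  by rewrite /Rintegral integral_indic ?setIT.
have -> : e = 2 * M * (eta + eta * (2 * (N + 1)) + eta) by rewrite /eta /c; field; rewrite gt_eqF//=; lra.
rewrite ler_pM2l ?mulr_gt0//; lra.
Qed.

Lemma L2_shift_cvg f : L2 f -> forall e, 0 < e ->
  exists2 d : R, 0 < d & forall z, `|z| < d -> n2 (fun x => f (x + z) - f x) <= e.
Proof.
move=> fL e e0.
(* Two uses of [n2D_le] give the three pieces the weights 4, 4 and 2. *)
have e10 : 0 < e / 10 by rewrite divr_gt0.
have [n hn] := (cvgn_eps _ _).1 (btrunc_cvg fL) _ e10.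
(* The index [n.+1] is positive, as the bounded case requires of its two bounds. *)
have := hn n.+1 (leqnSn n); set g := btrunc n.+1 f; rewrite subr0 ger0_norm ?n2_ge0// => gn.
have gL : L2 g by exact: btrunc_L2.
have [d d0 hd] : exists2 d : R, 0 < d & forall z, `|z| < d -> n2 (fun x => g (x + z) - g x) <= e / 10.
  apply: (@L2_shift_cvg_bounded g n.+1%:R n.+1%:R) => //.
  - move=> x; rewrite /g /btrunc normrM.
    rewrite [X in _ * `|X|]indicE; case: (boolP (x \in _)) => xf; last by rewrite normr0 mulr0.
    rewrite normr1 mulr1 /trunc normrM.
    move: xf; rewrite inE/= in_itv/= -ler_norml => xf.
    by rewrite (le_trans _ xf)// ler_piMr// indic_norm1.
  - move=> x nx; rewrite /g /btrunc /trunc (_ : \1__ x = 0 :> R) ?mulr0 ?mul0r//.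
    rewrite indicE; case: (boolP (x \in _)) => //; rewrite inE/= in_itv/= -ler_norml.
    by rewrite leNgt nx.
exists d => // z zd.
have rL : L2 (fun x => g x - f x) by exact: L2B.
have rsL := L2_shift z rL.
have dL : L2 (fun x => g (x + z) - g x) by apply: L2B => //; exact: L2_shift.
have -> : (fun x => f (x + z) - f x) =
  (fun x => ((g (x + z) - g x) + (g x - f x)) - (g (x + z) - f (x + z))).
  by apply/funext => x; ring.
apply: le_trans (n2D_le (L2D dL rL) (L2N rsL)) _.
have -> : n2 (fun x => - (g (x + z) - f (x + z))) = n2 (fun x => g x - f x).
  rewrite -(n2_shift z rL) /n2 !ip_sqr; apply: eq_Rintegral => x _; exact: sqrrN.
have := n2D_le dL rL; have := hd z zd; lra.
Qed.

(** The lower bound is the concentration of the Poisson kernel. For [|z| < d] the autocorrelation is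
    at least [n2 f - e] by continuity of translations. Farther out it is at least [- n2 f], and
    there [poisson r] is at most [r (1 + d^-2)] times [poisson 1], whose integral does not depend on
    [r]. *)
Lemma plancherel1 f : intg f -> L2 f -> n2 (hartley1 f) = 2 * pi * n2 f.
Proof.
move=> fi fL; apply/eqP; rewrite eq_le (hartley1_L2_le fi fL).2/=.
have [HL _] := hartley1_L2_le fi fL.
have pi0 := pi_gt0 R.
apply/ler_addgt0Pr => e0 e00.
(* The total loss is [2 pi (e + C r)], and [r] is chosen so that [C r <= e]. *)
pose e := e0 / (4 * pi).
have ep : 0 < e by rewrite divr_gt0// mulr_gt0.
have [d d0 hd] := L2_shift_cvg fL ep.
pose C := 2 * n2 f * (1 + (d ^+ 2)^-1).
have C0 : 0 <= C by rewrite /C !mulr_ge0 ?n2_ge0// addr_ge0// invr_ge0 sqr_ge0.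
pose r := e / (C + 1).
have C10 : 0 < C + 1 by rewrite ltr_wpDl.
have r0 : 0 < r by rewrite divr_gt0.
have Cr : C * r <= e.
  rewrite /r mulrCA ler_piMr ?(ltW ep)// ler_pdivrMr// mul1r lerDl//.
have [i1 E1] := abel_hartley1_sqrE r0 fi fL.
have iK := intg_poisson r0.
have iK1 := intg_poisson (@ltr01 R).
have low : \int[mu]_z ((n2 f - e) * poisson r z - C * r * poisson 1 z) <=
    \int[mu]_z (poisson r z * autocorr f z).
  apply: int_le => //; first by apply: intgB; exact: intgZ.
  move=> z; have K0 := poisson_ge0 r0 z.
  have [zd|zd] := ltP `|z| d.
    have : n2 f - e <= autocorr f z.
      by rewrite autocorrE//; have := hd z zd; have := n2_ge0 (fun x => f (x + z) - f x); lra.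
    move=> /(ler_wpM2l K0) h; apply: le_trans h.
    rewrite mulrC gerBl mulr_ge0 ?poisson_ge0// mulr_ge0// ltW//.
  have A1 : - n2 f <= autocorr f z by have := autocorr_norm_le z fL; rewrite ler_norml => /andP[].
  apply: le_trans (ler_wpM2l K0 A1).
  have z2 : d ^+ 2 <= z ^+ 2 by rewrite -(real_normK (num_real z)) lerXn2r ?nnegrE// ltW.
  have d2 : 0 < d ^+ 2 by rewrite exprn_gt0.
  have z20 : 0 < z ^+ 2 by apply: lt_le_trans z2.
  have Kz : poisson r z <= 2 * r / z ^+ 2.
    rewrite /poisson; apply: ler_wpM2l; first by rewrite mulr_ge0// ltW.
    by rewrite lef_pV2 ?posrE ?sqrD_gt0// lerDr sqr_ge0.
  have K1 : 2 * r / z ^+ 2 <= (1 + (d ^+ 2)^-1) * (r * poisson 1 z).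
    have -> : 2 * r / z ^+ 2 = (1 + (z ^+ 2)^-1) * (r * poisson 1 z).
      rewrite /poisson expr1n mulr1; field.
      rewrite gt_eqF ?addr_gt0//=; apply/eqP => z0.
      by rewrite z0 expr0n ltxx in z20.
    apply: ler_wpM2r; first by rewrite mulr_ge0 ?poisson_ge0// ltW.
    by rewrite lerD2l lef_pV2.
  have := ler_wpM2l (n2_ge0 f) (le_trans Kz K1).
  rewrite /C => h1; have := mulr_ge0 (ltW ep) K0.
  have := mulr_ge0 (n2_ge0 f) K0; nra.
have up : \int[mu]_xi (abel r xi * hartley1 f xi ^+ 2) <= n2 (hartley1 f).
  rewrite /n2 ip_sqr; apply: int_le; first exact: intg_abel_hartley1_sqr.
    by case: HL.
  by move=> x; rewrite ler_piMl ?sqr_ge0// abel_le1.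
have {low} := le_trans low (le_trans (_ : _ <= _) up); rewrite E1 => /(_ (lexx _)).
rewrite int_B; [|exact: intgZ|exact: intgZ].
rewrite (int_Z _ iK) (int_Z _ iK1) (int_poisson r0) (int_poisson ltr01) => low.
have eE : e0 = 2 * pi * (e + e).
  rewrite /e; move: (pi : R) pi0 => P P0; field.
  exact: lt0r_neq0.
rewrite eE.
have := ler_wpM2r (ltW pi0) Cr; nra.
Qed.

End plancherel1.

(** * The Hartley transform on L^2 *)

Section hartley.
Context {R : realType}.
Local Notation mu := (@lebesgue_measure R).
Implicit Types f g h : R -> R.

Definition L2cvg (F : nat -> R -> R) f :=
  (fun n => n2 (fun x => F n x - f x)) @ \oo --> (0 : R).

Lemma n2_ae f g : L2 f -> L2 g -> ae_eqR f g -> n2 f = n2 g.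
Proof. by move=> fL gL fg; exact: ip_ae. Qed.

Lemma n2Z a f : L2 f -> n2 (fun x => a * f x) = a ^+ 2 * n2 f.
Proof. by move=> fL; rewrite /n2 ipZl ?(ipC f) ?ipZl//; [ring|exact: L2Z]. Qed.

Lemma n2N f : n2 (fun x => - f x) = n2 f.
Proof. by rewrite /n2 !ip_sqr; apply: eq_Rintegral => x _; exact: sqrrN. Qed.

Lemma n2_sym f g : n2 (fun x => f x - g x) = n2 (fun x => g x - f x).
Proof. by rewrite -n2N; congr n2; apply/funext => x; rewrite opprB. Qed.

Lemma n2_mulb f h M : L2 f -> msr h -> (forall x, `|h x| <= M) ->
  n2 (fun x => h x * f x) <= M ^+ 2 * n2 f.
Proof.
move=> fL mh hM; have hfL := L2_mulb fL mh hM.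
rewrite /n2 !ip_sqr -int_Z; last by case: fL.
apply: int_le; [by case: hfL|by apply: intgZ; case: fL|] => x.
rewrite exprMn ler_wpM2r ?sqr_ge0//.
by rewrite -(real_normK (num_real (h x))) lerXn2r ?nnegrE// (le_trans _ (hM x)).
Qed.

Lemma n2_opp f : L2 f -> n2 (fun x => f (- x)) = n2 f.
Proof. by move=> fL; exact: ip_opp. Qed.

Lemma n2_eq0_ae f g : L2 f -> L2 g -> n2 (fun x => f x - g x) = 0 -> ae_eqR f g.
Proof.
move=> fL gL /(ip_eq0 (L2B fL gL)); apply: ae_imp => x /eqP.
by rewrite subr_eq0 => /eqP.
Qed.

Lemma cvg0_squeeze (u v : nat -> R) : (forall n, 0 <= u n <= v n) ->
  v @ \oo --> (0 : R) -> u @ \oo --> (0 : R).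
Proof.
move=> uv v0; apply: (@squeeze_cvgr _ _ _ _ (fun=> 0) v) => //.
  exact: nearW.
exact: cvg_cst.
Qed.

Lemma cvg0_lin2 (a b : R) (u v : nat -> R) : u @ \oo --> (0 : R) -> v @ \oo --> (0 : R) ->
  (fun n => a * u n + b * v n) @ \oo --> (0 : R).
Proof.
move=> u0 v0; have -> : 0 = a * 0 + b * 0 :> R by rewrite !mulr0 addr0.
by apply: cvgD; apply: cvgMl_tmp.
Qed.

Lemma L2cvg_eq F G f g :
  (forall n, n2 (fun x => F n x - f x) = n2 (fun x => G n x - g x)) ->
  L2cvg F f -> L2cvg G g.
Proof. by move=> E; rewrite /L2cvg; under eq_fun do rewrite E. Qed.

Lemma L2cvg_ae F G f : (forall n, L2 (F n)) -> (forall n, L2 (G n)) -> L2 f ->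
  (forall n, ae_eqR (F n) (G n)) -> L2cvg F f -> L2cvg G f.
Proof.
move=> FL GL fL FG; apply: L2cvg_eq => n.
by apply: n2_ae; [exact: L2B|exact: L2B|apply: ae_imp (FG n) => x ->].
Qed.

Lemma L2cvg_uniq F f g : (forall n, L2 (F n)) -> L2 f -> L2 g -> L2cvg F f -> L2cvg F g ->
  ae_eqR f g.
Proof.
move=> FL fL gL Ff Fg; apply: n2_eq0_ae => //.
have h : (fun n : nat => n2 (fun x => f x - g x)) @ \oo --> (0 : R).
  apply: cvg0_squeeze (cvg0_lin2 2 2 Ff Fg) => n; rewrite n2_ge0/=.
  have := n2D_le (L2N (L2B (FL n) fL)) (L2B (FL n) gL).
  rewrite n2N; congr (_ <= _); congr n2; apply/funext => x; ring.
have h2 : (fun n : nat => n2 (fun x => f x - g x)) @ \oo --> n2 (fun x => f x - g x).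
  exact: cvg_cst.
exact: (cvg_unique _ h2 h).
Qed.

Lemma L2cvgD F G f g : (forall n, L2 (F n)) -> (forall n, L2 (G n)) -> L2 f -> L2 g ->
  L2cvg F f -> L2cvg G g -> L2cvg (fun n x => F n x + G n x) (fun x => f x + g x).
Proof.
move=> FL GL fL gL Ff Gg; apply: cvg0_squeeze (cvg0_lin2 2 2 Ff Gg) => n.
rewrite n2_ge0/=; have := n2D_le (L2B (FL n) fL) (L2B (GL n) gL).
by congr (_ <= _); congr n2; apply/funext => x; ring.
Qed.

Lemma L2cvg_mulb F f h M : (forall n, L2 (F n)) -> L2 f -> msr h -> (forall x, `|h x| <= M) ->
  L2cvg F f -> L2cvg (fun n x => h x * F n x) (fun x => h x * f x).
Proof.
move=> FL fL mh hM Ff; apply: cvg0_squeeze (cvg0_lin2 (M ^+ 2) 0 Ff Ff) => n.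
rewrite n2_ge0/= mul0r addr0; have := n2_mulb (L2B (FL n) fL) mh hM.
by congr (_ <= _); congr n2; apply/funext => x; ring.
Qed.

Lemma L2cvg_opp F f : (forall n, L2 (F n)) -> L2 f -> L2cvg F f ->
  L2cvg (fun n x => F n (- x)) (fun x => f (- x)).
Proof.
move=> FL fL; apply: L2cvg_eq => n.
by rewrite -(n2_opp (L2B (FL n) fL)).
Qed.

Lemma L2cvg_shift c F f : (forall n, L2 (F n)) -> L2 f -> L2cvg F f ->
  L2cvg (fun n x => F n (x + c)) (fun x => f (x + c)).
Proof.
move=> FL fL; apply: L2cvg_eq => n.
by rewrite -(n2_shift c (L2B (FL n) fL)).
Qed.

Lemma ip_young t f g : 0 < t -> L2 f -> L2 g -> 2 * `|ip f g| <= t^-1 * n2 f + t * n2 g.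
Proof.
move=> t0 fL gL; have tL := L2Z t gL.
have := n2_ge0 (fun x => f x + t * g x); have := n2_ge0 (fun x => f x - t * g x).
rewrite n2B// n2D// n2Z// (ipC f) ipZl// (ipC g f) => h1 h2.
have : 2 * t * `|ip f g| <= n2 f + t ^+ 2 * n2 g.
  by have [h|h] := ler0P (ip f g); lra.
have -> : t^-1 * n2 f + t * n2 g = t^-1 * (n2 f + t ^+ 2 * n2 g).
  by field; exact: lt0r_neq0.
by rewrite ler_pdivlMl//; congr (_ <= _); ring.
Qed.

Lemma L2cvg_n2 F f : (forall n, L2 (F n)) -> L2 f -> L2cvg F f ->
  (fun n => n2 (F n)) @ \oo --> n2 f.
Proof.
move=> FL fL Ff; apply/cvgn_eps => e e0.
pose M := n2 f + 1; have M0 : 0 < M by rewrite ltr_wpDl ?n2_ge0.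
(* In Young's inequality this weight keeps the term [t * n2 f] below [e / 2]; the price [t^-1] falls
   on the vanishing term. *)
pose t := e / (2 * M); have t0 : 0 < t by rewrite divr_gt0// mulr_gt0.
have d0 : 0 < e / (2 * (1 + t^-1)) by rewrite divr_gt0// mulr_gt0// addr_gt0// invr_gt0.
have [N NP] := (cvgn_eps _ _).1 Ff _ d0; exists N => n Nn.
have := NP n Nn; rewrite subr0 ger0_norm ?n2_ge0//; set a := n2 _ => ha.
have dL := L2B (FL n) fL.
have E : n2 (F n) = a + n2 f + 2 * ip (fun x => F n x - f x) f.
  by rewrite /a -n2D//; congr n2; apply/funext => x; rewrite subrK.
have -> : n2 (F n) - n2 f = a + 2 * ip (fun x => F n x - f x) f by rewrite E; ring.
rewrite (le_trans (ler_normD _ _))// ger0_norm ?n2_ge0// normrM (ger0_norm (_ : 0 <= 2))//.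
have := ip_young t0 dL fL; rewrite -/a => h.
have h1 : t * n2 f <= e / 2.
  have -> : e / 2 = t * M by rewrite /t; field; exact: lt0r_neq0.
  by rewrite ler_pM2l// lerDl.
have h2 : a * (1 + t^-1) <= e / 2.
  rewrite -ler_pdivlMr ?addr_gt0 ?invr_gt0//.
  by rewrite (_ : e / 2 / (1 + t^-1) = e / (2 * (1 + t^-1)))// -mulrA -invfM.
by move: h1 h2 h; lra.
Qed.

(** Polarization reduces the claim to convergence of norms. *)
Lemma ip_cvg F G f g : (forall n, L2 (F n)) -> (forall n, L2 (G n)) -> L2 f -> L2 g ->
  L2cvg F f -> L2cvg G g -> (fun n => ip (F n) (G n)) @ \oo --> ip f g.
Proof.
move=> FL GL fL gL Ff Gg.
have E n : ip (F n) (G n) = 4^-1 * (n2 (fun x => F n x + G n x) - n2 (fun x => F n x - G n x)).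
  by rewrite n2D// n2B//; field.
have -> : ip f g = 4^-1 * (n2 (fun x => f x + g x) - n2 (fun x => f x - g x)).
  by rewrite n2D// n2B//; field.
under eq_fun do rewrite E.
apply: cvgMl_tmp; apply: cvgB.
  apply: (@L2cvg_n2 (fun n x => F n x + G n x)) => [n||]; [exact: L2D|exact: L2D|].
  exact: L2cvgD.
apply: (@L2cvg_n2 (fun n x => F n x - G n x)) => [n||]; [exact: L2B|exact: L2B|].
apply: L2cvgD => // [n||]; [exact: L2N|exact: L2N|].
apply: L2cvg_eq Gg => n.
by rewrite -n2N; congr n2; apply/funext => x; rewrite opprB opprK addrC.
Qed.

Lemma hartley1D f g : intg f -> intg g ->
  hartley1 (fun x => f x + g x) = fun xi => hartley1 f xi + hartley1 g xi.
Proof.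
move=> fi gi; apply/funext => xi; rewrite /hartley1.
rewrite -int_D; [|exact: intg_cas|exact: intg_cas].
by apply: eq_Rintegral => x _; rewrite mulrDl.
Qed.

Lemma hartley1Z a f : intg f -> hartley1 (fun x => a * f x) = fun xi => a * hartley1 f xi.
Proof.
move=> fi; apply/funext => xi; rewrite /hartley1 -int_Z; last exact: intg_cas.
by apply: eq_Rintegral => x _; rewrite mulrA.
Qed.

Lemma hartley1B f g : intg f -> intg g ->
  hartley1 (fun x => f x - g x) = fun xi => hartley1 f xi - hartley1 g xi.
Proof.
move=> fi gi; have -> : (fun x => f x - g x) = (fun x => f x + -1 * g x).
  by apply/funext => x; rewrite mulN1r.
rewrite hartley1D//; last exact: intgZ.
by rewrite hartley1Z//; apply/funext => x; rewrite mulN1r.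
Qed.

Lemma hartley1_L2 f : intg f -> L2 f -> L2 (hartley1 f).
Proof. by move=> fi fL; have [] := hartley1_L2_le fi fL. Qed.

(** A translation multiplies the Fourier transform by a phase; on the Hartley side this is a
    rotation of the pair of values at [xi] and [- xi], by the addition formula [casD]. *)
Lemma hartley1_shift c f xi : intg f ->
  hartley1 (fun x => f (x + c)) xi =
  cos (c * xi) * hartley1 f xi + - sin (c * xi) * hartley1 f (- xi).
Proof.
move=> fi.
have i1 := intg_cas xi fi; have i2 := intg_cas (- xi) fi.
rewrite /hartley1 -!int_Z// -int_D; [|exact: intgZ|exact: intgZ].
have cf : intg (fun x => f (x + c) * cas ((x + c - c) * xi)).
  have := intg_cas xi (intg_shift c fi); congr intg.
  by apply/funext => x; rewrite addrK.
transitivity (\int[mu]_x (f (x + c) * cas ((x + c - c) * xi))).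
  by apply: eq_Rintegral => x _; rewrite addrK.
rewrite (@int_shift R c (fun x => f x * cas ((x - c) * xi))).
  apply: eq_Rintegral => x _; rewrite mulrBl casD cosN sinN !mulrN; ring.
have := intg_shift (- c) cf.
by under eq_fun do rewrite subrK.
Qed.

(** The truncations are those of [is_fourier], so that the two transforms can be compared term by
    term before the limit. *)
Definition is_hart f g := L2 g /\ L2cvg (fun n => hartley1 (trunc n f)) g.

Definition hart f : R -> R := xget (fun=> 0) [set g | is_hart f g].

Lemma hart_ex f : L2 f -> exists g, is_hart f g.
Proof.
move=> fL; have tL n := trunc_L2 n fL; have ti n := trunc_intg n fL.
have [|g gL gP] := @L2_complete R (fun n => hartley1 (trunc n f)) (fun n => hartley1_L2 (ti n) (tL n)); last first.
  exists g; split => //; apply/cvgn_eps => e e0; have [N NP] := gP e e0.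
  by exists N => n Nn; rewrite subr0 ger0_norm ?n2_ge0// n2_sym NP.
move=> e e0; have pi0 := pi_gt0 R.
(* Plancherel's identity costs a factor 2 pi, and the distance of two truncations is at most 4 times
   this error. *)
have e2 : 0 < e / (8 * pi) by rewrite divr_gt0// mulr_gt0.
have [N NP] := (cvgn_eps _ _).1 (trunc_cvg fL) _ e2; exists N => m n Nm Nn.
have := NP m Nm; have := NP n Nn; rewrite !subr0 !ger0_norm ?n2_ge0// => hn hm.
rewrite -hartley1B// plancherel1//; [|exact: intgB|exact: L2B].
have := n2D_le (L2B (tL m) fL) (L2N (L2B (tL n) fL)); rewrite n2N => h.
have {h} h : n2 (fun x => trunc m f x - trunc n f x) <= 4 * (e / (8 * pi)).
  apply: le_trans (_ : 2 * (e / (8 * pi)) + 2 * (e / (8 * pi)) <= _); last by rewrite -mulrDl; lra.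
  apply: le_trans (_ : _ <= 2 * n2 (fun x => trunc m f x - f x) + 2 * n2 (fun x => trunc n f x - f x)) _.
    by move: h; congr (_ <= _); congr n2; apply/funext => x; ring.
  by rewrite lerD// ler_pM2l.
have -> : e = 2 * pi * (4 * (e / (8 * pi))).
  move: (pi : R) pi0 => P P0; field; exact: lt0r_neq0.
by rewrite ler_pM2l// mulr_gt0.
Qed.

Lemma hartP f : L2 f -> is_hart f (hart f).
Proof. by move=> /hart_ex[g gf]; exact: (xgetI _ gf). Qed.

Lemma hart_L2 f : L2 f -> L2 (hart f).
Proof. by move=> /hartP[]. Qed.

Lemma is_hart_uniq f g : L2 f -> is_hart f g -> ae_eqR g (hart f).
Proof.
move=> fL [gL g1]; have [hL h1] := hartP fL.
apply: L2cvg_uniq g1 h1 => // n.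
by apply: hartley1_L2; [exact: trunc_intg|exact: trunc_L2].
Qed.

Lemma hart_intg f : intg f -> L2 f -> ae_eqR (hart f) (hartley1 f).
Proof.
move=> fi fL; apply: ae_sym; apply: is_hart_uniq => //; split; first exact: hartley1_L2.
have h := cvg0_lin2 (2 * pi) 0 (trunc_cvg fL) (trunc_cvg fL).
apply: cvg0_squeeze h => n; rewrite n2_ge0/= mul0r addr0.
rewrite -hartley1B//; last exact: trunc_intg.
by rewrite plancherel1//; [apply: intgB => //; exact: trunc_intg|apply: L2B => //; exact: trunc_L2].
Qed.

Lemma n2_hart f : L2 f -> n2 (hart f) = 2 * pi * n2 f.
Proof.
move=> fL; have [hL h1] := hartP fL.
have tL n := trunc_L2 n fL; have ti n := trunc_intg n fL.
have a1 := L2cvg_n2 (fun n => hartley1_L2 (ti n) (tL n)) hL h1.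
have a2 := L2cvg_n2 tL fL (trunc_cvg fL).
have a3 : (fun n => n2 (hartley1 (trunc n f))) @ \oo --> 2 * pi * n2 f.
  by under eq_fun do rewrite (plancherel1 (ti _) (tL _)); exact: cvgMl_tmp.
exact: (cvg_unique _ a1 a3).
Qed.

Lemma ip_hart f g : L2 f -> L2 g -> ip (hart f) g = ip f (hart g).
Proof.
move=> fL gL; have [hL h1] := hartP fL; have [kL k1] := hartP gL.
have a1 := ip_cvg (fun n => hartley1_L2 (trunc_intg n fL) (trunc_L2 n fL))
  (fun n => trunc_L2 n gL) hL gL h1 (trunc_cvg gL).
have a2 := ip_cvg (fun n => trunc_L2 n fL) (fun n => hartley1_L2 (trunc_intg n gL) (trunc_L2 n gL))
  fL kL (trunc_cvg fL) k1.
have E n : ip (hartley1 (trunc n f)) (trunc n g) = ip (trunc n f) (hartley1 (trunc n g)).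
  by rewrite ipC; have [_] := hartley1_mult (trunc_intg n fL) (trunc_intg n gL).
move: a1; under eq_fun do rewrite E.
by move=> a1; exact: (cvg_unique _ a1 a2).
Qed.

Lemma hartD f g : L2 f -> L2 g ->
  ae_eqR (hart (fun x => f x + g x)) (fun x => hart f x + hart g x).
Proof.
move=> fL gL; apply: ae_sym; apply: is_hart_uniq; first exact: L2D.
have [hL h1] := hartP fL; have [kL k1] := hartP gL; split; first exact: L2D.
apply: L2cvg_eq (L2cvgD (fun n => hartley1_L2 (trunc_intg n fL) (trunc_L2 n fL))
  (fun n => hartley1_L2 (trunc_intg n gL) (trunc_L2 n gL)) hL kL h1 k1) => n; congr n2.
apply/funext => x; congr (_ - _).
have -> : trunc n (fun x => f x + g x) = fun x => trunc n f x + trunc n g x.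
  by apply/funext => y; rewrite /trunc mulrDl.
by rewrite hartley1D//; exact: trunc_intg.
Qed.

Lemma hartZ a f : L2 f -> ae_eqR (hart (fun x => a * f x)) (fun x => a * hart f x).
Proof.
move=> fL; apply: ae_sym; apply: is_hart_uniq; first exact: L2Z.
have [hL h1] := hartP fL; split; first exact: L2Z.
apply: L2cvg_eq (@L2cvg_mulb _ _ (fun=> a) `|a| (fun n => hartley1_L2 (trunc_intg n fL) (trunc_L2 n fL))
  hL (msr_cst a) (fun=> lexx _) h1) => n; congr n2.
apply/funext => x; congr (_ - _).
have -> : trunc n (fun x => a * f x) = fun x => a * trunc n f x.
  by apply/funext => y; rewrite /trunc mulrA.
by rewrite hartley1Z//; exact: trunc_intg.
Qed.

Lemma hartB f g : L2 f -> L2 g ->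
  ae_eqR (hart (fun x => f x - g x)) (fun x => hart f x - hart g x).
Proof.
move=> fL gL; have -> : (fun x => f x - g x) = (fun x => f x + -1 * g x).
  by apply/funext => x; rewrite mulN1r.
apply: ae_trans (hartD fL (L2Z _ gL)) _.
by apply: ae_imp (hartZ (-1) gL) => x ->; rewrite mulN1r.
Qed.

Lemma hart_ae f g : L2 f -> L2 g -> ae_eqR f g -> ae_eqR (hart f) (hart g).
Proof.
move=> fL gL fg; apply: n2_eq0_ae; [exact: hart_L2|exact: hart_L2|].
have dL := L2B fL gL.
rewrite -(n2_ae (hart_L2 dL) _ (hartB fL gL)); last by apply: L2B; exact: hart_L2.
rewrite n2_hart// (n2_ae dL L20); last by apply: ae_imp fg => x ->; rewrite subrr.
by rewrite /n2 /ip; under eq_Rintegral do rewrite mul0r; rewrite /Rintegral integral0 mulr0.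
Qed.

(** Inversion without any pointwise argument: when the squared norm of the difference is expanded,
    Plancherel's identity and the symmetry [ip_hart] make it 0. *)
Lemma hartK f : L2 f -> ae_eqR (hart (hart f)) (fun x => 2 * pi * f x).
Proof.
move=> fL; have hL := hart_L2 fL; have hhL := hart_L2 hL.
apply: n2_eq0_ae => //; first exact: L2Z.
rewrite n2B//; last exact: L2Z.
rewrite n2_hart// n2_hart// n2Z// (ipC _ (fun x => _ * f x)) ipZl// (ipC f) ip_hart//.
rewrite -/(n2 (hart f)) n2_hart//; ring.
Qed.

Lemma hart_cvg F f : (forall n, L2 (F n)) -> L2 f -> L2cvg F f ->
  L2cvg (fun n => hart (F n)) (hart f).
Proof.
move=> FL fL Ff; apply: cvg0_squeeze (cvg0_lin2 (2 * pi) 0 Ff Ff) => n.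
rewrite n2_ge0/= mul0r addr0 -n2_hart; last exact: L2B.
rewrite (n2_ae _ _ (hartB (FL n) fL))//; first exact/hart_L2/L2B.
by apply: L2B; exact: hart_L2.
Qed.

(** The formula holds for the integrable truncations by [hartley1_shift], and both sides are
    continuous in L^2. *)
Lemma hart_shift c f : L2 f -> ae_eqR (hart (fun x => f (x + c)))
  (fun xi => cos (c * xi) * hart f xi + - sin (c * xi) * hart f (- xi)).
Proof.
move=> fL; have hL := hart_L2 fL.
have tL n := trunc_L2 n fL; have ti n := trunc_intg n fL.
have htL n := hart_L2 (tL n).
have tsL n := L2_shift c (tL n).
have mc : msr (fun x : R => cos (c * x)) by exact: msr_cosM.
have ms : msr (fun x : R => - sin (c * x)) by apply: msrN; exact: msr_sinM.
have bc (x : R) : `|cos (c * x)| <= 1 by rewrite ler_norml cos_geN1 cos_le1.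
have bs (x : R) : `|- sin (c * x)| <= 1 by rewrite normrN ler_norml sin_geN1 sin_le1.
have rL g : L2 g -> L2 (fun xi => cos (c * xi) * g xi + - sin (c * xi) * g (- xi)).
  by move=> gL; apply: L2D; [exact: (L2_mulb gL mc bc)|exact: (L2_mulb (L2_opp gL) ms bs)].
have a1 := hart_cvg tsL (L2_shift c fL) (L2cvg_shift c tL fL (trunc_cvg fL)).
have a0 := hart_cvg tL fL (trunc_cvg fL).
have a2 := L2cvgD (fun n => L2_mulb (htL n) mc bc) (fun n => L2_mulb (L2_opp (htL n)) ms bs)
  (L2_mulb hL mc bc) (L2_mulb (L2_opp hL) ms bs) (L2cvg_mulb htL hL mc bc a0)
  (L2cvg_mulb (fun n => L2_opp (htL n)) (L2_opp hL) ms bs (L2cvg_opp htL hL a0)).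
refine (L2cvg_uniq (fun n => hart_L2 (tsL n)) (hart_L2 (L2_shift c fL)) (rL _ hL) a1 _).
apply: (L2cvg_ae (fun n => rL _ (htL n)) (fun n => hart_L2 (tsL n)) (rL _ hL) _ a2) => n.
apply: ae_sym.
have e1 := hart_intg (ti n) (tL n).
have e2 := hart_intg (intg_shift c (ti n)) (tsL n).
apply: ae_imp2 _ e2 (_ : {ae mu, forall xi, hart (trunc n f) xi = hartley1 (trunc n f) xi /\
   hart (trunc n f) (- xi) = hartley1 (trunc n f) (- xi)}).
  by move=> xi -> [-> ->]; rewrite hartley1_shift.
by apply: ae_imp2 _ e1 (ae_opp e1) => x; split.
Qed.

End hartley.

(** * Evolution equations in a semi-inner product space *)

Section evolution.
Context {R : realType} {V : lmodType R}.
Variable B : V -> V -> R.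
Hypothesis BC : forall x y, B x y = B y x.
Hypothesis BDl : forall x y z, B (x + y) z = B x z + B y z.
Hypothesis BZl : forall a x y, B (a *: x) y = a * B x y.
Hypothesis B_ge0 : forall x, 0 <= B x x.
Implicit Types (x y z : V) (t s : R) (g J : R -> V).

Lemma subrACA x y z w : (x - y) - (z - w) = (x - z) - (y - w).
Proof. by rewrite !opprB (addrC w) addrACA (addrC (- y)). Qed.

(** Only a seminorm, as [B] is not assumed definite: the vectors will be functions rather than
    classes, and uniqueness reads [nrm (x - y) = 0]. *)
Definition nrm x := Num.sqrt (B x x).

Hypothesis complete : forall u : nat -> V,
  (forall e : R, 0 < e -> exists N, forall m n, (N <= m)%N -> (N <= n)%N -> nrm (u m - u n) <= e) ->
  exists l, forall e : R, 0 < e -> exists N, forall n, (N <= n)%N -> nrm (u n - l) <= e.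

Lemma BDr x y z : B x (y + z) = B x y + B x z.
Proof. by rewrite BC BDl !(BC _ x). Qed.

Lemma BZr a x y : B x (a *: y) = a * B x y.
Proof. by rewrite BC BZl (BC y). Qed.

Lemma BNl x y : B (- x) y = - B x y.
Proof. by rewrite -scaleN1r BZl mulN1r. Qed.

Lemma BNr x y : B x (- y) = - B x y.
Proof. by rewrite BC BNl BC. Qed.

Lemma nrm_ge0 x : 0 <= nrm x. Proof. exact: sqrtr_ge0. Qed.

Lemma nrm_sqr x : nrm x ^+ 2 = B x x. Proof. by rewrite sqr_sqrtr. Qed.

Lemma nrmZ a x : nrm (a *: x) = `|a| * nrm x.
Proof. by rewrite /nrm BZl BZr mulrA -expr2 sqrtrM ?sqr_ge0// sqrtr_sqr. Qed.

Lemma nrmN x : nrm (- x) = nrm x.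
Proof. by rewrite -scaleN1r nrmZ normrN1 mul1r. Qed.

Lemma nrm0 : nrm 0 = 0.
Proof. by rewrite -(scale0r (0 : V)) nrmZ normr0 mul0r. Qed.

Lemma nrm_sym x y : nrm (x - y) = nrm (y - x).
Proof. by rewrite -nrmN opprB. Qed.

Lemma B_norm_le x y : `|B x y| <= nrm x * nrm y.
Proof.
have h : B x y ^+ 2 <= (nrm x * nrm y) ^+ 2.
  rewrite exprMn !nrm_sqr; apply: quad_discr => // t.
  have := B_ge0 (x + t *: y); rewrite BDl !BDr !BZl !BZr (BC y x).
  by congr (_ <= _); ring.
rewrite -(ler_pXn2r (n := 2)) ?nnegrE ?mulr_ge0 ?nrm_ge0// real_normK//.
exact: num_real.
Qed.

Lemma nrmD x y : nrm (x + y) <= nrm x + nrm y.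
Proof.
rewrite -(ler_pXn2r (n := 2)) ?nnegrE ?addr_ge0 ?nrm_ge0//.
rewrite nrm_sqr BDl !BDr (BC y x) sqrrD !nrm_sqr.
have := B_norm_le x y; have := ler_norm (B x y); lra.
Qed.

Lemma nrmB x y : nrm (x - y) <= nrm x + nrm y.
Proof. by rewrite -(nrmN y); exact: nrmD. Qed.

Lemma nrm_tri x y z : nrm (x - z) <= nrm (x - y) + nrm (y - z).
Proof. by rewrite -{1}(subrK y x) -addrA; exact: nrmD. Qed.

Lemma nrm_sub x y : nrm x <= nrm (x - y) + nrm y.
Proof. by rewrite -{1}(subrK y x); exact: nrmD. Qed.

Lemma nrm_dist x y : `|nrm x - nrm y| <= nrm (x - y).
Proof.
have := nrm_sub x y; have := nrm_sub y x; rewrite (nrm_sym y x) => h1 h2.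
by rewrite ler_norml; lra.
Qed.

Lemma nrm_sum n (F : 'I_n -> V) : nrm (\sum_(k < n) F k) <= \sum_(k < n) nrm (F k).
Proof.
elim/big_ind2: _ => [|a b c d ab cd|i _//]; first by rewrite nrm0.
by rewrite (le_trans (nrmD _ _))// lerD.
Qed.

Definition contT (T : R) g := forall t, 0 <= t <= T -> forall e : R, 0 < e ->
  exists2 d : R, 0 < d & forall s, 0 <= s <= T -> `|s - t| < d -> nrm (g s - g t) <= e.

(** [J' = g] on [[0, T]], uniformly and with a free tag [c] in each short interval. In this form the
    errors add up along a tagged partition, and no vector-valued integral is needed. *)
Definition primT (T : R) g J := forall e : R, 0 < e -> exists2 d : R, 0 < d &
  forall a c b, 0 <= a -> a <= c -> c <= b -> b <= T -> b - a < d ->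
  nrm (J b - J a - (b - a) *: g c) <= e * (b - a).

(** The abstract counterpart of [is_sobolev_integral]. *)
Definition riem g (a b : R) (J : V) := forall e : R, 0 < e -> exists2 d : R, 0 < d &
  forall (n : nat) (p c : nat -> R), p 0%N = a -> p n = b ->
    (forall k, (k < n)%N -> [/\ p k <= c k, c k <= p k.+1 & p k.+1 - p k < d]) ->
    nrm (\sum_(k < n) (p k.+1 - p k) *: g (c k) - J) <= e.

Lemma ucontT T g : contT T g -> forall e : R, 0 < e -> exists2 d : R, 0 < d &
  forall s t, 0 <= s <= T -> 0 <= t <= T -> `|s - t| < d -> nrm (g s - g t) <= e.
Proof.
move=> gc e e0; apply: lebesgue_number => x xT.
have e20 : 0 < e / 2 by rewrite divr_gt0.
have [d d0 dP] := gc x xT _ e20; exists d => // s t sT tT sx tx.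
have := dP s sT sx; have := dP t tT tx; rewrite nrm_sym.
by have := nrm_tri (g s) (g x) (g t); lra.
Qed.

(** A property of intervals that is stable under concatenation propagates from short intervals to
    all of them. Steps of length [d / 2] stay strictly below the threshold [d]. *)
Lemma chain (T d : R) (P : R -> R -> Prop) : 0 < d ->
  (forall a b, 0 <= a -> a <= b -> b <= T -> b - a < d -> P a b) ->
  (forall a b c, 0 <= a -> a <= b -> b <= c -> c <= T -> P a b -> P b c -> P a c) ->
  forall a b, 0 <= a -> a <= b -> b <= T -> P a b.
Proof.
move=> d0 loc tr.
have H (n : nat) : forall a b, 0 <= a -> a <= b -> b <= T -> b - a <= n%:R * (d / 2) -> P a b.
  elim: n => [|n ih] a b a0 ab bT h; first by apply: loc => //; lra.
  have nE : n.+1%:R = n%:R + 1 :> R by rewrite natr1.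
  have [ba|ba] := ltP (b - a) d; first exact: loc.
  apply: (tr a (a + d / 2) b) => //; try lra.
    by apply: loc; lra.
  by apply: ih; rewrite nE in h; lra.
move=> a b a0 ab bT; pose n := Num.bound ((b - a) / (d / 2)).
apply: (H n) => //; rewrite -ler_pdivrMr ?divr_gt0//; apply: ltW.
by apply: archi_boundP; rewrite divr_ge0 ?subr_ge0// divr_ge0// ltW.
Qed.

Lemma contT_bounded T g : 0 <= T -> contT T g ->
  exists2 M : R, 0 <= M & forall t, 0 <= t <= T -> nrm (g t) <= M.
Proof.
move=> T0 gc; have [d d0 dP] := ucontT gc ltr01.
have H (n : nat) : forall t, 0 <= t <= T -> t <= n%:R * (d / 2) -> nrm (g t) <= nrm (g 0) + n%:R.
  elim: n => [|n ih] t /andP[t0 tT] tn.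
    by have -> : t = 0 by [lra|]; rewrite addr0.
  have [td|td] := ltP t d.
    have := dP t 0 _ _ _; rewrite subr0 ger0_norm// => /(_ _ _ td).
    rewrite t0 tT lexx T0 => /(_ isT isT) h.
    have nE : n.+1%:R = n%:R + 1 :> R by rewrite natr1.
    have := nrm_sub (g t) (g 0); rewrite nE; have : 0 <= n%:R :> R by []; lra.
  have nE : n.+1%:R = n%:R + 1 :> R by rewrite natr1.
  have st : 0 <= t - d / 2 <= T by apply/andP; split; lra.
  have h1 : nrm (g (t - d / 2)) <= nrm (g 0) + n%:R by apply: ih => //; rewrite nE in tn; lra.
  have h2 : nrm (g t - g (t - d / 2)) <= 1.
    apply: dP => //; first by rewrite t0.
    by rewrite opprB addrC subrK ger0_norm; lra.
  by have := nrm_sub (g t) (g (t - d / 2)); rewrite nE; lra.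
exists (nrm (g 0) + (Num.bound (T / (d / 2)))%:R); first by rewrite addr_ge0 ?nrm_ge0.
move=> t tT; apply: H => //; have /andP[t0 tT'] := tT.
rewrite -ler_pdivrMr ?divr_gt0//; apply: le_trans (_ : T / (d / 2) <= _).
  by rewrite ler_wpM2r// invr_ge0 divr_ge0// ltW.
by apply/ltW/archi_boundP; rewrite divr_ge0// divr_ge0// ltW.
Qed.

(** Mean value inequality. The hypothesis on [phi] is a finite-difference form of [r <= phi']; a
    linear or a convex [phi] with derivative [r] satisfies it. *)
Lemma primT_le T g J (r phi : R -> R) : primT T g J ->
  (forall t, 0 <= t <= T -> nrm (g t) <= r t) ->
  (forall a b, 0 <= a -> a <= b -> b <= T -> (b - a) * r a <= phi b - phi a) ->
  forall a b, 0 <= a -> a <= b -> b <= T -> nrm (J b - J a) <= phi b - phi a.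
Proof.
move=> gJ gr rphi a b a0 ab bT; apply/ler_addgt0Pr => e e0.
(* Dividing by [T + 1] rather than by [T] covers [T = 0]. *)
pose r0 := e / (T + 1); have T0 : 0 < T + 1 by lra.
have r00 : 0 < r0 by rewrite divr_gt0.
have [d d0 dP] := gJ _ r00.
have H : nrm (J b - J a) <= phi b - phi a + r0 * (b - a).
  apply: (@chain T d (fun a b => nrm (J b - J a) <= phi b - phi a + r0 * (b - a))) => //.
    move=> {a b a0 ab bT} a b a0 ab bT bad.
    have := dP a a b a0 (lexx _) ab bT bad.
    have := nrm_sub (J b - J a) ((b - a) *: g a); rewrite nrmZ ger0_norm ?subr_ge0//.
    have : (b - a) * nrm (g a) <= (b - a) * r a.
      by rewrite ler_wpM2l ?subr_ge0// gr// a0/= (le_trans ab).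
    have := rphi a b a0 ab bT; lra.
  move=> {a b a0 ab bT} a b c a0 ab bc cT h1 h2.
  have := nrm_tri (J c) (J b) (J a); nra.
apply: le_trans H _; rewrite lerD2l /r0 -mulrA ler_piMr ?(ltW e0)//.
by rewrite mulrC ler_pdivrMr// mul1r; lra.
Qed.

Lemma primT_sub T g g' J J' : primT T g J -> primT T g' J' ->
  primT T (fun t => g t - g' t) (fun t => J t - J' t).
Proof.
move=> h h' e e0; have e20 : 0 < e / 2 by rewrite divr_gt0.
have [d d0 dP] := h _ e20; have [d' d0' dP'] := h' _ e20.
exists (Num.min d d') => [|a c b a0 ac cb bT]; first by rewrite lt_min d0.
rewrite lt_min => /andP[h1 h2].
have := dP a c b a0 ac cb bT h1; have := dP' a c b a0 ac cb bT h2.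
have -> : J b - J' b - (J a - J' a) - (b - a) *: (g c - g' c) =
  (J b - J a - (b - a) *: g c) - (J' b - J' a - (b - a) *: g' c).
  by rewrite scalerBr subrACA (subrACA (J b - J a)).
have := nrmB (J b - J a - (b - a) *: g c) (J' b - J' a - (b - a) *: g' c); lra.
Qed.

Lemma primT_null T g g' J J' : primT T g J ->
  (forall t, 0 <= t <= T -> nrm (g t - g' t) = 0) ->
  (forall t, 0 <= t <= T -> nrm (J t - J' t) = 0) -> primT T g' J'.
Proof.
move=> gJ gg JJ e e0; have [d d0 dP] := gJ _ e0; exists d => // a c b a0 ac cb bT bad.
apply: le_trans (dP a c b a0 ac cb bT bad).
have -> : J' b - J' a - (b - a) *: g' c =
  (J b - J a - (b - a) *: g c) - ((J b - J' b) - (J a - J' a) - (b - a) *: (g c - g' c)).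
  by rewrite scalerBr (subrACA (J b)) (subrACA (J b - J a) (J' b - J' a)) subKr.
apply: le_trans (nrmB _ _) _; rewrite gerDl.
apply: le_trans (nrmB _ _) _; rewrite nrmZ gg ?mulr0 ?addr0; last by rewrite (le_trans a0)// (le_trans cb).
by apply: le_trans (nrmB _ _) _; rewrite !JJ ?addr0//; apply/andP; split; lra.
Qed.

Lemma primT_contT T g J M : primT T g J -> (forall t, 0 <= t <= T -> nrm (g t) <= M) ->
  contT T J.
Proof.
move=> gJ gM t tT e e0.
have lip a b : 0 <= a -> a <= b -> b <= T -> nrm (J b - J a) <= M * b - M * a.
  by apply: (primT_le gJ gM) => a' b' _ _ _; lra.
have M0 : 0 <= M by rewrite (le_trans _ (gM t tT))// nrm_ge0.
have d0 : 0 < e / (M + 1) by rewrite divr_gt0//; lra.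
exists (e / (M + 1)) => // s sT; rewrite ltr_pdivlMr; last by lra.
move/andP: tT => [t0 tT]; move/andP: sT => [s0 sT].
have [st|ts] := leP s t.
  rewrite distrC ger0_norm ?subr_ge0// nrm_sym; have := lip s t s0 st tT; nra.
have ts' := ltW ts; rewrite ger0_norm ?subr_ge0//; have := lip t s t0 ts' sT; nra.
Qed.

Lemma primT_riem T g J t : primT T g J -> 0 <= t <= T -> riem g 0 t (J t - J 0).
Proof.
move=> gJ /andP[t0 tT] e e0.
have r0 : 0 < e / (t + 1) by rewrite divr_gt0//; lra.
have [d d0 dP] := gJ _ r0; exists d => // n p c p0 pn H.
have pm k : (k <= n)%N -> 0 <= p k /\ forall j, (j <= k)%N -> p j <= p k.
  elim: k => [|k ih] kn; first by rewrite p0; split => // j; rewrite leqn0 => /eqP ->; rewrite p0.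
  have [ih1 ih2] := ih (ltnW kn); have [h1 h2 _] := H k kn.
  split; first by lra.
  move=> j; rewrite leq_eqVlt => /predU1P[->//|]; rewrite ltnS => /ih2; lra.
have E : J t - J 0 = \sum_(k < n) (J (p k.+1) - J (p k)).
  by rewrite -(big_mkord xpredT (fun k => J (p k.+1) - J (p k))) telescope_sumr// pn p0.
rewrite E -sumrB; apply: le_trans (nrm_sum _) _.
apply: le_trans (_ : \sum_(k < n) (e / (t + 1) * (p k.+1 - p k)) <= _).
  apply: ler_sum => k _; rewrite nrm_sym; have [h1 h2 h3] := H k (ltn_ord k).
  have [q1 _] := pm k (ltnW (ltn_ord k)).
  have [_ q2] := pm n (leqnn n); have q3 := q2 k.+1 (ltn_ord k).
  by apply: dP => //; rewrite pn in q3; lra.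
rewrite -mulr_sumr -(big_mkord xpredT (fun k => p k.+1 - p k)) telescope_sumr// pn p0 subr0.
by rewrite -mulrA ler_piMr ?(ltW e0)// mulrC ler_pdivrMr ?mul1r; lra.
Qed.

(** The difference [J b - J a] has to be recovered from integrals that both start at 0. A fine
    partition of [[0, a]] is continued to one of [[0, b]], so the two Riemann sums differ by a sum
    over [[a, b]], which uniform continuity compares with [(b - a) *: g c]. *)
Lemma riem_primT T g J : contT T g -> (forall t, 0 <= t <= T -> riem g 0 t (J t)) -> primT T g J.
Proof.
move=> gc gJ e e0; have [d d0 dP] := ucontT gc e0.
exists d => // a c b a0 ac cb bT bad.
apply/ler_addgt0Pr => eta eta0; have e20 : 0 < eta / 2 by rewrite divr_gt0.
have aT : 0 <= a <= T by apply/andP; split; lra.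
have bT' : 0 <= b <= T by apply/andP; split; lra.
have [d1 d10 d1P] := gJ a aT _ e20; have [d2 d20 d2P] := gJ b bT' _ e20.
pose m := Num.min d1 d2; have m0 : 0 < m by rewrite lt_min d10.
(* Both halves get [N] equal pieces, of lengths [a / N] and [(b - a) / N], each at most
   [b / N < m]. *)
pose N := (Num.bound (b / m)).+1.
have N0 : 0 < N%:R :> R by [].
have bN : b / N%:R < m.
  rewrite ltr_pdivrMr// mulrC -ltr_pdivrMr//; apply: lt_le_trans (archi_boundP _) _.
    by rewrite divr_ge0 ?(ltW m0)//; lra.
  by rewrite ler_nat.
pose p1 (k : nat) := a * (k%:R / N%:R).
pose p2 (k : nat) := a + (b - a) * (k%:R / N%:R).
pose p (k : nat) := if (k <= N)%N then p1 k else p2 (k - N)%N.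
have p1S k : p1 k.+1 - p1 k = a / N%:R.
  by rewrite /p1 -natr1 -mulrBr -mulrBl; congr (_ * _); ring.
have p2S k : p2 k.+1 - p2 k = (b - a) / N%:R.
  by rewrite /p2 opprD addrACA subrr add0r -mulrBr -mulrBl -natr1; congr (_ * _); ring.
have p2N : p2 N = b by rewrite /p2 divff ?mulr1 ?gt_eqF//; ring.
have p1N : p1 N = a by rewrite /p1 divff ?mulr1 ?gt_eqF.
have p20 : p2 0%N = a by rewrite /p2 mul0r mulr0 addr0.
have aN : a / N%:R < m by apply: le_lt_trans bN; rewrite ler_wpM2r ?invr_ge0//; lra.
have baN : (b - a) / N%:R < m by apply: le_lt_trans bN; rewrite ler_wpM2r ?invr_ge0//; lra.
have aN0 : 0 <= a / N%:R by rewrite divr_ge0.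
have baN0 : 0 <= (b - a) / N%:R by rewrite divr_ge0// subr_ge0; lra.
have pl k : (k < N)%N -> p k = p1 k /\ p k.+1 = p1 k.+1 by move=> kN; rewrite /p kN (ltnW kN).
have pr k : p (N + k)%N = p2 k /\ p (N + k).+1 = p2 k.+1.
  rewrite /p -addnS; case: k => [|k]; first by rewrite addn0 leqnn p1N p20 addn1 ltnn subSnn.
  have l1 (j : nat) : (N + j.+1 <= N)%N = false by apply/negbTE; rewrite -ltnNge addnS ltnS leq_addr.
  by rewrite !l1 !addKn.
have h1 := d1P N p1 p1 _ p1N _.
have {h1} h1 : nrm (\sum_(k < N) (p1 k.+1 - p1 k) *: g (p1 k) - J a) <= eta / 2.
  apply: h1; first by rewrite /p1 mul0r mulr0.
  move=> k _; have := p1S k; rewrite lt_min in aN; move/andP: aN => [? ?].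
  by split => //; lra.
have {d2P} h2 : nrm (\sum_(k < N + N) (p k.+1 - p k) *: g (p k) - J b) <= eta / 2.
  apply: d2P.
  - by rewrite /p /p1 mul0r mulr0.
  - by have [-> _] := pr N.
  - rewrite lt_min in aN; move/andP: aN => [? ?].
    rewrite lt_min in baN; move/andP: baN => [? ?].
    move=> k _; have [kN|Nk] := ltnP k N.
      have [-> ->] := pl k kN; have := p1S k; split => //; lra.
    rewrite -(subnKC Nk); have [-> ->] := pr (k - N)%N; have := p2S (k - N)%N; split => //; lra.
have E : \sum_(k < N + N) (p k.+1 - p k) *: g (p k) =
    \sum_(k < N) (p1 k.+1 - p1 k) *: g (p1 k) + \sum_(k < N) (p2 k.+1 - p2 k) *: g (p2 k).
  rewrite big_split_ord/=; congr (_ + _); apply: eq_bigr => k _.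
    by have [-> ->] := pl k (ltn_ord k).
  by have [-> ->] := pr k.
have h3 : nrm (\sum_(k < N) (p2 k.+1 - p2 k) *: g (p2 k) - (b - a) *: g c) <= e * (b - a).
  have E2 : (b - a) *: g c = \sum_(k < N) (p2 k.+1 - p2 k) *: g c.
    rewrite -scaler_suml -(big_mkord xpredT (fun k => p2 k.+1 - p2 k)) telescope_sumr//.
    by rewrite p2N p20.
  rewrite E2 -sumrB; apply: le_trans (nrm_sum _) _.
  apply: le_trans (_ : \sum_(k < N) (p2 k.+1 - p2 k) * e <= _).
    apply: ler_sum => k _; rewrite -scalerBr nrmZ ger0_norm ?p2S// ler_wpM2l//.
    have u0 : 0 <= k%:R / N%:R :> R by rewrite divr_ge0.
    have u1 : k%:R / N%:R <= 1 :> R by rewrite ler_pdivrMr// mul1r ler_nat ltnW.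
    have q1 : a <= p2 k by rewrite /p2 lerDl mulr_ge0//; lra.
    have q2 : p2 k <= b by rewrite /p2 -lerBrDl ler_piMr//; lra.
    clear - q1 q2 a0 ac cb bT bad dP.
    apply: dP; [by apply/andP; split; lra|by apply/andP; split; lra|].
    by rewrite ltr_norml; lra.
  rewrite -mulr_suml -(big_mkord xpredT (fun k => p2 k.+1 - p2 k)) telescope_sumr//.
  by rewrite p2N p20 mulrC.
move: h2; rewrite E; set X := \sum_(k < N) _ in h1 *; set Y := \sum_(k < N) _ in h3 *.
move=> h2.
have -> : J b - J a - (b - a) *: g c = (Y - (b - a) *: g c) - ((X + Y - J b) - (X - J a)).
  rewrite (subrACA (X + Y)) (addrC X) addrK subrACA subrr sub0r opprB.
  by rewrite addrC.
apply: le_trans (nrmB _ _) _; have := nrmB (X + Y - J b) (X - J a); lra.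
Qed.


Lemma primT_subr T g J a : primT T g (fun s => J s - a) -> primT T g J.
Proof.
move=> H e e0; have [d d0 dP] := H e e0; exists d => // x c y x0 xc cy yT xy.
by have := dP x c y x0 xc cy yT xy; rewrite subrACA subrr subr0.
Qed.

Lemma riem_null g (a b : R) (J J' : V) : riem g a b J -> nrm (J - J') = 0 -> riem g a b J'.
Proof.
move=> H JJ e e0; have [d d0 dP] := H e e0; exists d => // n q c q0 qn h.
by apply: le_trans (nrm_tri _ J _) _; rewrite JJ addr0; exact: dP.
Qed.

Lemma riem_trivial g (a : R) (J : V) : riem g a a J -> nrm J = 0.
Proof.
move=> H; apply/eqP; rewrite eq_le nrm_ge0 andbT; apply/ler_addgt0Pr => e e0; rewrite add0r.
have [d d0 dP] := H e e0.
(* The empty partition is admissible when the endpoints coincide, and its sum is 0. *)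
have h k : (k < 0)%N -> [/\ a <= a, a <= a & a - a < d] by [].
have := dP 0%N (fun=> a) (fun=> a) erefl erefl h.
by rewrite big_ord0 sub0r nrmN.
Qed.

Definition cont g := forall t, 0 <= t -> forall e : R, 0 < e ->
  exists2 d : R, 0 < d & forall s, 0 <= s -> `|s - t| < d -> nrm (g s - g t) <= e.

Lemma contT_cont g : (forall T, contT T g) -> cont g.
Proof.
move=> gc t t0 e e0; have t1 : 0 <= t <= t + 1 by rewrite t0 lerDl ler01.
have [d d0 dP] := gc _ t t1 _ e0; exists (Num.min d 1); first by rewrite lt_min d0 ltr01.
move=> s s0; rewrite lt_min => /andP[sd st]; apply: dP => //; rewrite s0.
by move: st; rewrite ltr_norml => /andP[_ h]; lra.
Qed.

Lemma cont_contT T g : cont g -> contT T g.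
Proof.
move=> gc t /andP[t0 _] e e0; have [d d0 dP] := gc t t0 e e0.
by exists d => // s /andP[s0 _]; exact: dP.
Qed.

(* The primitive of the step function equal to [g (k h)] on [k h, (k+1) h]. *)
Definition step_prim g (h : R) (N : nat) t : V :=
  \sum_(k < N) (Num.min t (k.+1%:R * h) - Num.min t (k%:R * h)) *: g (k%:R * h).

Lemma step_prim_le g (h : R) (N : nat) (T d e : R) a c b : 0 < h -> T <= N%:R * h ->
  (forall s t, 0 <= s <= T -> 0 <= t <= T -> `|s - t| < d -> nrm (g s - g t) <= e) ->
  0 <= a -> a <= c -> c <= b -> b <= T -> b - a + h < d ->
  nrm (step_prim g h N b - step_prim g h N a - (b - a) *: g c) <= e * (b - a).
Proof.
move=> h0 TN ge a0 ac cb bT bad.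
(* The length of the part of [[a, b]] inside [[k h, (k + 1) h]]. These lengths add up to [b - a],
   and where one is nonzero the node [k h] is within [b - a + h] of [c]. *)
pose w (k : nat) := (Num.min b (k.+1%:R * h) - Num.min b (k%:R * h)) -
  (Num.min a (k.+1%:R * h) - Num.min a (k%:R * h)).
have sumw : \sum_(k < N) w k = b - a.
  rewrite sumrB -(big_mkord xpredT (fun k => Num.min b (k.+1%:R * h) - Num.min b (k%:R * h))).
  rewrite -(big_mkord xpredT (fun k => Num.min a (k.+1%:R * h) - Num.min a (k%:R * h))).
  rewrite !(telescope_sumr (fun k => Num.min _ (k%:R * h)))// mul0r.
  have -> : Num.min b (N%:R * h) = b by rewrite min_l//; lra.
  have -> : Num.min a (N%:R * h) = a by rewrite min_l//; lra.
  have -> : Num.min b 0 = 0 by rewrite min_r//; lra.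
  have -> : Num.min a 0 = 0 by rewrite min_r//; lra.
  by rewrite !subr0.
have -> : step_prim g h N b - step_prim g h N a - (b - a) *: g c =
    \sum_(k < N) w k *: (g (k%:R * h) - g c).
  rewrite /step_prim -sumrB -sumw scaler_suml -sumrB.
  by apply: eq_bigr => k _; rewrite -scalerBl scalerBr.
apply: le_trans (nrm_sum _) _; rewrite -sumw mulr_sumr; apply: ler_sum => k _.
have kS : k.+1%:R * h = k%:R * h + h by rewrite -natr1 mulrDl mul1r.
have k0 : 0 <= k%:R * h by rewrite mulr_ge0// ltW.
have w0 : 0 <= w k.
  rewrite /w kS; case: (leP b (k%:R * h + h)); case: (leP b (k%:R * h));
  case: (leP a (k%:R * h + h)); case: (leP a (k%:R * h)); lra.
rewrite nrmZ ger0_norm// mulrC.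
have [wk0|wk0] := eqVneq (w k) 0; first by rewrite wk0 !mulr0.
rewrite ler_wpM2r//.
have k1 : k%:R * h < b.
  rewrite ltNge; apply: contra wk0 => bk; apply/eqP; rewrite /w kS.
  by rewrite !min_l; lra.
have k2 : a < k%:R * h + h.
  rewrite ltNge; apply: contra wk0 => bk; apply/eqP; rewrite /w kS.
  by rewrite !min_r; lra.
apply: ge; [by apply/andP; split; lra|by apply/andP; split; lra|].
by rewrite ltr_norml; lra.
Qed.

Lemma prim_ex g : cont g -> exists J, J 0 = 0 /\ forall T, primT T g J.
Proof.
move=> gc.
(* [(n + 1)^2] steps of length [1 / (n + 1)] cover [[0, n + 1]]: the mesh tends to 0 and every [T]
   is eventually covered. *)
pose S (n : nat) := step_prim g n.+1%:R^-1 (n.+1 * n.+1).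
have h0 (n : nat) : 0 < n.+1%:R^-1 :> R by rewrite invr_gt0.
have hN (n : nat) : (n.+1 * n.+1)%:R * n.+1%:R^-1 = n.+1%:R :> R.
  by rewrite natrM mulfK// pnatr_eq0.
have small (r : R) : 0 < r -> exists N, forall n, (N <= n)%N -> n.+1%:R^-1 <= r.
  move=> r0; exists (Num.bound r^-1) => n Nn; rewrite -(invrK r) lef_pV2 ?posrE ?invr_gt0//.
  apply/ltW; apply: lt_le_trans (archi_boundP _) _; first by rewrite invr_ge0 ltW.
  by rewrite ler_nat (leq_trans Nn).
have big (T : R) : exists N, forall n, (N <= n)%N -> T <= n.+1%:R.
  exists (Num.bound `|T|) => n Nn; apply: le_trans (ler_norm T) _; apply/ltW.
  by apply: lt_le_trans (archi_boundP _) _ => //; rewrite ler_nat (leq_trans Nn).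
have S0 n : S n 0 = 0.
  apply: big1 => k _; rewrite !min_l ?subrr ?scale0r//; rewrite mulr_ge0// ltW//.
have close (T : R) : forall e : R, 0 < e -> exists2 d : R, 0 < d & exists N, forall n, (N <= n)%N ->
    forall a c b, 0 <= a -> a <= c -> c <= b -> b <= T -> b - a < d ->
    nrm (S n b - S n a - (b - a) *: g c) <= e * (b - a).
  move=> e e0; have [d d0 dP] := ucontT (@cont_contT T g gc) e0.
  have d20 : 0 < d / 2 by rewrite divr_gt0.
  exists (d / 2) => //; have [N1 N1P] := small (d / 2) d20; have [N2 N2P] := big T.
  exists (maxn N1 N2) => n; rewrite geq_max => /andP[n1 n2] a c b a0 ac cb bT bad.
  apply: (@step_prim_le _ _ _ T d) => //; first by rewrite hN N2P.
  by move: (N1P n n1) bad; move: (n.+1%:R^-1 : R) => r hr bad; lra.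
have cau t : forall e : R, 0 < e -> exists N, forall m n, (N <= m)%N -> (N <= n)%N ->
    nrm (S m t - S n t) <= e.
  move=> e e0; have [t0|t0] := ltP t 0.
    exists 0%N => m n _ _.
    suff E k : S k t = 0 by rewrite !E subrr nrm0 ltW.
    apply: big1 => j _; rewrite !min_l ?subrr ?scale0r//.
      by apply: le_trans (ltW t0) _; rewrite mulr_ge0// ltW.
    by apply: le_trans (ltW t0) _; rewrite mulr_ge0// ltW.
  have r0 : 0 < e / (2 * (t + 1)) by rewrite divr_gt0// mulr_gt0//; lra.
  have [d d0 [N NP]] := close t _ r0; exists N => m n Nm Nn.
  pose D a := S m a - S n a.
  have H : nrm (D t - D 0) <= e / (t + 1) * (t - 0).
    apply: (@chain t d (fun a b => nrm (D b - D a) <= e / (t + 1) * (b - a))) => //.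
      move=> a b a0 ab bT bad.
      have h1 := NP m Nm a a b a0 (lexx _) ab bT bad.
      have h2 := NP n Nn a a b a0 (lexx _) ab bT bad.
      have -> : D b - D a = (S m b - S m a - (b - a) *: g a) - (S n b - S n a - (b - a) *: g a).
        by rewrite /D subrACA [RHS]subrACA subrr subr0.
      apply: le_trans (nrmB _ _) _.
      have -> : e / (t + 1) = e / (2 * (t + 1)) + e / (2 * (t + 1)) by field; lra.
      by rewrite mulrDl lerD.
    move=> a b c a0 ab bc cT h1 h2; have := nrm_tri (D c) (D b) (D a); lra.
  move: H; rewrite /D !S0 subrr subr0 subr0 => H; apply: le_trans H _.
  by rewrite -mulrA ler_piMr ?(ltW e0)// mulrC ler_pdivrMr ?mul1r; lra.
have [J JP] := choice (fun t => complete (cau t)).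
(* The limit at time 0 is determined only up to vectors of norm 0; subtracting it gives an exact
   zero. *)
exists (fun t => J t - J 0); split; first by rewrite subrr.
move=> T e e0; have [d d0 [N NP]] := close T e e0; exists d => // a c b a0 ac cb bT bad.
apply/ler_addgt0Pr => eta eta0; have e20 : 0 < eta / 2 by rewrite divr_gt0.
have [Na NaP] := JP a _ e20; have [Nb NbP] := JP b _ e20.
pose n := maxn N (maxn Na Nb).
have h1 := NP n (leq_maxl _ _) a c b a0 ac cb bT bad.
have h2 := NaP n (leq_trans (leq_maxl _ _) (leq_maxr _ _)).
have h3 := NbP n (leq_trans (leq_maxr _ _) (leq_maxr _ _)).
have -> : J b - J 0 - (J a - J 0) - (b - a) *: g c =
  (S n b - S n a - (b - a) *: g c) - ((S n b - J b) - (S n a - J a)).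
  rewrite [J b - _ - _]subrACA subrr subr0 (subrACA (S n b)) [RHS]subrACA.
  by rewrite subrr sub0r opprB.
apply: le_trans (nrmB _ _) _; have := nrmB (S n b - J b) (S n a - J a); lra.
Qed.


(** * Picard iteration for a bounded, globally Lipschitz field *)

Section picard.
Variables (Phi : R -> V -> V) (M L : R) (a : V).
Hypothesis L0 : 0 < L.
Hypothesis PhiM : forall t v, 0 <= t -> nrm (Phi t v) <= M.
Hypothesis PhiL : forall t v w, 0 <= t -> nrm (Phi t v - Phi t w) <= L * nrm (v - w).
Hypothesis PhiC : forall v, cont (Phi ^~ v).

Lemma cont_Phi v : cont v -> cont (fun t => Phi t (v t)).
Proof.
move=> vc t t0 e e0.
have e1 : 0 < e / (2 * L) by rewrite divr_gt0// mulr_gt0.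
have e2 : 0 < e / 2 by rewrite divr_gt0.
have [d d0 dP] := vc t t0 _ e1; have [d' d0' dP'] := PhiC (v t) t0 e2.
exists (Num.min d d') => [|s s0]; first by rewrite lt_min d0.
rewrite lt_min => /andP[h1 h2].
apply: le_trans (nrm_tri _ (Phi s (v t)) _) _.
have h3 := PhiL (v s) (v t) s0; have h4 := dP s s0 h1; have h5 := dP' s s0 h2.
have : L * nrm (v s - v t) <= e / 2.
  by have -> : e / 2 = L * (e / (2 * L)) by [field; exact: lt0r_neq0|]; rewrite ler_pM2l.
lra.
Qed.

Lemma M_ge0 : 0 <= M. Proof. exact: le_trans (nrm_ge0 _) (PhiM 0 (lexx 0)). Qed.

Lemma lip_cont v : (forall s t, 0 <= s -> s <= t -> nrm (v t - v s) <= M * t - M * s) -> cont v.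
Proof.
move=> vl t t0 e e0; have M0 := M_ge0.
have d0 : 0 < e / (M + 1) by rewrite divr_gt0//; lra.
exists (e / (M + 1)) => // s s0; rewrite ltr_pdivlMr; last by lra.
have [st|ts] := leP s t.
  rewrite distrC ger0_norm ?subr_ge0// nrm_sym; have := vl s t s0 st; nra.
have ts' := ltW ts; rewrite ger0_norm ?subr_ge0//; have := vl t s t0 ts'; nra.
Qed.

Lemma prim_lip (g J : R -> V) : (forall t, 0 <= t -> nrm (g t) <= M) -> (forall T, primT T g J) ->
  forall s t, 0 <= s -> s <= t -> nrm (J t - J s) <= M * t - M * s.
Proof.
move=> gM gJ s t s0 st; apply: (primT_le (gJ t)) => // [u /andP[u0 _]|]; first exact: gM.
by move=> a' b' _ _ _ /=; rewrite mulrC mulrBr.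
Qed.

Lemma picard_step_ex v : cont v -> exists w, [/\ w 0 = a, cont w &
  forall T, primT T (fun t => Phi t (v t)) w].
Proof.
move=> /cont_Phi/prim_ex[J [J0 JP]].
have P' T : primT T (fun t => Phi t (v t)) (fun t => a + J t).
  move=> e e0; have [d d0 dP] := JP T e e0; exists d => // x c b x0 xc cb bT bad.
  by rewrite opprD addrACA subrr add0r; exact: dP.
exists (fun t => a + J t); split => //; first by rewrite J0 addr0.
apply: lip_cont; apply: prim_lip P' => t t0; exact: PhiM.
Qed.

Lemma picard_seq : exists v : nat -> R -> V, [/\ forall n, cont (v n), forall n, v n.+1 0 = a,
  v 0%N = (fun=> a) & forall n T, primT T (fun t => Phi t (v n t)) (v n.+1)].
Proof.
pose st v w := cont v -> [/\ w 0 = a, cont w & forall T, primT T (fun t => Phi t (v t)) w].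
(* The axiom of choice asks for a successor of every curve; for a discontinuous one any value will
   do. *)
have H v : exists w, st v w.
  have [vc|nv] := pselect (cont v).
    by have [w wP] := picard_step_ex vc; exists w.
  by exists v => /nv.
have [F FP] := choice H.
pose v n := iter n F (fun=> a).
have vc n : cont (v n).
  elim: n => [|n ih]; last by have [] := FP _ ih.
  by move=> t t0 e e0; exists 1 => // s _ _; rewrite subrr nrm0 ltW.
by exists v; split => // n; have [] := FP _ (vc n).
Qed.

(** Convexity of the exponential, in the shape that [primT_le] asks of a comparison function. *)
Lemma expR_sub_ge (k x y : R) : 0 <= k -> (y - x) * (k * expR (k * x)) <= expR (k * y) - expR (k * x).
Proof.
move=> k0; have -> : expR (k * y) = expR (k * (y - x)) * expR (k * x) by rewrite -expRD; congr expR; ring.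
have := expR_ge1Dx (k * (y - x)); have := expR_gt0 (k * x); nra.
Qed.

(** With this constant the first increment, at most [M * t = K * (2 * L * t)], is below
    [K * expR (2 * L * t)]. *)
Let K := M / (2 * L).

(** With the weight [expR (2 * L * t)], integrating a Lipschitz bound [L] gains a factor 1/2, so the
    iteration contracts on the whole half-line at once. *)
Lemma picard_seq_le (v : nat -> R -> V) : (forall n, v n.+1 0 = a) -> v 0%N = (fun=> a) ->
  (forall n T, primT T (fun t => Phi t (v n t)) (v n.+1)) ->
  forall n t, 0 <= t -> nrm (v n.+1 t - v n t) <= K / 2 ^+ n * expR (2 * L * t).
Proof.
move=> va v0 vP; have M0 := M_ge0; have L20 : 0 < 2 * L by rewrite mulr_gt0.
have K0 : 0 <= K by rewrite divr_ge0// ltW.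
elim=> [|n ih] t t0.
  rewrite v0 expr0 divr1 -(va 0%N).
  have := prim_lip (fun t => PhiM (v 0%N t)) (vP 0%N) (lexx 0) t0.
  rewrite mulr0 subr0 => h; apply: le_trans h _.
  have -> : M * t = K * (2 * L * t) by rewrite /K; field; exact: lt0r_neq0.
  by rewrite ler_wpM2l// ltW//; have := expR_ge1Dx (2 * L * t); lra.
have c0 : 0 <= K / 2 ^+ n.+1 by rewrite divr_ge0// exprn_ge0.
have h := primT_le (r := fun t => L * (K / 2 ^+ n * expR (2 * L * t)))
  (phi := fun t => K / 2 ^+ n.+1 * expR (2 * L * t)) (primT_sub (vP n.+1 t) (vP n t)) _ _ (lexx 0) t0 (lexx t).
have := h; rewrite !va subrr subr0 => {}h.
apply: le_trans (h _ _) _.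
- move=> s /andP[s0 _]; apply: le_trans (PhiL _ _ s0) _.
  by rewrite ler_pM2l// ih.
- move=> x y x0 xy yt; rewrite -mulrBr.
  have := ler_wpM2l c0 (@expR_sub_ge (2 * L) x y (ltW L20)).
  congr (_ <= _); rewrite exprS; field.
  by rewrite expf_neq0.
- by rewrite gerBl mulr_ge0// expR_ge0.
Qed.

Lemma picard : exists v, v 0 = a /\ forall T, primT T (fun t => Phi t (v t)) v.
Proof.
have [v [vc va v0 vP]] := picard_seq.
have vle := picard_seq_le va v0 vP.
have M0 := M_ge0; have L20 : 0 < 2 * L by rewrite mulr_gt0.
have K0 : 0 <= K by rewrite divr_ge0// ltW.
have tail n k t : 0 <= t -> nrm (v (n + k)%N t - v n t) <= 2 * K / 2 ^+ n * expR (2 * L * t).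
  move=> t0; have E0 := expR_ge0 (2 * L * t).
  suff : nrm (v (n + k)%N t - v n t) <= 2 * K * (2 ^- n - 2 ^- (n + k)) * expR (2 * L * t).
    move=> h; apply: le_trans h _; apply: ler_wpM2r => //.
    by apply: ler_wpM2l; [rewrite mulr_ge0|rewrite gerBl invr_ge0 exprn_ge0].
  elim: k => [|k ih]; first by rewrite addn0 !subrr nrm0 mulr0 mul0r.
  apply: le_trans (nrm_tri _ (v (n + k)%N t) _) _.
  rewrite addnS; have h1 := vle (n + k)%N t t0.
  have -> : 2 * K * (2 ^- n - 2 ^- (n + k).+1) * expR (2 * L * t) =
     K / 2 ^+ (n + k) * expR (2 * L * t) + 2 * K * (2 ^- n - 2 ^- (n + k)) * expR (2 * L * t).
    by rewrite exprS; field; rewrite !expf_neq0.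
  by rewrite lerD.
have small (c : R) : 0 <= c -> forall e : R, 0 < e -> exists N, forall n, (N <= n)%N -> c / 2 ^+ n <= e.
  move=> c0 e e0; have h : (fun n => geometric c 2^-1 n) @ \oo --> (0 : R).
    by apply: cvg_geometric; rewrite ger0_norm// invf_lt1// ltr1n.
  have [N NP] := (cvgn_eps _ _).1 h e e0; exists N => n Nn.
  have := NP n Nn; rewrite subr0 /geometric/= ger0_norm ?mulr_ge0// ?exprn_ge0// exprVn//.
have cau t : forall e : R, 0 < e -> exists N, forall m n, (N <= m)%N -> (N <= n)%N ->
    nrm (v m `|t| - v n `|t|) <= e.
  move=> e e0; have E0 := expR_ge0 (2 * L * `|t|).
  have c0 : 0 <= 4 * K * expR (2 * L * `|t|).
    by apply: mulr_ge0 => //; apply: mulr_ge0.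
  have [N NP] := small _ c0 e e0; exists N => m n Nm Nn.
  apply: le_trans (nrm_tri _ (v N `|t|) _) _; rewrite (nrm_sym (v N _)).
  have := tail N (m - N)%N `|t| (normr_ge0 t); have := tail N (n - N)%N `|t| (normr_ge0 t).
  rewrite !subnKC// => h1 h2; have := NP N (leqnn N).
  have -> : 4 * K * expR (2 * L * `|t|) / 2 ^+ N =
    2 * K / 2 ^+ N * expR (2 * L * `|t|) + 2 * K / 2 ^+ N * expR (2 * L * `|t|).
    by field; rewrite expf_neq0.
  lra.
have [w' wP'] := choice (fun t => complete (cau t)).
(* The estimates hold for nonnegative times only; the absolute value lets a limit be chosen for
   every real [t]. *)
pose w t := w' `|t|.
have wP t : 0 <= t -> forall e : R, 0 < e -> exists N, forall n, (N <= n)%N -> nrm (v n t - w t) <= e.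
  by move=> t0; have := wP' t; rewrite /w ger0_norm.
have vw n t : 0 <= t -> nrm (v n t - w t) <= 2 * K / 2 ^+ n * expR (2 * L * t).
  move=> t0; apply/ler_addgt0Pr => e e0; have [N NP] := wP t t0 e e0.
  apply: le_trans (nrm_tri _ (v (n + N)%N t) _) _; rewrite nrm_sym.
  by rewrite lerD ?tail// NP// leq_addl.
have wc : cont w.
  apply: lip_cont => s t s0 st; apply/ler_addgt0Pr => e e0.
  have e20 : 0 < e / 2 by rewrite divr_gt0.
  have t0 : 0 <= t by lra.
  have [N1 NP1] := wP t t0 _ e20; have [N2 NP2] := wP s s0 _ e20.
  have h1 := NP1 _ (leqW (leq_maxl N1 N2)); have h2 := NP2 _ (leqW (leq_maxr N1 N2)).
  have h3 := prim_lip (fun t => PhiM (v (maxn N1 N2) t)) (vP (maxn N1 N2)) s0 st.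
  set vt := v (maxn N1 N2).+1 t in h1 h3; set vs := v (maxn N1 N2).+1 s in h2 h3.
  have h4 := nrm_tri (w t) vt (w s); have h5 := nrm_tri vt vs (w s).
  rewrite (nrm_sym (w t) vt) in h4; clear - h1 h2 h3 h4 h5; lra.
(* The limit [w] is fixed by the iteration only up to norm 0. Its image [J] under one more step
   starts exactly at [a] and is the solution returned. *)
have [J [J0 Jc JP]] := picard_step_ex wc.
have Jw t : 0 <= t -> nrm (w t - J t) = 0.
  move=> t0; apply/eqP; rewrite eq_le nrm_ge0 andbT; apply/ler_addgt0Pr => e e0; rewrite add0r.
  have E0 := expR_ge0 (2 * L * t).
  have c0 : 0 <= 2 * K * expR (2 * L * t).
    by apply: mulr_ge0 => //; apply: mulr_ge0.
  have [N NP] := small _ c0 e e0; have := NP N (leqnn N).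
  have -> : 2 * K * expR (2 * L * t) / 2 ^+ N = K / 2 ^+ N * expR (2 * L * t) + 2 * K / 2 ^+ N.+1 * expR (2 * L * t).
    by rewrite exprS; field; rewrite expf_neq0.
  have h1 := vw N.+1 t t0.
  have c1 : 0 <= K / 2 ^+ N by rewrite divr_ge0// exprn_ge0.
  have h2 : nrm (v N.+1 t - J t) <= K / 2 ^+ N * expR (2 * L * t).
    have h := primT_le (r := fun t => L * (2 * K / 2 ^+ N * expR (2 * L * t)))
      (phi := fun t => K / 2 ^+ N * expR (2 * L * t)) (primT_sub (vP N t) (JP t)) _ _ (lexx 0) t0 (lexx t).
    move: h; rewrite va J0 subrr subr0 => h; apply: le_trans (h _ _) _.
    + move=> s /andP[s0 _]; apply: le_trans (PhiL _ _ s0) _.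
      by rewrite ler_pM2l// vw.
    + move=> x y x0 xy yt; rewrite -mulrBr.
      have := ler_wpM2l c1 (@expR_sub_ge (2 * L) x y (ltW L20)).
      by congr (_ <= _); ring.
    + by rewrite gerBl mulr_ge0// expR_ge0.
  have h3 := nrm_tri (w t) (v N.+1 t) (J t); rewrite (nrm_sym (w t) (v _ t)) in h3; lra.
exists J; split => // T; apply: primT_null (JP T) _ _ => t /andP[t0 tT].
  apply/eqP; rewrite eq_le nrm_ge0 andbT.
  by apply: le_trans (PhiL _ _ t0) _; rewrite Jw// mulr0.
by rewrite subrr nrm0.
Qed.

(** Gronwall without derivatives: [expR (- (L * s)) * nrm (v s - w s)] grows by at most an
    arbitrarily small multiple of the length of each short interval, hence stays at 0. *)
Lemma gronwall_uniq T v w : primT T (fun t => Phi t (v t)) v -> primT T (fun t => Phi t (w t)) w ->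
  nrm (v 0 - w 0) = 0 -> forall t, 0 <= t <= T -> nrm (v t - w t) = 0.
Proof.
move=> vP wP vw0 t /andP[t0 tT]; apply/eqP; rewrite eq_le nrm_ge0 andbT.
pose D s := v s - w s; pose z s := expR (- (L * s)) * nrm (D s).
suff H : z t <= 0.
  by move: H; rewrite /z pmulr_rle0// expR_gt0.
apply/ler_addgt0Pr => e e0; rewrite add0r.
have r0 : 0 < e / (t + 1) by rewrite divr_gt0//; lra.
have [d d0 dP] := primT_sub vP wP r0.
have : z t - z 0 <= e / (t + 1) * (t - 0).
  apply: (@chain T d (fun a b => z b - z a <= e / (t + 1) * (b - a))) => //; last first.
    by move=> x y z' _ _ _ _; lra.
  move=> x y x0 xy yT yx; have h := dP x x y x0 (lexx _) xy yT yx.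
  have h1 : nrm (D y) <= nrm (D x) + (y - x) * (L * nrm (D x)) + e / (t + 1) * (y - x).
    have h2 := nrm_sub (D y) (D x); have h3 := nrm_sub (D y - D x) ((y - x) *: (Phi x (v x) - Phi x (w x))).
    rewrite nrmZ ger0_norm ?subr_ge0// in h3.
    have h4 : (y - x) * nrm (Phi x (v x) - Phi x (w x)) <= (y - x) * (L * nrm (D x)).
      by rewrite ler_wpM2l ?subr_ge0//; exact: PhiL.
    rewrite -/(D y) -/(D x) in h; lra.
  have Ey := expR_gt0 (- (L * y)); have Dx := nrm_ge0 (D x).
  have y0 : 0 <= y by lra.
  have Ey1 : expR (- (L * y)) <= 1 by rewrite -expR0 ler_expR oppr_le0 mulr_ge0// ltW.
  have k1 : (1 + L * (y - x)) * expR (- (L * y)) <= expR (- (L * x)).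
    have -> : expR (- (L * x)) = expR (L * (y - x)) * expR (- (L * y)) by rewrite -expRD; congr expR; ring.
    by rewrite ler_pM2r// expR_ge1Dx.
  have k2 := ler_wpM2r Dx k1.
  have k3 := ler_wpM2l (ltW Ey) h1.
  have k4 : expR (- (L * y)) * (e / (t + 1) * (y - x)) <= e / (t + 1) * (y - x).
    by rewrite ler_piMl// mulr_ge0 ?subr_ge0// ltW.
  rewrite /z; lra.
have -> : z 0 = 0 by rewrite /z /D vw0 mulr0.
rewrite !subr0 => h; apply: le_trans h _.
by rewrite -mulrA ler_piMr ?(ltW e0)// mulrC ler_pdivrMr ?mul1r; lra.
Qed.

End picard.

(** The energy increment is [B (v b - v a) (v b + v a)]. As [g a] is orthogonal to [v a], the sum
    may be replaced by a difference in the leading term, which becomes quadratic in [b - a]. *)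
Lemma energy_conservation T g v : contT T g -> contT T v -> primT T g v ->
  (forall t, 0 <= t <= T -> B (v t) (g t) = 0) ->
  forall t, 0 <= t <= T -> nrm (v t) = nrm (v 0).
Proof.
move=> gc vc gv Bvg t /andP[t0 tT].
have T0 : 0 <= T by lra.
have [M M0 MP] := contT_bounded T0 gc; have [K K0 KP] := contT_bounded T0 vc.
suff E : B (v t) (v t) = B (v 0) (v 0) by rewrite /nrm E.
apply/eqP; rewrite -subr_eq0 -normr_eq0 eq_le normr_ge0 andbT.
apply/ler_addgt0Pr => e e0; rewrite add0r.
pose r := e / (t + 1); have r0 : 0 < r by rewrite divr_gt0//; lra.
(* [eta] bounds the remainder paired with [v b + v a], of norm at most [2 K]; the second bound in
   [d'] below handles the quadratic term. Each takes half of [r]. *)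
pose eta := Num.min 1 (r / (4 * (K + 1))).
have eta0 : 0 < eta by rewrite lt_min ltr01/= divr_gt0// mulr_gt0//; lra.
have [d d0 dP] := gv eta eta0.
pose d' := Num.min d (r / (2 * (M * (M + 1) + 1))).
have MM : 0 <= M * (M + 1) by rewrite mulr_ge0//; lra.
have d0' : 0 < d' by rewrite lt_min d0/= divr_gt0// mulr_gt0//; lra.
have : `|B (v t) (v t) - B (v 0) (v 0)| <= r * (t - 0).
  apply: (@chain T d' (fun a b => `|B (v b) (v b) - B (v a) (v a)| <= r * (b - a))) => //; last first.
    move=> a b c _ _ _ _ h1 h2.
    have := ler_normD (B (v c) (v c) - B (v b) (v b)) (B (v b) (v b) - B (v a) (v a)).
    by rewrite addrA subrK; lra.
  move=> a b a0 ab bT; rewrite lt_min => /andP[h1 h2].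
  have aT : 0 <= a <= T by apply/andP; split; lra.
  have bT' : 0 <= b <= T by apply/andP; split; lra.
  have h3 := dP a a b a0 (lexx _) ab bT h1.
  set q := v b - v a - _ in h3.
  have vb : v b - v a = (b - a) *: g a + q by rewrite /q [RHS]addrC subrK.
  have E : B (v b) (v b) - B (v a) (v a) = B (v b - v a) (v b + v a).
    by rewrite BDl !BDr !BNl (BC (v a) (v b)); ring.
  have E2 : B (g a) (v b + v a) = B (g a) (v b - v a).
    by rewrite !BDr BNr !(BC (g a) (v a)) Bvg// oppr0.
  have E3 : B (v b - v a) (v b + v a) = (b - a) * B (g a) (v b - v a) + B q (v b + v a).
    by rewrite {1}vb BDl BZl E2.
  have ba0 : 0 <= b - a by lra.
  have gM := MP a aT; have g0 := nrm_ge0 (g a).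
  have eta1 : eta <= 1 by rewrite ge_min lexx.
  have vba : nrm (v b - v a) <= (M + 1) * (b - a).
    rewrite vb; apply: le_trans (nrmD _ _) _; rewrite nrmZ ger0_norm//; nra.
  have p1 : `|B (g a) (v b - v a)| <= M * (M + 1) * (b - a).
    apply: le_trans (B_norm_le _ _) _; rewrite -mulrA; apply: ler_pM => //; exact: nrm_ge0.
  have p2 : `|B q (v b + v a)| <= r / 2 * (b - a).
    apply: le_trans (B_norm_le _ _) _.
    apply: le_trans (_ : eta * (b - a) * (2 * (K + 1)) <= _).
      apply: ler_pM => //; [exact: nrm_ge0|exact: nrm_ge0|].
      by apply: le_trans (nrmD _ _) _; have := KP a aT; have := KP b bT'; lra.
    have eta2 : eta <= r / (4 * (K + 1)) by rewrite ge_min lexx orbT.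
    have -> : r / 2 * (b - a) = r / (4 * (K + 1)) * (b - a) * (2 * (K + 1)).
      by field; lra.
    by apply: ler_wpM2r; [lra|apply: ler_wpM2r].
  have p3 : (b - a) * (M * (M + 1) * (b - a)) <= r / 2 * (b - a).
    rewrite mulrC ler_wpM2r//.
    rewrite ltr_pdivlMr in h2; last by lra.
    nra.
  rewrite E E3; apply: le_trans (ler_normD _ _) _; rewrite normrM (ger0_norm ba0).
  have := ler_wpM2l ba0 p1; lra.
rewrite subr0 => h; apply: le_trans h _.
by rewrite /r -mulrA ler_piMr ?(ltW e0)// mulrC ler_pdivrMr ?mul1r; lra.
Qed.


(** The radial retraction onto the ball of radius [K]. Being a positive multiple of [v], it
    preserves orthogonality of the truncated field to [v]. *)
Definition retract (K : R) v := (K / Num.max K (nrm v)) *: v.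

Lemma max_nrm_gt0 (K : R) v : 0 < K -> 0 < Num.max K (nrm v).
Proof. by move=> K0; rewrite lt_max K0. Qed.

Lemma retract_coef_gt0 (K : R) v : 0 < K -> 0 < K / Num.max K (nrm v).
Proof. by move=> K0; rewrite divr_gt0// max_nrm_gt0. Qed.

Lemma retract_le (K : R) v : 0 < K -> nrm (retract K v) <= K.
Proof.
move=> K0; rewrite /retract nrmZ gtr0_norm ?retract_coef_gt0//.
rewrite mulrAC ler_pdivrMr ?max_nrm_gt0// ler_pM2l// le_max lexx orbT//.
Qed.

Lemma retract_id (K : R) v : 0 < K -> nrm v <= K -> retract K v = v.
Proof. by move=> K0 vK; rewrite /retract max_l// divff ?scale1r// gt_eqF. Qed.

(** The difference splits into [v - w] scaled by a factor at most 1 and [w] times a difference of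
    factors; each part is at most [nrm (v - w)]. *)
Lemma retract_lip (K : R) v w : 0 < K -> nrm (retract K v - retract K w) <= 2 * nrm (v - w).
Proof.
move=> K0; rewrite /retract.
set m := Num.max K (nrm v); set n := Num.max K (nrm w).
have m0 : 0 < m by exact: max_nrm_gt0.
have n0 : 0 < n by exact: max_nrm_gt0.
have Km : K <= m by rewrite le_max lexx.
have wn : nrm w <= n by rewrite le_max lexx orbT.
have mn : `|n - m| <= nrm (v - w).
  have := nrm_dist v w; rewrite /m /n !ler_norml => /andP[h1 h2].
  by have := nrm_ge0 (v - w); case: (leP K (nrm v)); case: (leP K (nrm w)); lra.
have -> : (K / m) *: v - (K / n) *: w = (K / m) *: (v - w) + (K / m - K / n) *: w.
  by rewrite scalerBr scalerBl addrA subrK.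
apply: le_trans (nrmD _ _) _; rewrite !nrmZ.
have h1 : `|K / m| * nrm (v - w) <= nrm (v - w).
  by rewrite ler_piMl ?nrm_ge0// gtr0_norm ?divr_gt0// ler_pdivrMr// mul1r.
have h2 : `|K / m - K / n| * nrm w <= nrm (v - w).
  have -> : K / m - K / n = (K / m) / n * (n - m) by field; rewrite !gt_eqF.
  rewrite normrM gtr0_norm ?divr_gt0// mulrAC.
  apply: le_trans (_ : 1 * `|n - m| <= _); last by rewrite mul1r.
  rewrite ler_wpM2r// mulrAC ler_pdivrMr// mul1r.
  by rewrite -[leRHS]mul1r ler_pM ?nrm_ge0 ?divr_ge0 ?(ltW K0) ?(ltW m0)// ler_pdivrMr// mul1r.
lra.
Qed.

(** * Global flow of a locally Lipschitz field orthogonal to the position *)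

Section conservative_flow.
Variable Phi : R -> V -> V.
Hypothesis PhiL : forall K : R, 0 < K -> exists2 L : R, 0 < L & forall t v w, 0 <= t ->
  nrm v <= K -> nrm w <= K -> nrm (Phi t v - Phi t w) <= L * nrm (v - w).
Hypothesis Phi0 : forall t, 0 <= t -> nrm (Phi t 0) = 0.
Hypothesis PhiC : forall v, cont (Phi ^~ v).
Hypothesis PhiE : forall t v, 0 <= t -> B v (Phi t v) = 0.

Lemma contT_Phi T v : 0 <= T -> contT T v -> contT T (fun t => Phi t (v t)).
Proof.
move=> T0 vc; have [K K0 KP] := contT_bounded T0 vc.
have [|L L0 LP] := PhiL (K := K + 1); first by lra.
move=> t /andP[t0 tT] e e0.
have tT' : 0 <= t <= T by rewrite t0.
have e1 : 0 < e / (2 * L) by rewrite divr_gt0// mulr_gt0.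
have e2 : 0 < e / 2 by rewrite divr_gt0.
have [d d0 dP] := vc t tT' _ e1; have [d' d0' dP'] := PhiC (v t) t0 e2.
exists (Num.min d d') => [|s sT]; first by rewrite lt_min d0.
rewrite lt_min => /andP[h1 h2]; have /andP[s0 _] := sT.
apply: le_trans (nrm_tri _ (Phi s (v t)) _) _.
have h3 := LP s (v s) (v t) s0 (le_trans (KP s sT) _) (le_trans (KP t tT') _).
have h4 := dP s sT h1; have h5 := dP' s s0 h2.
have h6 : L * nrm (v s - v t) <= e / 2.
  by have -> : e / 2 = L * (e / (2 * L)) by [field; exact: lt0r_neq0|]; rewrite ler_pM2l.
have K1 : K <= K + 1 by lra.
by have := h3 K1 K1; lra.
Qed.

Lemma conservative_flow_ex (a : V) : exists v, [/\ v 0 = a, cont v,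
  forall T, primT T (fun t => Phi t (v t)) v &
  forall T w, 0 <= T -> contT T w -> primT T (fun t => Phi t (w t)) w -> nrm (w 0 - a) = 0 ->
    forall t, 0 <= t <= T -> nrm (w t - v t) = 0].
Proof.
(* The summand 1 keeps the radius positive even when [a] has norm 0. *)
pose K := nrm a + 1; have K0 : 0 < K by rewrite ltr_wpDl ?nrm_ge0.
have [L0 L00 LP0] := PhiL K0.
pose L := 2 * L0; have Lp : 0 < L by rewrite mulr_gt0.
pose Psi t v := Phi t (retract K v).
have PsiL t v w : 0 <= t -> nrm (Psi t v - Psi t w) <= L * nrm (v - w).
  move=> t0; apply: le_trans (LP0 t _ _ t0 (retract_le _ K0) (retract_le _ K0)) _.
  have -> : L * nrm (v - w) = L0 * (2 * nrm (v - w)) by rewrite /L; ring.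
  by rewrite ler_pM2l// retract_lip.
have PsiM t v : 0 <= t -> nrm (Psi t v) <= L0 * K.
  move=> t0; apply: le_trans (nrm_sub _ (Phi t 0)) _; rewrite Phi0// addr0.
  apply: le_trans (LP0 t _ _ t0 (retract_le _ K0) _) _; first by rewrite nrm0 ltW.
  by rewrite subr0 ler_pM2l// retract_le.
have PsiC v : cont (Psi ^~ v) by exact: PhiC.
have [v [va vP]] := picard a Lp PsiM PsiL PsiC.
have vc : cont v.
  by apply: contT_cont => T; apply: primT_contT (vP T) _ => t /andP[t0 _]; exact: PsiM.
have vE t : 0 <= t -> nrm (v t) = nrm a.
  move=> t0; rewrite -va; apply: (energy_conservation (T := t) _ _ (vP t)).
  - by apply: cont_contT; exact: (cont_Phi Lp PsiL PsiC).
  - exact: cont_contT.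
  - move=> s /andP[s0 _]; have c0 := retract_coef_gt0 (v s) K0.
    apply/eqP; rewrite -(mulrI_eq0 _ (lregP (lt0r_neq0 c0))).
    by rewrite -BZl; apply/eqP; exact: PhiE.
  - by rewrite t0 lexx.
have aK : nrm a <= K by rewrite lerDl.
exists v; split => //.
  move=> T; apply: primT_null (vP T) _ _ => t /andP[t0 _]; last by rewrite subrr nrm0.
  by rewrite /Psi retract_id ?vE// subrr nrm0.
move=> T w T0 wc wP wa t tT.
(* A competitor conserves its norm by itself, so it never leaves the ball and also solves the
   truncated equation, which is globally Lipschitz. *)
have wE s : 0 <= s <= T -> nrm (w s) = nrm a.
  move=> sT; have -> : nrm a = nrm (w 0).
    apply/eqP; rewrite -subr_eq0 -normr_eq0 eq_le normr_ge0 andbT.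
    by apply: le_trans (nrm_dist _ _) _; rewrite nrm_sym wa.
  apply: (energy_conservation (contT_Phi T0 wc) wc wP) => // u /andP[u0 _].
  exact: PhiE.
have wP' : primT T (fun t => Psi t (w t)) w.
  apply: primT_null wP _ _ => s sT; last by rewrite subrr nrm0.
  by rewrite /Psi retract_id ?wE// subrr nrm0.
by apply: (gronwall_uniq Lp PsiL wP' (vP T)) => //; rewrite va.
Qed.

End conservative_flow.

End evolution.

(** * The nonlinearity *)

Section dispersion.
Context {R : realType}.
Local Notation mu := (@lebesgue_measure R).
Implicit Types f g G : R -> R.

Lemma eint_powR (b : R) : 0 < b ->
  (\int[mu]_x ((1 + `|x|) `^ (- b - 1))%:E = (2 / b)%:E)%E.
Proof.
move=> b0; pose F x : R := (1 + x) `^ (- b) / - b.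
have dP (a x : R) : 0 < 1 + x -> is_derive x 1 (fun x : R => (1 + x) `^ a) (a * (1 + x) `^ (a - 1)).
  move=> x0; have h := @is_derive1_powR R a (1 + x) x0.
  have h1 : is_derive x 1 (fun x : R => 1 + x) 1 by apply: (is_derive_eq (is_deriveD _ _)); rewrite add0r.
  have := is_derive1_comp h h1.
  by rewrite mulr1.
have cP (a x : R) : 0 < 1 + x -> {for x, continuous (fun x : R => (1 + x) `^ a)}.
  move=> x0; apply: differentiable_continuous; apply/derivable1_diffP.
  by have [] := dP a x x0.
have dF (x : R) : 0 < 1 + x -> is_derive x 1 F ((1 + x) `^ (- b - 1)).
  move=> x0; have h := dP (- b) x x0; apply: is_derive_eq.
  by rewrite scaler0 add0r /GRing.scale/= mulKf// oppr_eq0 gt_eqF.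
rewrite ge0_symfun_integralT; first last.
- by move=> x /=; rewrite normrN.
- move=> x; have x0 : 0 < 1 + `|x| by rewrite ltr_pwDl.
  exact: (@continuous_comp _ _ _ (fun x : R => `|x|) (fun y : R => (1 + y) `^ (- b - 1)) x (@norm_continuous _ R x) (cP _ _ x0)).
- by move=> x; exact: powR_ge0.
have -> : [set x : R | 0 <= x] = `[0, +oo[%classic.
  by apply/seteqP; split => x /=; rewrite in_itv/= andbT.
under eq_integral.
  move=> x; rewrite inE/= in_itv/= andbT => x0; rewrite ger0_norm//; over.
have Fl : F x @[x --> +oo] --> (0 : R).
  have -> : (0 : R) = 0 / - b by rewrite mul0r.
  apply: cvgMr_tmp; apply/cvgrPdist_le => e e0.
  exists (e `^ (- b^-1)); split; first exact: num_real.
  move=> x ex; have x1 : 0 < 1 + x by rewrite ltr_wpDl// (le_lt_trans _ ex)// powR_ge0.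
  rewrite sub0r normrN ger0_norm ?powR_ge0//.
  have -> : e = (e `^ (- b^-1)) `^ (- b).
    by rewrite -powRrM mulrNN mulVf ?gt_eqF// powRr1// ltW.
  rewrite powRN [leRHS]powRN lef_pV2 ?posrE ?powR_gt0//.
  by rewrite ge0_ler_powR ?nnegrE ?powR_ge0 ?(ltW b0) ?(ltW x1)//; lra.
rewrite (ge0_continuous_FTC2y _ _ Fl).
- by rewrite /F addr0 powR1 -EFinB -EFinM; congr EFin; field; rewrite gt_eqF.
- by move=> x x0; exact: powR_ge0.
- apply: continuous_in_subspaceT => x; rewrite inE/= in_itv/= andbT => x0; apply: cP; lra.
- by move=> x x0; have [] := dF x (ltr_wpDl ler01 x0).
- apply: cvg_at_right_filter; apply: differentiable_continuous; apply/derivable1_diffP.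
  by have [] := dF 0; rewrite ?addr0.
- move=> x; rewrite in_itv/= andbT => x0; rewrite derive1E.
  by have [] := dF x (ltr_wpDl ler01 x0).
Qed.

Lemma sin_mvt (y : R) : 0 <= y -> exists2 c : R, 0 <= c <= y & sin y = cos c * y.
Proof.
rewrite le_eqVlt => /predU1P[<-|y0]; first by exists 0; rewrite ?lexx// sin0 mulr0.
have cs : {within `[0, y], continuous (@sin R)}.
  by apply: continuous_subspaceT; exact: continuous_sin.
have [c] := MVT y0 (fun x _ => is_derive_sin x) cs.
by rewrite in_itv/= sin0 !subr0 => /andP[c0 cy] E; exists c => //; rewrite !ltW.
Qed.

Lemma sin_norm_le (y : R) : `|sin y| <= `|y|.
Proof.
have H (z : R) : 0 <= z -> `|sin z| <= z.
  move=> z0; have [c _ ->] := sin_mvt z0.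
  by rewrite normrM (ger0_norm z0) ler_piMl// ler_norml cos_geN1 cos_le1.
by case: (ler0P y) => y0; [rewrite -normrN -sinN H// oppr_ge0|rewrite H// ltW].
Qed.

Lemma cos_quad (x : R) : 2 - 2 * cos x <= x ^+ 2.
Proof.
have E : 2 - 2 * cos x = 4 * sin (x / 2) ^+ 2.
  have {1}-> : x = x / 2 + x / 2 by field.
  by have := cos2Dsin2 (x / 2); rewrite cosD; nra.
have : sin (x / 2) ^+ 2 <= (x / 2) ^+ 2.
  by rewrite -(real_normK (num_real (sin _))) -(real_normK (num_real (x / 2))) lerXn2r ?nnegrE// sin_norm_le.
by rewrite E; lra.
Qed.

Lemma sin_sub_le (y : R) : `|sin y - y| <= `|y| ^+ 3.
Proof.
have H (z : R) : 0 <= z -> `|sin z - z| <= z ^+ 3.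
  move=> z0; have [c /andP[c0 cz] ->] := sin_mvt z0.
  rewrite -{2}(mul1r z) -mulrBl normrM (ger0_norm z0) exprSr ler_wpM2r//.
  rewrite distrC ger0_norm ?subr_ge0 ?cos_le1//.
  have : c ^+ 2 <= z ^+ 2 by rewrite lerXn2r ?nnegrE.
  by have := cos_quad c; have := sqr_ge0 z; lra.
case: (ler0P y) => y0; last by rewrite H// ltW.
by rewrite -normrN opprB -[X in X - _]opprK addrC -sinN H// oppr_ge0.
Qed.

(** Interpolation between the bound 4, used for [|x| >= 1], and the bound [x^2], used for
    [|x| < 1]. *)
Lemma cos_powR (s x : R) : 0 < s <= 2 -> 2 - 2 * cos x <= 4 * `|x| `^ s.
Proof.
move=> /andP[s0 s2]; have [x1|x1] := leP 1 `|x|.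
  have : 1 <= `|x| `^ s.
    by have <- : 1 `^ s = 1 :> R; [rewrite powR1|rewrite ge0_ler_powR ?nnegrE// ltW].
  have := cos_geN1 x; lra.
have x2 : x ^+ 2 <= `|x| `^ s.
  have [->|xn0] := eqVneq x 0; first by rewrite expr0n powR_ge0.
  have n0 : 0 < `|x| by rewrite normr_gt0.
  have E : x ^+ 2 = `|x| `^ s * `|x| `^ (2 - s).
    rewrite -powRD; last by rewrite (gt_eqF n0) implybT.
    have -> : s + (2 - s) = 2%:R by ring.
    by rewrite powR_mulrn// real_normK ?num_real.
  rewrite E ler_piMr ?powR_ge0//.
  have : `|x| `^ (2 - s) <= 1 `^ (2 - s) by rewrite ge0_ler_powR ?nnegrE ?subr_ge0// ltW.
  by rewrite powR1.
have := cos_quad x; have : 0 <= x ^+ 2 by rewrite sqr_ge0.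
lra.
Qed.

Lemma pow_sub_le (M : R) n : 0 <= M -> exists2 C : R, 0 <= C & forall a b : R,
  `|a| <= M -> `|b| <= M -> `|a ^+ n - b ^+ n| <= C * `|a - b|.
Proof.
move=> M0; elim: n => [|n [C C0 ih]].
  by exists 0 => // a b _ _; rewrite !expr0 subrr normr0 mul0r.
exists (M * C + M ^+ n); first by rewrite addr_ge0 ?mulr_ge0 ?exprn_ge0.
move=> a b aM bM.
have -> : a ^+ n.+1 - b ^+ n.+1 = a * (a ^+ n - b ^+ n) + b ^+ n * (a - b) by rewrite !exprS; ring.
apply: le_trans (ler_normD _ _) _; rewrite !normrM [leRHS]mulrDl lerD//.
  by rewrite -[leRHS]mulrA ler_pM// ih.
by rewrite ler_wpM2r// normrX lerXn2r ?nnegrE.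
Qed.

(** Meant for [a = u (x + h)], [a' = u x], [b = v (x + h)], [b' = v x]: an increment of [u^n - v^n]
    is controlled by that of [u - v], plus the uniform distance [m] times an increment of [v]. This
    is the source of the Lipschitz bound on the nonlinearity. *)
Lemma pow_sub2_le (M : R) n : 0 <= M -> exists2 C : R, 0 <= C & forall (a a' b b' m : R),
  `|a| <= M -> `|a'| <= M -> `|b| <= M -> `|b'| <= M -> `|a - b| <= m -> `|a' - b'| <= m ->
  `|(a ^+ n - b ^+ n) - (a' ^+ n - b' ^+ n)| <= C * (`|(a - b) - (a' - b')| + m * `|b - b'|).
Proof.
move=> M0; elim: n => [|n [C C0 ih]].
  exists 0 => // a a' b b' m _ _ _ _ _ _; by rewrite !expr0 !subrr normr0 mul0r.
have [D D0 hD] := pow_sub_le n M0.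
exists (M * C + D + M ^+ n + D); first by rewrite !addr_ge0 ?mulr_ge0 ?exprn_ge0.
move=> a a' b b' m aM aM' bM bM' abm abm'.
have -> : (a ^+ n.+1 - b ^+ n.+1) - (a' ^+ n.+1 - b' ^+ n.+1) =
  a * ((a ^+ n - b ^+ n) - (a' ^+ n - b' ^+ n)) + (a - b) * (b ^+ n - b' ^+ n)
  + a' ^+ n * ((a - b) - (a' - b')) + (b - b') * (a' ^+ n - b' ^+ n).
  by rewrite !exprS; ring.
have h1 := ih _ _ _ _ _ aM aM' bM bM' abm abm'.
have h2 := hD _ _ bM bM'; have h3 := hD _ _ aM' bM'.
have m0 : 0 <= m by exact: le_trans abm.
have X0 := normr_ge0 ((a - b) - (a' - b')); have Y0 := normr_ge0 (b - b').
move: X0 Y0 h1 h2; set X := `|(a - b) - _|; set Y := `|b - b'| => X0 Y0 h1 h2.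
have Mn : `|a' ^+ n| <= M ^+ n by rewrite normrX lerXn2r ?nnegrE.
have T (a1 a2 a3 a4 : R) : `|a1 + a2 + a3 + a4| <= `|a1| + `|a2| + `|a3| + `|a4|.
  by rewrite (le_trans (ler_normD _ _))// lerD2r (le_trans (ler_normD _ _))// lerD2r ler_normD.
apply: le_trans (T _ _ _ _) _.
rewrite !normrM -/X -/Y.
have k1 : `|a| * `|(a ^+ n - b ^+ n) - (a' ^+ n - b' ^+ n)| <= M * (C * (X + m * Y)) by rewrite ler_pM.
have k2 : `|a - b| * `|b ^+ n - b' ^+ n| <= m * (D * Y) by rewrite ler_pM.
have k3 : `|a' ^+ n| * X <= M ^+ n * X by rewrite ler_wpM2r.
have k4 : Y * `|a' ^+ n - b' ^+ n| <= Y * (D * m) by rewrite ler_wpM2l// (le_trans h3)// ler_wpM2l.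
have k5 : 0 <= D * X by rewrite mulr_ge0.
have k6 : 0 <= M ^+ n * (m * Y) by rewrite !mulr_ge0// exprn_ge0.
lra.
Qed.

Lemma pow_taylor2 (M : R) n : 0 <= M -> exists2 C : R, 0 <= C & forall a b : R,
  `|a| <= M -> `|b| <= M -> `|b ^+ n.+1 - a ^+ n.+1 - n.+1%:R * a ^+ n * (b - a)| <= C * (b - a) ^+ 2.
Proof.
move=> M0; elim: n => [|n [C C0 ih]].
  by exists 0 => // a b _ _; rewrite !expr1 expr0 mulr1 mul1r subrr normr0 mul0r.
have [D D0 hD] := pow_sub_le n.+1 M0.
exists (M * C + D); first by rewrite addr_ge0 ?mulr_ge0.
move=> a b aM bM.
have -> : b ^+ n.+2 - a ^+ n.+2 - n.+2%:R * a ^+ n.+1 * (b - a) =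
  a * (b ^+ n.+1 - a ^+ n.+1 - n.+1%:R * a ^+ n * (b - a)) + (b ^+ n.+1 - a ^+ n.+1) * (b - a).
  have -> : n.+2%:R = n.+1%:R + 1 :> R by rewrite natr1.
  by rewrite !exprS; ring.
apply: le_trans (ler_normD _ _) _; rewrite !normrM [leRHS]mulrDl lerD//.
  by rewrite -[leRHS]mulrA ler_pM// ih.
by rewrite -(real_normK (num_real (b - a))) expr2 mulrA ler_wpM2r// hD.
Qed.

(* At [a = u x] and [b = u (x + h)] the left-hand side is, up to a term of zero
   integral, the integrand of <u (. + h) - u (. - h), u ^+ p.+1>. *)
Lemma flux_le (M : R) p : 0 <= M -> exists2 C : R, 0 <= C & forall a b : R,
  `|a| <= M -> `|b| <= M ->
  `|b * a ^+ p.+1 - a * b ^+ p.+1 + p%:R / p.+2%:R * (b ^+ p.+2 - a ^+ p.+2)| <= C * (b - a) ^+ 2.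
Proof.
move=> M0; have [C C0 hC] := pow_taylor2 p M0; have [D D0 hD] := pow_taylor2 p.+1 M0.
exists (M * C + D); first by rewrite addr_ge0 ?mulr_ge0.
move=> a b aM bM.
have c0 : 0 <= p%:R / p.+2%:R :> R by rewrite divr_ge0.
have c1 : p%:R / p.+2%:R <= 1 :> R by rewrite ler_pdivrMr// mul1r ler_nat -addn2 leq_addr.
(* The first two terms contribute [- p a^(p+1) (b - a)] to first order; the coefficient
   [p / (p + 2)] is the one that cancels it, leaving two Taylor remainders. *)
have -> : b * a ^+ p.+1 - a * b ^+ p.+1 + p%:R / p.+2%:R * (b ^+ p.+2 - a ^+ p.+2) =
  - (a * (b ^+ p.+1 - a ^+ p.+1 - p.+1%:R * a ^+ p * (b - a))) +
  p%:R / p.+2%:R * (b ^+ p.+2 - a ^+ p.+2 - p.+2%:R * a ^+ p.+1 * (b - a)).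
  rewrite !exprS -!natr1; have : p%:R + 1 + 1 != 0 :> R by rewrite -!(natrD _ _ 1) pnatr_eq0 addn1.
  by move: (p%:R : R) (a ^+ p) (b ^+ p) => P A B P0; field.
apply: le_trans (ler_normD _ _) _; rewrite normrN !(normrM a) (normrM (_ / _)) [leRHS]mulrDl lerD//.
  by rewrite -[leRHS]mulrA ler_pM// hC.
rewrite (ger0_norm c0); apply: le_trans (_ : 1 * (D * (b - a) ^+ 2) <= _); last by rewrite mul1r.
by rewrite ler_pM// hD.
Qed.

(** * The weight, the Sobolev embedding and the nonlinear operator on states *)

Section symbol.
Variable alpha : R.
Hypothesis alpha1 : 1 < alpha.

Definition weight (xi : R) : R := 1 + 5 / 4 * `|xi| `^ alpha.
Definition om (xi : R) : R := Num.sqrt (weight xi).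

Lemma alpha_gt0 : 0 < alpha. Proof. by rewrite (lt_trans _ alpha1). Qed.

Lemma weight_ge1 xi : 1 <= weight xi.
Proof. by rewrite lerDl mulr_ge0// powR_ge0. Qed.

Lemma weight_gt0 xi : 0 < weight xi.
Proof. by rewrite (lt_le_trans _ (weight_ge1 xi)). Qed.

Lemma om_gt0 xi : 0 < om xi.
Proof. by rewrite sqrtr_gt0 weight_gt0. Qed.

Lemma om_neq0 xi : om xi != 0.
Proof. by rewrite gt_eqF// om_gt0. Qed.

Lemma om_sqr xi : om xi ^+ 2 = weight xi.
Proof. by rewrite sqr_sqrtr// ltW// weight_gt0. Qed.

Lemma om_ge1 xi : 1 <= om xi.
Proof. by rewrite -[leLHS]sqrtr1 ler_wsqrtr// weight_ge1. Qed.

Lemma omN xi : om (- xi) = om xi.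
Proof. by rewrite /om /weight normrN. Qed.

Lemma msr_absR (a : R) : msr (fun xi : R => `|xi| `^ a).
Proof. by apply: (msr_comp (measurable_powR a)); apply: msr_norm; exact: msr_id. Qed.

Lemma msr_weight : msr weight.
Proof. by apply: msrD; [exact: msr_cst|apply: msrM; [exact: msr_cst|exact: msr_absR]]. Qed.

Lemma msr_om : msr om.
Proof. by apply: msr_comp msr_weight; apply: msr_cont; exact: sqrt_continuous. Qed.

Lemma msr_inv f : msr f -> (forall x, 0 < f x) -> msr (fun x => (f x)^-1).
Proof.
move=> mf f0; have -> : (fun x => (f x)^-1) = (fun x => f x `^ (-1)).
  by apply/funext => x; rewrite powR_inv1// ltW.
exact: (msr_comp (measurable_powR _) mf).
Qed.

Lemma msr_omV : msr (fun xi => (om xi)^-1).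
Proof. exact: msr_inv msr_om om_gt0. Qed.

Lemma omV_norm_le1 xi : `|(om xi)^-1| <= 1.
Proof. by rewrite gtr0_norm ?invr_gt0 ?om_gt0// invf_le1 ?om_gt0// om_ge1. Qed.

(** The square is dominated by [2^alpha (1 + |x|)^(-alpha)], which is integrable because
    [alpha > 1]. *)
Lemma omV_L2 : L2 (fun xi => (om xi)^-1).
Proof.
split; first exact: msr_omV.
have b0 : 0 < alpha - 1 by rewrite subr_gt0.
have i1 : intg (fun x : R => (1 + `|x|) `^ (- (alpha - 1) - 1)).
  apply/intg_ge0; first apply: (msr_comp (measurable_powR _)).
  - by apply: msrD; [exact: msr_cst|apply: msr_norm; exact: msr_id].
  - by move=> x; exact: powR_ge0.
  - by rewrite eint_powR// ltry.
apply: intg_le (intgZ (2 `^ alpha) i1) _; first by apply: msrX; exact: msr_omV.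
move=> x; rewrite exprVn om_sqr gtr0_norm ?invr_gt0 ?weight_gt0//.
have -> : - (alpha - 1) - 1 = - alpha by ring.
have x1 : 0 < 1 + `|x| by rewrite ltr_pwDl.
rewrite powRN ler_pdivlMr ?powR_gt0// mulrC ler_pdivrMr ?weight_gt0//.
have m0 : 0 <= Num.max 1 `|x| by rewrite le_max ler01.
apply: le_trans (_ : (2 * Num.max 1 `|x|) `^ alpha <= _).
  rewrite ge0_ler_powR ?nnegrE ?mulr_ge0 ?(ltW x1) ?(ltW alpha_gt0)//.
  by case: (leP 1 `|x|); lra.
rewrite powRM// ler_pM2l ?powR_gt0// /weight.
have := powR_ge0 `|x| alpha; case: (leP 1 `|x|) => _; rewrite ?powR1; lra.
Qed.

(** The cap at 2 reflects that [2 - 2 cos] vanishes only to second order at 0. *)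
Definition hexp : R := Num.min alpha 2.

Lemma hexp_itv : 1 < hexp <= 2.
Proof. by rewrite /hexp lt_min alpha1 ltr1n/= ge_min lexx orbT. Qed.

(* Uses [|h xi|^hexp <= |h|^hexp (1 + |xi|^alpha)], as [hexp <= alpha]. *)
Lemma diff_symbol_le (h xi : R) : (2 - 2 * cos (h * xi)) * (om xi)^-1 ^+ 2 <= 4 * `|h| `^ hexp.
Proof.
have /andP[s1 s2] := hexp_itv; have s0 : 0 < hexp by lra.
rewrite exprVn om_sqr ler_pdivrMr ?weight_gt0//.
have s02 : 0 < hexp <= 2 by rewrite s0.
apply: le_trans (cos_powR (h * xi) s02) _.
rewrite normrM powRM// !mulrA -[leRHS]mulrA -[leLHS]mulrA.
rewrite ler_pM2l// ler_wpM2l ?powR_ge0//.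
rewrite /weight; have p0 := powR_ge0 `|xi| alpha.
have [x1|x1] := leP 1 `|xi|.
  have : `|xi| `^ hexp <= `|xi| `^ alpha by rewrite ler_powR// ge_min lexx.
  lra.
have : `|xi| `^ hexp <= 1 `^ hexp by rewrite ge0_ler_powR ?nnegrE// ltW.
rewrite powR1; lra.
Qed.

(** For [|xi| >= 1], [|xi| <= |xi|^alpha] gives [xi^2 <= |xi| * weight xi]. The cut at 1 is where
    the dyadic bands begin. *)
Lemma freq_ratio_le xi : (xi / om xi) ^+ 2 <= 1 + `|xi| * \1_[set x : R | 1 <= `|x|] xi.
Proof.
rewrite exprMn exprVn om_sqr ler_pdivrMr ?weight_gt0// -(real_normK (num_real xi)).
rewrite indicE; have [x1|x1] := leP 1 `|xi|.
  rewrite mem_set//.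
  have h : `|xi| <= `|xi| `^ alpha by rewrite le1r_powR// ltW.
  have x0 := normr_ge0 xi; rewrite mulr1 /weight expr2.
  have : `|xi| * `|xi| <= `|xi| * (1 + 5 / 4 * `|xi| `^ alpha) by rewrite ler_wpM2l//; lra.
  have : 0 <= 1 * (1 + 5 / 4 * `|xi| `^ alpha) by rewrite mul1r; lra.
  by rewrite mulrDl; lra.
rewrite memNset /=; last by apply/negP; rewrite -ltNge.
rewrite mulr0 addr0 mul1r (le_trans _ (weight_ge1 xi))// expr_le1// ltW//.
Qed.

(* Sends the state of a function back to that function. *)
Definition syn G : R -> R := fun x => (2 * pi)^-1 * hartley1 (fun xi => (om xi)^-1 * G xi) x.

Lemma omV_mul_L2 G : L2 G -> L2 (fun xi => (om xi)^-1 * G xi).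
Proof. by move=> GL; exact: L2_mulb GL msr_omV omV_norm_le1. Qed.

Lemma omV_mul_intg G : L2 G -> intg (fun xi => (om xi)^-1 * G xi).
Proof. by move=> GL; exact: L2M omV_L2 GL. Qed.

Lemma pi2V_neq0 : 2 * pi != 0 :> R.
Proof. by rewrite mulf_neq0// gt_eqF// pi_gt0. Qed.

Lemma syn_hart G : L2 G -> ae_eqR (syn G) (fun x => (2 * pi)^-1 * hart (fun xi => (om xi)^-1 * G xi) x).
Proof.
by move=> GL; apply: ae_imp (hart_intg (omV_mul_intg GL) (omV_mul_L2 GL)) => x ->.
Qed.

Lemma syn_L2 G : L2 G -> L2 (syn G).
Proof.
move=> GL; apply: L2_ae (ae_sym (syn_hart GL)) _; last exact/L2Z/hart_L2/omV_mul_L2.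
by apply: msrM; [exact: msr_cst|apply: hartley1_msr; exact: omV_mul_intg].
Qed.

Lemma hart_syn G : L2 G -> ae_eqR (hart (syn G)) (fun xi => (om xi)^-1 * G xi).
Proof.
move=> GL; have hL := hart_L2 (omV_mul_L2 GL).
apply: ae_trans (hart_ae (syn_L2 GL) (L2Z _ hL) (syn_hart GL)) _.
apply: ae_trans (hartZ _ hL) _.
by apply: ae_imp (hartK (omV_mul_L2 GL)) => x ->; rewrite mulrA mulVf ?mul1r// pi2V_neq0.
Qed.

Lemma synB G G' : L2 G -> L2 G' -> syn (fun xi => G xi - G' xi) = fun x => syn G x - syn G' x.
Proof.
move=> GL GL'; apply/funext => x; rewrite /syn -mulrBr; congr (_ * _).
have -> : (fun xi => (om xi)^-1 * (G xi - G' xi)) = (fun xi => (om xi)^-1 * G xi - (om xi)^-1 * G' xi).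
  by apply/funext => xi; rewrite mulrBr.
by rewrite hartley1B//; exact: omV_mul_intg.
Qed.

(** The Sobolev embedding, by Cauchy-Schwarz against [1 / om]. It holds at every [x] because [syn]
    is an absolutely convergent integral. *)
Lemma syn_bound : exists2 C : R, 0 <= C & forall G x, L2 G -> `|syn G x| <= C * Num.sqrt (n2 G).
Proof.
exists ((2 * pi)^-1 * 2 * Num.sqrt (n2 (fun xi => (om xi)^-1))) => [|G x GL].
  by rewrite !mulr_ge0 ?sqrtr_ge0// invr_ge0 mulr_ge0// ltW// pi_gt0.
have c0 : 0 <= (2 * pi)^-1 :> R by rewrite invr_ge0 mulr_ge0// ltW// pi_gt0.
rewrite /syn normrM (ger0_norm c0) -!mulrA ler_wpM2l//.
apply: le_trans (hartley1_bound x (omV_mul_intg GL)) _; rewrite ler_pM2l//.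
rewrite -sqrtrM ?n2_ge0//; set I := (X in X <= _).
have I0 : 0 <= I by apply: int_ge0.
rewrite -(ger0_norm I0) -sqrtr_sqr ler_wsqrtr//.
have aL : L2 (fun x => `|G x|).
  by apply: (L2_le (msr_norm (L2_msr GL)) GL) => y; rewrite normr_id.
have := cauchy_schwarz omV_L2 aL.
have -> : ip (fun x => `|G x|) (fun x => `|G x|) = n2 G.
  by rewrite /n2 !ip_sqr; apply: eq_Rintegral => y _; rewrite real_normK ?num_real.
congr (_ ^+ 2 <= _); apply: eq_Rintegral => y _.
by rewrite normrM gtr0_norm// invr_gt0 om_gt0.
Qed.

Lemma ip_hart2 f g : L2 f -> L2 g -> ip (hart f) (hart g) = 2 * pi * ip f g.
Proof.
move=> fL gL; rewrite (ip_hart fL (hart_L2 gL)).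
rewrite (ip_ae fL fL (hart_L2 (hart_L2 gL)) (L2Z (2 * pi) gL) (ae_refl f) (hartK gL)).
by rewrite ipC ipZl// ipC.
Qed.

(** This is how a Fourier multiplier with even real part and odd imaginary part acts on a Hartley
    transform. The cross term [c * d * G xi * G (- xi)] is odd, so the norm sees only the squared
    modulus of the symbol. *)
Lemma n2_even_odd (c d : R -> R) (M : R) G : msr c -> msr d ->
  (forall x, `|c x| <= M) -> (forall x, `|d x| <= M) ->
  (forall x, c (- x) = c x) -> (forall x, d (- x) = - d x) -> L2 G ->
  intg (fun xi => (c xi ^+ 2 + d xi ^+ 2) * G xi ^+ 2) /\
  n2 (fun xi => c xi * G xi + d xi * G (- xi)) =
    \int[mu]_xi ((c xi ^+ 2 + d xi ^+ 2) * G xi ^+ 2).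
Proof.
move=> mc md cM dM ce d_o GL.
have AL := L2_mulb GL mc cM; have BL := L2_mulb (L2_opp GL) md dM; have DL := L2_mulb GL md dM.
have E1 : ip (fun xi => c xi * G xi) (fun xi => d xi * G (- xi)) = 0.
  by apply: (int_odd (L2M AL BL)) => x; rewrite ce d_o opprK; ring.
have E2 : n2 (fun xi => d xi * G (- xi)) = n2 (fun xi => d xi * G xi).
  rewrite -(n2_opp DL) /n2 !ip_sqr; apply: eq_Rintegral => x _.
  by rewrite d_o mulNr sqrrN.
split; first by have := intgD AL.2 DL.2; congr intg; apply/funext => x; ring.
rewrite (n2D AL BL) E1 E2 mulr0 addr0 /n2 !ip_sqr -(int_D AL.2 DL.2).
by apply: eq_Rintegral => x _; ring.
Qed.

Lemma n2_diff f (h : R) : L2 f -> intg (fun xi => (2 - 2 * cos (h * xi)) * hart f xi ^+ 2) /\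
  \int[mu]_xi ((2 - 2 * cos (h * xi)) * hart f xi ^+ 2) = 2 * pi * n2 (fun x => f (x + h) - f x).
Proof.
move=> fL; have hL := hart_L2 fL; have fhL := L2_shift h fL.
have mc : msr (fun x : R => cos (h * x) - 1) by apply: msrB; [exact: msr_cosM|exact: msr_cst].
have ms : msr (fun x : R => - sin (h * x)) by apply: msrN; exact: msr_sinM.
have bc (x : R) : `|cos (h * x) - 1| <= 2.
  by rewrite ler_norml; have := cos_geN1 (h * x); have := cos_le1 (h * x); lra.
have bs (x : R) : `|- sin (h * x)| <= 2.
  by rewrite normrN ler_norml; have := sin_geN1 (h * x); have := sin_le1 (h * x); lra.
have ec (x : R) : cos (h * - x) - 1 = cos (h * x) - 1 by rewrite mulrN cosN.
have os (x : R) : - sin (h * - x) = - - sin (h * x) by rewrite mulrN sinN.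
have [i1 i2] := n2_even_odd mc ms bc bs ec os hL.
have E : (fun xi => ((cos (h * xi) - 1) ^+ 2 + (- sin (h * xi)) ^+ 2) * hart f xi ^+ 2) =
    (fun xi => (2 - 2 * cos (h * xi)) * hart f xi ^+ 2).
  by apply/funext => x; congr (_ * _); have := cos2Dsin2 (h * x); nra.
rewrite E in i1 i2; split; first exact: i1.
have dL := L2B fhL fL; rewrite -i2 -(n2_hart dL); apply: n2_ae.
- by apply: L2D; [exact: L2_mulb hL mc bc|exact: L2_mulb (L2_opp hL) ms bs].
- exact: hart_L2.
apply: ae_sym; apply: ae_trans (hartB fhL fL) _.
by apply: ae_imp (hart_shift h fL) => x ->; ring.
Qed.

Lemma syn_diff_le (h : R) G : L2 G -> n2 (fun x => syn G (x + h) - syn G x) <= `|h| `^ hexp * n2 G.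
Proof.
move=> GL; have [i1 i2] := n2_diff h (syn_L2 GL).
have pi2 := pi_ge2 R; have pi0 : 0 < 2 * pi :> R by lra.
rewrite -(ler_pM2l pi0) -i2.
have mK : msr (fun xi => (2 - 2 * cos (h * xi)) * (om xi)^-1 ^+ 2).
  apply: msrM; last by apply: msrX; exact: msr_omV.
  apply: msrB; first exact: msr_cst.
  by apply: msrM; [exact: msr_cst|exact: msr_cosM].
have Kb (xi : R) : `|(2 - 2 * cos (h * xi)) * (om xi)^-1 ^+ 2| <= 4 * `|h| `^ hexp.
  by rewrite ger0_norm ?diff_symbol_le// mulr_ge0 ?sqr_ge0//; have := cos_le1 (h * xi); lra.
have iK := intg_mulb GL.2 mK Kb.
rewrite (@int_ae R _ (fun xi => ((2 - 2 * cos (h * xi)) * (om xi)^-1 ^+ 2) * G xi ^+ 2)); first last.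
- by apply: ae_imp (hart_syn GL) => xi ->; rewrite exprMn mulrA.
- exact: intg_msr.
- exact: intg_msr.
apply: le_trans (_ : \int[mu]_xi ((4 * `|h| `^ hexp) * G xi ^+ 2) <= _).
  apply: int_le => //; first by apply: intgZ; case: GL.
  by move=> x; rewrite ler_wpM2r ?sqr_ge0// diff_symbol_le.
rewrite int_Z; last by case: GL.
(* The factor 4 of [diff_symbol_le] is absorbed by [2 * pi >= 4]. *)
rewrite -ip_sqr -/(n2 G) -mulrA ler_wpM2r ?mulr_ge0 ?powR_ge0 ?n2_ge0//; lra.
Qed.

(** The ratio by which the bound on squared increments decreases when the step is halved. As
    [hexp > 1], it beats the factor 2 of the dyadic weights. *)
Definition q : R := 2^-1 `^ hexp.

Lemma q_ge0 : 0 <= q. Proof. exact: powR_ge0. Qed.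

Lemma q_lt : 2 * q < 1.
Proof.
have /andP[s1 _] := hexp_itv.
have l2 : 0 < ln (2 : R) by rewrite ln_gt0// ltr1n.
have -> : q = expR (- (hexp * ln 2)).
  by rewrite /q /powR gt_eqF ?invr_gt0// lnV ?posrE// mulrN.
have {1}-> : 2 = expR (ln 2) :> R by rewrite lnK ?posrE.
by rewrite -expRD expR_lt1; nra.
Qed.

Lemma q_expE k : `|2^-1 ^+ k : R| `^ hexp = q ^+ k.
Proof.
have h0 : 0 <= 2^-1 :> R by rewrite invr_ge0.
by rewrite ger0_norm ?exprn_ge0// -(powR_mulrn k h0) powRAC powR_mulrn ?powR_ge0.
Qed.

Lemma geo_sum_le (r : R) N : 0 <= r -> r < 1 -> \sum_(k < N) r ^+ k <= (1 - r)^-1.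
Proof.
move=> r0 r1; have d0 : 0 < 1 - r by rewrite subr_gt0.
have -> : \sum_(k < N) r ^+ k = (1 - r ^+ N) * (1 - r)^-1.
  elim: N => [|N ih]; first by rewrite big_ord0 expr0 subrr mul0r.
  by rewrite big_ord_recr/= ih exprS; field; rewrite gt_eqF.
by rewrite ler_piMl ?invr_ge0 ?(ltW d0)// gerBl exprn_ge0.
Qed.

Definition band N (x : R) : R := if (1 <= `|x|) && (`|x| < 2 ^+ N) then `|x| else 0.

(** A single term suffices. If [2^k <= |x| < 2^(k+1)], then [2^-k |x|] lies in [[1, 2]], where
    [2 - 2 cos] is at least [2 - 2 cos 1], and [|x|] is at most twice [2^k]. *)
Lemma dyadic_sum : exists2 C : R, 0 <= C & forall N (x : R),
  band N x <= C * \sum_(k < N) 2 ^+ k * (2 - 2 * cos (2^-1 ^+ k * x)).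
Proof.
have c1 : 0 < 2 - 2 * cos 1 :> R.
  have : cos 1 < cos (0 : R).
    have p2 := pi_ge2 R; rewrite ltr_cos ?ltr01// in_itv/=; lra.
  by rewrite cos0; lra.
have C0 : 0 <= 2 / (2 - 2 * cos 1) :> R by rewrite divr_ge0// ltW.
have t0 (y : R) : 0 <= 2 - 2 * cos y by have := cos_le1 y; lra.
exists (2 / (2 - 2 * cos 1)) => //; elim=> [|N ih] x.
  by rewrite big_ord0 mulr0 /band expr0; case: ltP => // h; rewrite ?andbF//; case: leP => // h'; lra.
have T0 : 0 <= 2 ^+ N * (2 - 2 * cos (2^-1 ^+ N * x)) by rewrite mulr_ge0 ?exprn_ge0.
have := ih x; rewrite big_ord_recr/= mulrDr /band.
have [x1|x1] := leP 1 `|x| => /=; last by move=> h; rewrite addr_ge0// mulr_ge0.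
have [xN|xN] := ltP `|x| (2 ^+ N).
  have -> : `|x| < 2 ^+ N.+1 by rewrite (lt_trans xN)// exprS ltr_pMl ?exprn_gt0// ltr1n.
  by move=> h; rewrite (le_trans h)// lerDl mulr_ge0.
move=> h; case: ifP => [xN1|_]; last by rewrite addr_ge0// mulr_ge0.
rewrite -[leLHS]add0r lerD//.
have p0 : 0 < 2 ^+ N :> R by rewrite exprn_gt0.
have y1 : 1 <= 2^-1 ^+ N * `|x| by rewrite exprVn mulrC ler_pdivlMr// mul1r.
have y2 : 2^-1 ^+ N * `|x| <= 2.
  by rewrite exprVn mulrC ler_pdivrMr//; rewrite exprS in xN1; exact: ltW.
have E : cos (2^-1 ^+ N * x) = cos (2^-1 ^+ N * `|x|).
  by case: (ler0P x) => _; rewrite ?mulrN ?cosN.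
have c2 : cos (2^-1 ^+ N * `|x|) <= cos 1.
  have p2 := pi_ge2 R; rewrite leNgt ltr_cos ?in_itv/= -?leNgt//; lra.
rewrite E; apply: le_trans (ltW xN1) _; rewrite exprS; move: p0 c1 c2.
move: (2 ^+ N : R) (cos (1 : R)) (cos (2^-1 ^+ N * `|x|)) => P a b P0 a1 ba.
have -> : 2 / (2 - 2 * a) * (P * (2 - 2 * b)) = 2 * P * ((2 - 2 * b) / (2 - 2 * a)).
  by field; lra.
rewrite ler_peMr ?mulr_ge0 ?(ltW P0)//.
by rewrite ler_pdivlMr// mul1r; lra.
Qed.

Lemma band_ge0 N x : 0 <= band N x.
Proof. by rewrite /band; case: ifP. Qed.

Lemma msr_band N : msr (band N).
Proof.
have mn : msr (fun x : R => `|x|) by apply: msr_norm; exact: msr_id.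
pose A : set R := (fun x : R => `|x|) @^-1` [set` `[1, 2 ^+ N[].
have -> : band N = fun x => `|x| * \1_A x.
  apply/funext => x; rewrite /band indicE /A.
  case: ifPn => h; first by rewrite mem_set ?mulr1//= in_itv.
  by rewrite memNset ?mulr0//= in_itv/=; exact/negP.
by apply: msrM => //; apply: msr_indic; exact: measurable_pre_itv.
Qed.

Lemma band_near (x : R) : exists N, forall n : nat, (N <= n)%N ->
  band n x = `|x| * \1_[set x : R | 1 <= `|x|] x.
Proof.
have [x1|x1] := leP 1 `|x|; last first.
  exists 0%N => n _; rewrite /band indicE leNgt x1/= memNset ?mulr0//=.
  by apply/negP; rewrite -ltNge.
exists (Num.bound `|x|) => n bn; rewrite /band x1/= indicE mem_set// mulr1.
suff -> : `|x| < 2 ^+ n by [].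
apply: lt_le_trans (archi_boundP (normr_ge0 x)) _.
rewrite -natrX ler_nat; apply: leq_trans bn _; exact/ltnW/ltn_expl.
Qed.

Lemma int_sum n (F : nat -> R -> R) : (forall k, intg (F k)) ->
  \int[mu]_x (\sum_(k < n) F k x) = \sum_(k < n) \int[mu]_x F k x.
Proof.
move=> Fi; elim: n => [|n ih].
  by rewrite big_ord0; under eq_Rintegral do rewrite big_ord0; rewrite /Rintegral integral0.
under eq_Rintegral do rewrite big_ord_recr/=.
by rewrite int_D ?ih ?big_ord_recr//; exact: intg_sum.
Qed.

(* The hypothesis bounds the dyadic sum of the [2 ^+ k * n2 (f (. + 2 ^- k) - f)],
   a substitute for the H^(1/2) seminorm. *)
Lemma half_derivative_le : exists2 C : R, 0 <= C & forall f (A : R), L2 f -> 0 <= A ->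
  (forall k, n2 (fun x => f (x + 2^-1 ^+ k) - f x) <= A * q ^+ k) ->
  L2 (fun xi => xi / om xi * hart f xi) /\
  n2 (fun xi => xi / om xi * hart f xi) <= C * (n2 f + A).
Proof.
have [C C0 CP] := dyadic_sum.
have q0 : 0 <= 2 * q by rewrite mulr_ge0 ?q_ge0.
have d0 : 0 < 1 - 2 * q by have := q_lt; lra.
have pi0 : 0 < 2 * pi :> R by rewrite mulr_gt0// pi_gt0.
have D0 : 0 <= C * (1 - 2 * q)^-1 by rewrite mulr_ge0// invr_ge0 ltW.
exists (2 * pi * (1 + C * (1 - 2 * q)^-1)).
  by rewrite mulr_ge0 ?(ltW pi0)// addr_ge0.
move=> f A fL A0 fA; have hL := hart_L2 fL.
pose S k xi := 2 ^+ k * ((2 - 2 * cos (2^-1 ^+ k * xi)) * hart f xi ^+ 2).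
have Si k : intg (S k) by apply: intgZ; have [] := n2_diff (2^-1 ^+ k) fL.
(* By Plancherel the [k]-th term is [2 pi 2^k] times the squared norm of an increment, at most
   [2 pi A (2 q)^k]. *)
have SI N : \int[mu]_xi (\sum_(k < N) S k xi) <= 2 * pi * (A * (1 - 2 * q)^-1).
  rewrite int_sum//; apply: le_trans (_ : 2 * pi * (A * \sum_(k < N) (2 * q) ^+ k) <= _); last first.
    by rewrite ler_pM2l// ler_wpM2l// geo_sum_le//; have := q_lt.
  rewrite !mulr_sumr; apply: ler_sum => k _.
  have [i1 i2] := n2_diff (2^-1 ^+ k) fL; rewrite /S int_Z// i2.
  have -> : 2 * pi * (A * (2 * q) ^+ k) = 2 ^+ k * (2 * pi * (A * q ^+ k)) by rewrite exprMn; ring.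
  by rewrite ler_wpM2l ?exprn_ge0// ler_pM2l.
pose F N xi := (1 + band N xi) * hart f xi ^+ 2.
pose g xi := (1 + `|xi| * \1_[set x : R | 1 <= `|x|] xi) * hart f xi ^+ 2.
have FS N xi : band N xi * hart f xi ^+ 2 <= C * \sum_(k < N) S k xi.
  apply: le_trans (ler_wpM2r (sqr_ge0 _) (CP N xi)) _.
  rewrite -mulrA ler_wpM2l// mulr_suml; apply: ler_sum => k _.
  by rewrite /S mulrA.
have Fi1 N : intg (fun xi => band N xi * hart f xi ^+ 2).
  apply: intg_le (intgZ C (intg_sum N Si)) _ => [|xi].
    by apply: msrM; [exact: msr_band|exact: intg_msr hL.2].
  by rewrite ger0_norm ?FS// mulr_ge0 ?sqr_ge0// band_ge0.
have FE N : F N = fun xi => hart f xi ^+ 2 + band N xi * hart f xi ^+ 2.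
  by apply/funext => xi; rewrite /F mulrDl mul1r.
have Fi N : intg (F N) by rewrite FE; apply: intgD => //; exact: hL.2.
have FI N : \int[mu]_xi F N xi <= 2 * pi * (1 + C * (1 - 2 * q)^-1) * (n2 f + A).
  rewrite FE int_D//; last exact: hL.2.
  rewrite -ip_sqr -/(n2 (hart f)) n2_hart//.
  have h1 : \int[mu]_xi (band N xi * hart f xi ^+ 2) <= C * (2 * pi * (A * (1 - 2 * q)^-1)).
    apply: le_trans (_ : \int[mu]_xi (C * \sum_(k < N) S k xi) <= _).
      by apply: int_le => //; apply: intgZ; exact: intg_sum.
    by rewrite int_Z ?ler_wpM2l//; exact: intg_sum.
  apply: le_trans (lerD (lexx _) h1) _.
  have e1 := mulr_ge0 (mulr_ge0 (ltW pi0) D0) (n2_ge0 f).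
  have e2 := mulr_ge0 (ltW pi0) A0.
  move: D0 e1; move: ((1 - 2 * q)^-1) => D D0 e1; lra.
have g0 xi : 0 <= g xi by rewrite mulr_ge0 ?sqr_ge0// addr_ge0// mulr_ge0.
have mg : msr g.
  apply: msrM; last exact: intg_msr hL.2.
  apply: msrD; first exact: msr_cst.
  apply: msrM; first by apply: msr_norm; exact: msr_id.
  apply: msr_indic; have -> : [set x : R | 1 <= `|x|] = (fun x : R => `|x|) @^-1` [set` `[1, +oo[].
    by apply/seteqP; split => x /=; rewrite in_itv/= andbT.
  by apply: measurable_pre_itv; apply: msr_norm; exact: msr_id.
have Fg : {ae mu, forall xi, F ^~ xi @ \oo --> g xi}.
  apply: aeW => xi; have [N NP] := band_near xi.
  apply/cvgn_eps => e e0; exists N => n Nn; rewrite /F /g NP// subrr normr0 ltW//.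
(* The bounds are uniform in the number of bands, so Fatou's lemma gives integrability and the
   estimate together. *)
have [gi gI] := fatouR Fi (fun N xi => mulr_ge0 (addr_ge0 ler01 (band_ge0 N xi)) (sqr_ge0 _)) mg g0 Fg FI.
have le xi : (xi / om xi * hart f xi) ^+ 2 <= g xi.
  by rewrite exprMn ler_wpM2r ?sqr_ge0// freq_ratio_le.
have mF : msr (fun xi => xi / om xi * hart f xi).
  apply: msrM; last by case: hL.
  by apply: msrM; [exact: msr_id|exact: msr_omV].
have xL : L2 (fun xi => xi / om xi * hart f xi).
  split => //; apply: intg_le gi _ => [|xi]; first exact: msrX.
  by rewrite ger0_norm ?sqr_ge0.
split => //; apply: le_trans gI; rewrite /n2 ip_sqr; apply: int_le => //.
by case: xL.
Qed.

Lemma L2_pow f M n : L2 f -> (forall x, `|f x| <= M) -> L2 (fun x => f x ^+ n.+1).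
Proof.
move=> fL fM; have M0 : 0 <= M by exact: le_trans (fM 0).
under eq_fun do rewrite exprSr.
apply: (L2_mulb fL (msrX n (L2_msr fL)) (M := M ^+ n)) => x.
by rewrite normrX lerXn2r ?nnegrE.
Qed.

Variable p : nat.

(* The symbol of [- 1 / 2 * smoothed_dx] is odd and imaginary, hence the
   reflection [- xi]. *)
Definition nonlin G : R -> R := fun xi => 2^-1 * (xi / om xi * hart (fun x => syn G x ^+ p.+1) (- xi)).

Lemma pow_syn_L2 G : L2 G -> L2 (fun x => syn G x ^+ p.+1).
Proof. by move=> GL; have [C _ CP] := syn_bound; apply: (L2_pow p (syn_L2 GL)) => x; exact: CP. Qed.

(** [half_derivative_le] is applied to a difference of powers: [pow_sub_le] bounds its norm and
    [pow_sub2_le] its increments, with [m] the uniform bound on the difference of the two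
    functions. *)
Lemma pow_syn_lip (K : R) : 0 < K -> exists2 C : R, 0 <= C & forall G G', L2 G -> L2 G' ->
  n2 G <= K ^+ 2 -> n2 G' <= K ^+ 2 ->
  let f x := syn G x ^+ p.+1 - syn G' x ^+ p.+1 in
  L2 (fun xi => xi / om xi * hart f xi) /\
  n2 (fun xi => xi / om xi * hart f xi) <= C * n2 (fun xi => G xi - G' xi).
Proof.
move=> K0; have [B B0 BP] := syn_bound; have [H H0 HP] := half_derivative_le.
pose M := B * K; have M0 : 0 <= M by rewrite mulr_ge0// ltW.
have [C1 C10 hC1] := pow_sub_le p.+1 M0; have [C2 C20 hC2] := pow_sub2_le p.+1 M0.
(* The squared norm of [|u| + m |v|] is at most [2 n2 u + 2 m^2 n2 v]. Here [m^2 = B^2 E] and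
   [n2 v <= K^2 q^k], and [B K = M]. *)
pose A0 := C2 ^+ 2 * (2 + 2 * M ^+ 2).
have A00 : 0 <= A0 by rewrite mulr_ge0 ?sqr_ge0// addr_ge0// mulr_ge0// sqr_ge0.
exists (H * (C1 ^+ 2 + A0)); first by rewrite mulr_ge0// addr_ge0// sqr_ge0.
move=> G G' GL GL' GK GK' f.
pose E := n2 (fun xi => G xi - G' xi); have E0 : 0 <= E by exact: n2_ge0.
have dL := L2B GL GL'.
have sb J x : L2 J -> n2 J <= K ^+ 2 -> `|syn J x| <= M.
  move=> JL JK; apply: le_trans (BP _ _ JL) _; rewrite ler_wpM2l//.
  by rewrite -[leRHS](ger0_norm (ltW K0)) -sqrtr_sqr ler_wsqrtr.
have fL : L2 f by apply: L2B; exact: pow_syn_L2.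
have dE x : syn G x - syn G' x = syn (fun xi => G xi - G' xi) x by rewrite synB.
have n2f : n2 f <= C1 ^+ 2 * E.
  have h : n2 (syn (fun xi => G xi - G' xi)) <= E.
    rewrite (n2_ae (syn_L2 dL) (L2Z _ (hart_L2 (omV_mul_L2 dL))) (syn_hart dL)) n2Z ?n2_hart//; [|exact: omV_mul_L2|exact/hart_L2/omV_mul_L2].
    rewrite expr2 -mulrA (mulrA (2 * pi)^-1 (2 * pi)) mulVf ?pi2V_neq0// mul1r.
    have pi2 := pi_ge2 R.
    apply: le_trans (_ : 1 * n2 (fun xi => (om xi)^-1 * (G xi - G' xi)) <= _).
      by rewrite ler_wpM2r ?n2_ge0// invf_le1; lra.
    rewrite mul1r; have := n2_mulb dL msr_omV omV_norm_le1.
    by rewrite expr1n mul1r.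
  apply: le_trans (_ : n2 (fun x => C1 * (syn G x - syn G' x)) <= _).
    rewrite /n2 !ip_sqr; apply: int_le; [by case: fL|by case: (L2Z C1 (L2B (syn_L2 GL) (syn_L2 GL')))|].
    move=> x; rewrite -(real_normK (num_real (f x))) -(real_normK (num_real (_ * _))).
    by rewrite lerXn2r ?nnegrE// normrM (ger0_norm C10) hC1// sb.
  rewrite n2Z; last by apply: L2B; exact: syn_L2.
  by rewrite ler_wpM2l ?sqr_ge0//; under eq_fun do rewrite dE.
have fA k : n2 (fun x => f (x + 2^-1 ^+ k) - f x) <= A0 * E * q ^+ k.
  set h := 2^-1 ^+ k.
  pose m := B * Num.sqrt E; have m0 : 0 <= m by rewrite mulr_ge0// sqrtr_ge0.
  pose u x := syn (fun xi => G xi - G' xi) (x + h) - syn (fun xi => G xi - G' xi) x.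
  pose v x := syn G' (x + h) - syn G' x.
  have uL : L2 u by apply: L2B; [exact: L2_shift (syn_L2 dL)|exact: syn_L2].
  have vL : L2 v by apply: L2B; [exact: L2_shift (syn_L2 GL')|exact: syn_L2].
  have absL (J : R -> R) : L2 J -> L2 (fun x => `|J x|).
    by move=> JL; apply: (L2_le (msr_norm (L2_msr JL)) JL) => y; rewrite normr_id.
  have n2abs (J : R -> R) : n2 (fun x => `|J x|) = n2 J.
    by rewrite /n2 !ip_sqr; apply: eq_Rintegral => y _; rewrite real_normK ?num_real.
  have wL : L2 (fun x => `|u x| + m * `|v x|) by apply: L2D; [exact: absL|exact/L2Z/absL].
  apply: le_trans (_ : n2 (fun x => C2 * (`|u x| + m * `|v x|)) <= _).
    rewrite /n2 !ip_sqr; apply: int_le; [|by case: (L2Z C2 wL)|].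
      by case: (L2B (L2_shift h fL) fL).
    move=> x; rewrite -(real_normK (num_real (_ - _))) -(real_normK (num_real (_ * _))).
    rewrite lerXn2r ?nnegrE// normrM (ger0_norm C20).
    rewrite [leRHS](_ : _ = C2 * (`|u x| + m * `|v x|)); last first.
      by rewrite ger0_norm// addr_ge0// mulr_ge0.
    have := hC2 (syn G (x + h)) (syn G x) (syn G' (x + h)) (syn G' x) m.
    by rewrite !sb// !dE !BP//; exact.
  rewrite n2Z// -[leRHS]mulrA /A0 -[leRHS]mulrA ler_wpM2l ?sqr_ge0//.
  apply: le_trans (n2D_le (absL _ uL) (L2Z m (absL _ vL))) _.
  rewrite n2Z ?n2abs//; last exact: absL.
  have hu := syn_diff_le h dL; have hv := syn_diff_le h GL'.
  rewrite -/E -/u q_expE in hu; rewrite -/v q_expE in hv.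
  have hq : 0 <= q ^+ k by rewrite exprn_ge0// q_ge0.
  have m2 : m ^+ 2 = B ^+ 2 * E by rewrite exprMn sqr_sqrtr.
  have mv : m ^+ 2 * n2 v <= B ^+ 2 * E * (q ^+ k * K ^+ 2).
    rewrite m2 ler_wpM2l ?mulr_ge0 ?sqr_ge0//; apply: le_trans hv _.
    by rewrite ler_wpM2l.
  apply: le_trans (_ : 2 * (q ^+ k * E) + 2 * (B ^+ 2 * E * (q ^+ k * K ^+ 2)) <= _).
    by rewrite lerD// ler_pM2l.
  by rewrite /M exprMn le_eqVlt; apply/orP; left; apply/eqP; ring.
have [h1 h2] := HP f (A0 * E) fL (mulr_ge0 A00 E0) fA; split=> //.
apply: le_trans h2 _; rewrite -/E -mulrA ler_wpM2l//; lra.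
Qed.

Lemma n2_0 : n2 (fun=> 0 : R) = 0.
Proof. by rewrite /n2 /ip; under eq_Rintegral do rewrite mul0r; rewrite /Rintegral integral0. Qed.

Lemma syn0 : syn (fun=> 0) = fun=> 0.
Proof.
apply/funext => x; rewrite /syn /hartley1; under eq_Rintegral do rewrite mulr0 mul0r.
by rewrite /Rintegral integral0 mulr0.
Qed.

(** The case [G' = 0] of [pow_syn_lip], with radius [n2 G + 1], whose square exceeds [n2 G] without
    a square root. *)
Lemma nonlin_L2 G : L2 G -> L2 (nonlin G).
Proof.
move=> GL.
have K0 : 0 < n2 G + 1 by rewrite ltr_wpDl ?n2_ge0.
have GK : n2 G <= (n2 G + 1) ^+ 2 by have := n2_ge0 G; nra.
have [C _ CP] := pow_syn_lip K0.
have K1 : n2 (fun=> 0 : R) <= (n2 G + 1) ^+ 2 by rewrite n2_0 sqr_ge0.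
have [h _] := CP G (fun=> 0) GL L20 GK K1.
have fe : (fun x => syn G x ^+ p.+1 - syn (fun=> 0) x ^+ p.+1) = fun x => syn G x ^+ p.+1.
  by apply/funext => x; rewrite syn0 expr0n subr0.
rewrite fe in h.
have E : nonlin G = fun xi => - 2^-1 * (fun xi => xi / om xi * hart (fun x => syn G x ^+ p.+1) xi) (- xi).
  by apply/funext => xi; rewrite /nonlin omN; ring.
by rewrite E; apply: L2Z; exact: (L2_opp h).
Qed.

Lemma nonlin0 : n2 (nonlin (fun=> 0)) = 0.
Proof.
have fe : (fun x => syn (fun=> 0) x ^+ p.+1) = fun=> 0.
  by apply/funext => x; rewrite syn0 expr0n.
have h0 : ae_eqR (hart (fun=> 0)) (fun=> 0 : R).
  by apply: ip_eq0; [exact: hart_L2 L20|rewrite -/(n2 _) n2_hart ?n2_0 ?mulr0//; exact: L20].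
transitivity (n2 (fun=> 0 : R)); last exact: n2_0.
apply: (n2_ae (nonlin_L2 L20) L20).
by rewrite /nonlin fe; apply: ae_imp (ae_opp h0) => xi ->; rewrite !mulr0.
Qed.

Lemma nonlin_lip (K : R) : 0 < K -> exists2 C : R, 0 <= C & forall G G', L2 G -> L2 G' ->
  n2 G <= K ^+ 2 -> n2 G' <= K ^+ 2 ->
  n2 (fun xi => nonlin G xi - nonlin G' xi) <= C * n2 (fun xi => G xi - G' xi).
Proof.
move=> K0; have [C C0 CP] := pow_syn_lip K0; exists C => // G G' GL GL' GK GK'.
have [h1 h2] := CP G G' GL GL' GK GK'; set f := fun x => _ - _ in h1 h2.
apply: le_trans h2; rewrite -(n2_opp h1).
have hL := L2_opp h1; have dL := L2B (nonlin_L2 GL) (nonlin_L2 GL').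
apply: le_trans (_ : n2 (fun xi => - 2^-1 * (- xi / om (- xi) * hart f (- xi))) <= _).
  rewrite le_eqVlt; apply/orP; left; apply/eqP; apply: n2_ae => //; first exact: L2Z.
  apply: ae_imp (ae_opp (hartB (pow_syn_L2 GL) (pow_syn_L2 GL'))) => xi ->.
  rewrite /nonlin omN; move: (hart _ (- xi)) (hart (fun x => syn G' x ^+ p.+1) (- xi)) => a b.
  by ring.
by rewrite n2Z// sqrrN ler_piMl ?n2_ge0// expr_le1 ?invr_ge0// invf_le1// ler1n.
Qed.

Lemma nonlin_ip0 G : L2 G -> ip G (nonlin G) = 0.
Proof.
move=> GL; set f := fun x => syn G x ^+ p.+1; set u := syn G.
have fL : L2 f by exact: pow_syn_L2.
have uL : L2 u by exact: syn_L2.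
have hfL := hart_L2 fL; have huL := hart_L2 uL.
have [C _ CP] := syn_bound; set M := C * Num.sqrt (n2 G).
have uM x : `|u x| <= M by exact: CP.
have M0 : 0 <= M by exact: le_trans (uM 0).
have pi0 : 0 < pi :> R by exact: pi_gt0.
(* For these steps the quotient bound [h^-1 |h|^hexp] is [(2 q)^k], which tends to 0. *)
pose h k : R := 2^-1 ^+ k.
have h0 k : 0 < h k by rewrite exprn_gt0// invr_gt0.
pose W xi := (om xi)^-1 * G xi * hart f (- xi).
(* [sin (h xi) / h] replaces the frequency [xi]. Since it is at most [|xi|] in modulus, dominated
   convergence recovers [2 * ip G (nonlin G)]; for fixed [h] the integral is a symmetric difference
   of [u] tested against [f]. *)
pose I k := \int[mu]_xi ((h k)^-1 * sin (h k * xi) * W xi).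
have NL := nonlin_L2 GL.
have UL := omV_mul_L2 GL.
have Wi : intg W by exact: L2M UL (L2_opp hfL).
have WE xi : xi * W xi = 2 * (G xi * nonlin G xi).
  by rewrite /W /nonlin -/f; field; exact: om_neq0.
have ms k : msr (fun xi => sin (h k * xi)) by exact: msr_sinM.
have small (r : R) : 0 <= r -> r < 1 -> (fun k => r ^+ k) @ \oo --> (0 : R).
  by move=> r0 r1; apply: cvg_expr; rewrite ger0_norm.
have h1 : (fun k => h k) @ \oo --> (0 : R) by apply: small; rewrite ?invr_ge0// invf_lt1// ltr1n.
have I1 : (fun k => I k) @ \oo --> 2 * ip G (nonlin G).
  have mF k : msr (fun xi => (h k)^-1 * sin (h k * xi) * W xi).
    by apply: msrM (intg_msr Wi); apply: msrM; [exact: msr_cst|exact: ms].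
  have mf : msr (fun xi => 2 * (G xi * nonlin G xi)) by apply: intg_msr; apply: intgZ; exact: L2M.
  have cF : {ae mu, forall xi, (fun k => (h k)^-1 * sin (h k * xi) * W xi) @ \oo --> 2 * (G xi * nonlin G xi)}.
    apply: aeW => xi; rewrite -WE; apply: cvgMr_tmp.
    apply/cvgn_eps => e e0.
    have c0 : 0 < e / (`|xi| ^+ 3 + 1) by rewrite divr_gt0// ltr_wpDl// exprn_ge0.
    have [N NP] := (cvgn_eps _ _).1 h1 _ c0; exists N => k Nk.
    have := NP k Nk; rewrite subr0 (gtr0_norm (h0 k)) ler_pdivlMr; last by rewrite ltr_wpDl// exprn_ge0.
    have hk1 : h k <= 1 by rewrite exprn_ile1 ?invr_ge0// invf_le1// ler1n.
    move=> hk; have -> : (h k)^-1 * sin (h k * xi) - xi = (h k)^-1 * (sin (h k * xi) - h k * xi).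
      by rewrite mulrBr mulKf// gt_eqF.
    rewrite normrM gtr0_norm ?invr_gt0// mulrC ler_pdivrMr//.
    apply: le_trans (sin_sub_le _) _; rewrite normrM (gtr0_norm (h0 k)) exprMn.
    have x3 : 0 <= `|xi| ^+ 3 by rewrite exprn_ge0.
    have k0 := h0 k; have : h k ^+ 3 <= h k ^+ 2 by rewrite exprS ler_piMl// sqr_ge0.
    by move: (`|xi| ^+ 3) x3 hk => X X0 hk hk3; nra.
  have bF k xi : `|(h k)^-1 * sin (h k * xi) * W xi| <= `|2 * (G xi * nonlin G xi)|.
    rewrite -WE !normrM ler_wpM2r// gtr0_norm ?invr_gt0// mulrC ler_pdivrMr//.
    by rewrite [leRHS]mulrC -{2}(gtr0_norm (h0 k)) -normrM sin_norm_le.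
  have gi : intg (fun xi => `|2 * (G xi * nonlin G xi)|) by apply: intg_norm; apply: intgZ; exact: L2M.
  by have [_] := dom_cvg mF mf cF gi bF; rewrite int_Z//; exact: L2M.
pose a k x := u (x + h k) - u (x + - h k).
have aL k : L2 (a k) by apply: L2B; exact: L2_shift.
have IE k : I k = pi * (h k)^-1 * ip (a k) f.
  have e1 := ip_hart2 (aL k) fL.
  have e2 : ip (hart (a k)) (hart f) = \int[mu]_xi (2 * (sin (h k * xi) * W xi)).
    have sW : intg (fun xi => sin (h k * xi) * W xi).
      by apply: (intg_mulb (M := 1) Wi (ms k)) => x; rewrite ler_norml sin_geN1 sin_le1.
    rewrite -(int_opp (intgZ 2 sW)).
    apply: int_ae; [|exact: (intg_msr (intg_opp (intgZ 2 sW)))|].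
      exact: (intg_msr (L2M (hart_L2 (aL k)) hfL)).
    have E1 : ae_eqR (hart (a k)) (fun xi => - 2 * sin (h k * xi) * hart u (- xi)).
      apply: ae_trans (hartB (L2_shift (h k) uL) (L2_shift (- h k) uL)) _.
      apply: ae_imp2 _ (hart_shift (h k) uL) (hart_shift (- h k) uL) => x -> ->.
      by rewrite (mulNr (h k)) cosN sinN; ring.
    apply: ae_imp2 _ E1 (ae_opp (hart_syn GL)) => x -> ->.
    by rewrite /W mulrN sinN opprK; ring.
  rewrite e1 int_Z in e2; last first.
    by apply: (intg_mulb (M := 1) Wi (ms k)) => x; rewrite ler_norml sin_geN1 sin_le1.
  rewrite /I; under eq_Rintegral do rewrite -mulrA.
  rewrite int_Z; last first.
    by apply: (intg_mulb (M := 1) Wi (ms k)) => x; rewrite ler_norml sin_geN1 sin_le1.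
  by rewrite mulrC -mulrA mulrCA mulrC; congr (_ * _); move: e2; lra.
have [D D0 hD] := flux_le p M0.
have Ib k : `|I k| <= pi * D * n2 G * (2 * q) ^+ k.
  rewrite IE !normrM (gtr0_norm pi0) gtr0_norm ?invr_gt0//.
  have hV : (h k)^-1 = 2 ^+ k by rewrite /h exprVn invrK.
  rewrite hV exprMn -!mulrA ler_pM2l// !mulrA (mulrC _ (2 ^+ k)) -!mulrA ler_pM2l ?exprn_gt0//.
  have sL := L2_shift (h k) uL; have sfL := L2_shift (h k) fL.
  have shE x : u (x + - h k + h k) = u x by rewrite -addrA addNr addr0.
  have i2 : intg (fun x => u x ^+ p.+2) by have := L2M uL fL; congr intg; apply/funext => x; rewrite exprS.
  have i2s := intg_shift (h k) i2.
  have E1 : ip (a k) f = ip (fun x => u (x + h k)) f - ip u (fun x => f (x + h k)).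
    have -> : ip u (fun x => f (x + h k)) = ip (fun x => u (x + - h k)) f; last first.
      exact: (ipBl sL (L2_shift (- h k) uL) fL).
    rewrite -(ip_shift (h k) (L2_shift (- h k) uL) fL).
    by apply: eq_Rintegral => x _; rewrite -addrA addrN addr0.
  (* The last summand has integral 0 by translation invariance; it is added so that [flux_le]
     applies. *)
  pose Q x := u (x + h k) * u x ^+ p.+1 - u x * u (x + h k) ^+ p.+1 +
    p%:R / p.+2%:R * (u (x + h k) ^+ p.+2 - u x ^+ p.+2).
  have i12 := intgB (L2M sL fL) (L2M uL sfL); have i3 := intgB i2s i2.
  have Qi : intg Q := intgD i12 (intgZ (p%:R / p.+2%:R) i3).
  have E2 : ip (a k) f = \int[mu]_x Q x.
    rewrite (int_D i12 (intgZ _ i3)) (int_Z _ i3) (int_B i2s i2) (int_B (L2M sL fL) (L2M uL sfL)).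
    have e4 : \int[mu]_x (u (x + h k) ^+ p.+2) = \int[mu]_x (u x ^+ p.+2) := int_shift (h k) i2.
    by rewrite e4 [X in _ + _ * X]subrr mulr0 addr0; exact: E1.
  have dL := L2B sL uL.
  rewrite E2; apply: le_trans (int_norm Qi) _.
  apply: le_trans (_ : \int[mu]_x (D * (u (x + h k) - u x) ^+ 2) <= _).
    apply: int_le; [exact: intg_norm|by apply: intgZ; case: dL|] => x.
    exact: hD.
  rewrite int_Z; last by case: dL.
  rewrite -ip_sqr ler_wpM2l// mulrC -q_expE; exact: syn_diff_le.
have I0 : (fun k => I k) @ \oo --> (0 : R).
  have q0 : 0 <= 2 * q by rewrite mulr_ge0 ?q_ge0.
  apply: norm_cvg0; apply: cvg0_squeeze (_ : (fun k => pi * D * n2 G * (2 * q) ^+ k) @ \oo --> (0 : R)).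
    by move=> k; rewrite normr_ge0 Ib.
  rewrite -(mulr0 (pi * D * n2 G)); apply: cvgMl_tmp; apply: small => //; exact: q_lt.
have E : 2 * ip G (nonlin G) = 0 by exact: (cvg_unique _ I1 I0).
by move: E; lra.
Qed.

End symbol.

End dispersion.

(** * Fourier and Hartley transforms *)

Section fourier_hartley.
Context {R : realType}.
Local Notation mu := (@lebesgue_measure R).
Implicit Types (f h : R -> R) (g : R -> R[i]).
Local Open Scope complex_scope.

Definition sqn (z : R[i]) : R := complex.Re z ^+ 2 + complex.Im z ^+ 2.

Lemma normc_sqn (z : R[i]) : Normc.normc z = Num.sqrt (sqn z).
Proof. by case: z. Qed.

Lemma cL2normE g : cL2norm g = ((\int[mu]_x (sqn (g x))%:E) `^ 2^-1)%E.
Proof.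
rewrite /cL2norm unlock; congr poweR; apply: eq_integral => x _ /=.
rewrite normc_sqn ger0_norm ?sqrtr_ge0//; congr EFin.
by rewrite powR_mulrn ?sqrtr_ge0// sqr_sqrtr// addr_ge0// sqr_ge0.
Qed.

Lemma cL2norm_L2 g : L2 (fun x => complex.Re (g x)) -> L2 (fun x => complex.Im (g x)) ->
  cL2norm g = (Num.sqrt (n2 (fun x => complex.Re (g x)) + n2 (fun x => complex.Im (g x))))%:E.
Proof.
move=> [m1 i1] [m2 i2]; rewrite cL2normE /sqn -(EFin_int (intgD i1 i2)) int_D//.
have j1 := int_ge0 (fun x => sqr_ge0 (complex.Re (g x))).
have j2 := int_ge0 (fun x => sqr_ge0 (complex.Im (g x))).
by rewrite poweR_EFin powR12_sqrt ?addr_ge0// /n2 !ip_sqr.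
Qed.

Lemma cL2P g : cL2 g <-> L2 (fun x => complex.Re (g x)) /\ L2 (fun x => complex.Im (g x)).
Proof.
split=> [[m1 m2]|[r i]]; last first.
  by split; [case: r|case: i|rewrite cL2norm_L2// ltry].
rewrite cL2normE => h; have {}h : (\int[mu]_x (sqn (g x))%:E < +oo)%E.
  by apply: (@lty_poweRy _ _ 2^-1) => //; rewrite gt_eqF// invr_gt0.
have ms : msr (fun x => sqn (g x)) by apply: msrD; exact: msrX.
have si : intg (fun x => sqn (g x)).
  by apply/intg_ge0 => // x; rewrite addr_ge0 ?sqr_ge0.
split; (split => //; apply: intg_le si _ => [|x]; first exact: msrX);
  by rewrite ger0_norm ?sqr_ge0// /sqn ?lerDl ?lerDr sqr_ge0.
Qed.

Lemma Lfun_L2 f : f \in Lfun mu 2%:E <-> L2 f.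
Proof.
split=> [fL|[mf fi]].
  split; last exact: Lfun2_integrable_sqr.
  by have := sub_Lfun_mfun fL; rewrite inE.
have E : cL2norm (fun x => (f x)%:C) = 'N[mu]_2%:E[EFin \o f]%E.
  rewrite /cL2norm unlock; congr poweR; apply: eq_integral => x _ /=.
  by rewrite expr0n addr0 sqrtr_sqr normr_id.
apply/andP; split; first by rewrite inE.
rewrite inE /= /finite_norm -E.
by have [_ _] := (cL2P (fun x => (f x)%:C)).2 (conj (conj mf fi) L20).
Qed.

Definition evp h x := 2^-1 * (h x + h (- x)).
Definition odp h x := 2^-1 * (h x - h (- x)).

Lemma evp_L2 h : L2 h -> L2 (evp h).
Proof. by move=> hL; apply: L2Z; apply: L2D => //; exact: L2_opp. Qed.

Lemma odp_L2 h : L2 h -> L2 (odp h).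
Proof. by move=> hL; apply: L2Z; apply: L2B => //; exact: L2_opp. Qed.

Lemma n2_evp_odp h : L2 h -> n2 (evp h) + n2 (odp h) = n2 h.
Proof.
move=> hL; have oL := L2_opp hL.
by rewrite (n2Z _ (L2D hL oL)) (n2Z _ (L2B hL oL)) n2D// n2B// n2_opp//; field.
Qed.

Lemma evp_sub h h' x : evp h x - evp h' x = evp (fun x => h x - h' x) x.
Proof. by rewrite /evp; ring. Qed.

Lemma odp_sub h h' x : odp h x - odp h' x = odp (fun x => h x - h' x) x.
Proof. by rewrite /odp; ring. Qed.

Definition fhat h (xi : R) : R[i] := evp h xi +i* (- odp h xi).

Lemma cintegral_trunc f n xi : L2 f ->
  cintegral `[- n%:R, n%:R] (fun x => (f x)%:C * expi (- (x * xi))) =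
  fhat (hartley1 (trunc n f)) xi.
Proof.
move=> fL; have ti := trunc_intg n fL.
have tc y : intg (fun x => trunc n f x * cas (x * y)) by exact: intg_cas.
have restr (k : R -> R) : \int[mu]_(x in `[- n%:R, n%:R]) (f x * k x) =
    \int[mu]_x (trunc n f x * k x).
  rewrite Rintegral_mkcond; apply: eq_Rintegral => x _.
  rewrite patchE /trunc indicE; case: ifPn => h; rewrite ?mulr1// mulr0 mul0r//.
rewrite /cintegral /fhat; congr (_ +i* _).
  transitivity (\int[mu]_(x in `[- n%:R, n%:R]) (f x * cos (x * xi))).
    by apply: eq_Rintegral => x _; rewrite /expi/= cosN; ring.
  rewrite restr /evp /hartley1 -int_D// -int_Z; last exact: intgD.
  by apply: eq_Rintegral => x _; rewrite /cas mulrN cosN sinN; field.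
transitivity (\int[mu]_(x in `[- n%:R, n%:R]) (f x * - sin (x * xi))).
  by apply: eq_Rintegral => x _; rewrite /expi/= sinN; ring.
rewrite restr /odp /hartley1 -int_B// -mulNr -int_Z; last exact: intgB.
by apply: eq_Rintegral => x _; rewrite /cas (mulrN x) cosN sinN; field.
Qed.

Lemma is_fourierP f g : L2 f -> is_fourier f g <->
  [/\ L2 (fun x => complex.Re (g x)), L2 (fun x => complex.Im (g x)),
   L2cvg (fun n => evp (hartley1 (trunc n f))) (fun x => complex.Re (g x)) &
   L2cvg (fun n x => - odp (hartley1 (trunc n f)) x) (fun x => complex.Im (g x))].
Proof.
move=> fL.
have hL n := hartley1_L2 (trunc_intg n fL) (trunc_L2 n fL).
rewrite /is_fourier; under eq_fun do under eq_fun do rewrite (cintegral_trunc _ _ fL).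
have E n r i : L2 (fun x => complex.Re (g x)) -> L2 (fun x => complex.Im (g x)) ->
   r = n2 (fun x => evp (hartley1 (trunc n f)) x - complex.Re (g x)) ->
   i = n2 (fun x => - odp (hartley1 (trunc n f)) x - complex.Im (g x)) ->
   cL2norm (fun xi => fhat (hartley1 (trunc n f)) xi - g xi) = (Num.sqrt (r + i))%:E.
  move=> rL iL -> ->.
  have r1 x : complex.Re (fhat (hartley1 (trunc n f)) x - g x) =
      evp (hartley1 (trunc n f)) x - complex.Re (g x) by case: (g x).
  have i1 x : complex.Im (fhat (hartley1 (trunc n f)) x - g x) =
      - odp (hartley1 (trunc n f)) x - complex.Im (g x) by case: (g x).
  rewrite cL2norm_L2.
  - by under eq_fun do rewrite r1; under [in X in _ + X]eq_fun do rewrite i1.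
  - by under eq_fun do rewrite r1; apply: L2B => //; exact: evp_L2.
  - by under eq_fun do rewrite i1; apply: L2B => //; apply: L2N; exact: odp_L2.
split=> [[/cL2P[rL iL]]|[rL iL rc ic]].
  under eq_fun do rewrite (E _ _ _ rL iL erefl erefl).
  move=> /fine_cvgP[_] /=; rewrite /comp /= => h.
  have := cvg_sqr h; rewrite expr0n/= => {}h.
  split => //; apply: cvg0_squeeze h => n; rewrite n2_ge0/= sqr_sqrtr ?addr_ge0 ?n2_ge0//.
    by rewrite lerDl n2_ge0.
  by rewrite lerDr n2_ge0.
split; first exact/cL2P.
under eq_fun do rewrite (E _ _ _ rL iL erefl erefl).
have := cvg0_lin2 1 1 rc ic; under eq_fun do rewrite !mul1r.
move=> h; apply: cvg_EFinR; rewrite -sqrtr0.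
by apply: continuous_cvg h; exact: sqrt_continuous.
Qed.

(** [fourier] is a choice. Since [fhat (hart f)] meets the specification, the chosen function meets
    it too, and uniqueness of L^2 limits identifies the two. *)
Lemma fourier_hart f : L2 f ->
  {ae mu, forall xi, fourier f xi = fhat (hart f) xi} /\ cL2 (fourier f).
Proof.
move=> fL; have [hL hc] := hartP fL.
have tL n := hartley1_L2 (trunc_intg n fL) (trunc_L2 n fL).
have ec : L2cvg (fun n => evp (hartley1 (trunc n f))) (evp (hart f)).
  apply: cvg0_squeeze hc => n; rewrite n2_ge0/=.
  rewrite -(n2_evp_odp (L2B (tL n) hL)); under eq_fun do rewrite evp_sub.
  by rewrite lerDl n2_ge0.
have oc : L2cvg (fun n x => - odp (hartley1 (trunc n f)) x) (fun x => - odp (hart f) x).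
  apply: cvg0_squeeze hc => n; rewrite n2_ge0/=.
  rewrite -(n2_evp_odp (L2B (tL n) hL)) -n2N; under eq_fun do rewrite opprB opprK addrC odp_sub.
  by rewrite lerDr n2_ge0.
have Hf : is_fourier f (fhat (hart f)).
  by apply/is_fourierP => //; split => //; [exact: evp_L2|apply: L2N; exact: odp_L2].
have := xgetI (fun=> 0) Hf; rewrite -/(fourier f) => Hg.
have [rL iL rc ic] := (is_fourierP _ fL).1 Hg.
split; last by case: Hg.
have e1 := L2cvg_uniq (fun n => evp_L2 (tL n)) rL (evp_L2 hL) rc ec.
have e2 := L2cvg_uniq (fun n => L2N (odp_L2 (tL n))) iL (L2N (odp_L2 hL)) ic oc.
apply: ae_imp2 _ e1 e2 => x; rewrite /fhat; case: (fourier f x) => a b /= -> ->.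
by [].
Qed.

Lemma fhat_uniq h k xi : fhat h xi = fhat k xi -> h xi = k xi.
Proof. by rewrite /fhat /evp /odp => -[]; lra. Qed.

Lemma hart_of_fourier f h : L2 f -> {ae mu, forall xi, fourier f xi = fhat h xi} ->
  ae_eqR (hart f) h.
Proof.
by move=> fL; have [e _] := fourier_hart fL; apply: ae_imp2 e => x -> /fhat_uniq.
Qed.

Lemma hart_inj f k : L2 f -> L2 k -> ae_eqR (hart f) (hart k) -> ae_eqR f k.
Proof.
move=> fL kL fk; have pi0 : 0 < 2 * pi :> R by rewrite mulr_gt0// pi_gt0.
apply: ae_imp2 (hart_ae (hart_L2 fL) (hart_L2 kL) fk)
  (_ : {ae mu, forall x, hart (hart f) x = 2 * pi * f x /\ hart (hart k) x = 2 * pi * k x}).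
  by move=> x e [e1 e2]; apply: (mulfI (lt0r_neq0 pi0)); rewrite -e1 -e2.
by apply: ae_imp2 (hartK fL) (hartK kL) => x; split.
Qed.

Lemma hart_surj h : L2 h -> exists2 f, L2 f & ae_eqR (hart f) h.
Proof.
move=> hL; exists (fun x => (2 * pi)^-1 * hart h x); first exact/L2Z/hart_L2.
apply: ae_trans (hartZ _ (hart_L2 hL)) _; apply: ae_imp (hartK hL) => x ->.
by rewrite mulKf// mulf_neq0// gt_eqF// pi_gt0.
Qed.

(** The parities say that the symbol at [- xi] is the conjugate of that at [xi], so the output is
    real. Multiplication by [i] exchanges even and odd parts, whence the reflection. [hart_surj]
    supplies a function with the required transform, so [fourier_mult] does not fall on its default
    value. *)
Lemma fourier_mult_hart (a b : R -> R) (M : R) f : msr a -> msr b ->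
  (forall x, `|a x| <= M) -> (forall x, `|b x| <= M) ->
  (forall x, a (- x) = a x) -> (forall x, b (- x) = - b x) -> L2 f ->
  L2 (fourier_mult (fun xi => a xi +i* b xi) f) /\
  ae_eqR (hart (fourier_mult (fun xi => a xi +i* b xi) f))
    (fun xi => a xi * hart f xi - b xi * hart f (- xi)).
Proof.
move=> ma mb aM bM ae bo fL; have hL := hart_L2 fL.
have kL : L2 (fun xi => a xi * hart f xi - b xi * hart f (- xi)).
  by apply: L2B; [exact: L2_mulb hL ma aM|exact: L2_mulb (L2_opp hL) mb bM].
have E xi : fhat (fun xi => a xi * hart f xi - b xi * hart f (- xi)) xi =
    (a xi +i* b xi) * fhat (hart f) xi.
  rewrite /fhat; apply/eqP; rewrite eq_complex/= /evp /odp ae bo opprK.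
  by apply/andP; split; apply/eqP; ring.
have [k kL' kh] := hart_surj kL.
have H : [set h | h \in Lfun mu 2%:E /\ {ae mu, forall xi, fourier h xi = (a xi +i* b xi) * fourier f xi}] k.
  split; first exact/Lfun_L2.
  have [e1 _] := fourier_hart kL'; have [e2 _] := fourier_hart fL.
  apply: ae_imp2 _ e2 (_ : {ae mu, forall xi, fourier k xi = fhat (hart k) xi /\
     (hart k xi = a xi * hart f xi - b xi * hart f (- xi) /\
     hart k (- xi) = a (- xi) * hart f (- xi) - b (- xi) * hart f (- - xi))}).
    by move=> xi -> [-> [k1 k2]]; rewrite -E /fhat /evp /odp k1 k2.
  by apply: ae_imp2 _ e1 (ae_imp2 (fun x => @conj _ _) kh (ae_opp kh)) => x; split.
have [/Lfun_L2 mL me] := xgetI (fun=> 0) H; rewrite -/(fourier_mult _ _) in mL me.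
split; first exact: mL.
apply: (hart_of_fourier mL).
have [e2 _] := fourier_hart fL.
by apply: ae_imp2 _ me e2 => x -> ->; rewrite E.
Qed.

(** * Sobolev norms in terms of the Hartley transform *)

Section sobolev_hart.
Variable s : R.

Definition sweight (xi : R) : R := (1 + xi ^+ 2) `^ (s / 2).

Lemma msr_sweight : msr sweight.
Proof.
apply: (msr_comp (measurable_powR _)).
by apply: msrD; [exact: msr_cst|apply: msrX; exact: msr_id].
Qed.

Lemma sobolev_norm_aux f : L2 f ->
  sobolev_norm s f = cL2norm (fun xi => (sweight xi)%:C * fourier f xi) /\
  (cL2 (fun xi => (sweight xi)%:C * fourier f xi) <-> L2 (fun xi => sweight xi * hart f xi)) /\
  (L2 (fun xi => sweight xi * hart f xi) ->
    cL2norm (fun xi => (sweight xi)%:C * fourier f xi) =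
    (Num.sqrt (n2 (fun xi => sweight xi * hart f xi)))%:E).
Proof.
move=> fL; rewrite /sobolev_norm ((Lfun_L2 f).2 fL); split => //.
have [e cf] := fourier_hart fL; have [rL iL] := (cL2P _).1 cf.
have r1 xi : complex.Re ((sweight xi)%:C * fourier f xi) = sweight xi * complex.Re (fourier f xi).
  by case: (fourier f xi) => a b /=; ring.
have i1 xi : complex.Im ((sweight xi)%:C * fourier f xi) = sweight xi * complex.Im (fourier f xi).
  by case: (fourier f xi) => a b /=; ring.
have mr := msrM msr_sweight (L2_msr rL); have mi := msrM msr_sweight (L2_msr iL).
have hL := hart_L2 fL; have mW := msrM msr_sweight (L2_msr hL).
pose Wh xi := sweight xi * hart f xi.
have er : ae_eqR (evp Wh) (fun xi => sweight xi * complex.Re (fourier f xi)).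
  by apply: ae_imp e => xi ->; rewrite /evp /Wh /sweight sqrrN /= /evp; ring.
have ei : ae_eqR (fun xi => - odp Wh xi) (fun xi => sweight xi * complex.Im (fourier f xi)).
  by apply: ae_imp e => xi ->; rewrite /odp /Wh /sweight sqrrN /= /odp; ring.
have key : L2 Wh -> L2 (fun xi => sweight xi * complex.Re (fourier f xi)) /\
                    L2 (fun xi => sweight xi * complex.Im (fourier f xi)).
  move=> WL; split; first exact: L2_ae mr er (evp_L2 WL).
  exact: L2_ae mi ei (L2N (odp_L2 WL)).
split.
  split=> [/cL2P[]|/key[rL' iL']].
    under eq_fun do rewrite r1; move=> rL'; under eq_fun do rewrite i1; move=> iL'.
    apply: L2_ae mW _ (L2B rL' iL').
    by apply: ae_imp2 _ er ei => xi <- <-; rewrite /evp /odp /Wh; field.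
  apply/cL2P; split; first by under eq_fun do rewrite r1.
  by under eq_fun do rewrite i1.
move=> WL; have [rL' iL'] := key WL.
rewrite cL2norm_L2; [|by under eq_fun do rewrite r1|by under eq_fun do rewrite i1].
under eq_fun do rewrite r1; under [in X in _ + X]eq_fun do rewrite i1.
rewrite -(n2_ae (evp_L2 WL) rL' er) -(n2_ae (L2N (odp_L2 WL)) iL' ei) n2N.
by rewrite n2_evp_odp.
Qed.

Lemma sobolev_normE f : L2 f -> L2 (fun xi => sweight xi * hart f xi) ->
  sobolev_norm s f = (Num.sqrt (n2 (fun xi => sweight xi * hart f xi)))%:E.
Proof. by move=> fL WL; have [-> [_ ->]] := sobolev_norm_aux fL. Qed.

Lemma sobolevP f : sobolev s f <-> L2 f /\ L2 (fun xi => sweight xi * hart f xi).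
Proof.
split=> [h|[fL WL]]; last by rewrite /sobolev sobolev_normE// ltry.
have fL : L2 f.
  by apply/Lfun_L2; move: h; rewrite /sobolev /sobolev_norm; case: ifP => //; rewrite ltxx.
split => //; have [E [E2 _]] := sobolev_norm_aux fL; apply/E2.
rewrite /sobolev E in h; have [_ cf] := fourier_hart fL; have [rL iL] := (cL2P _).1 cf.
split => //.
  have -> : (fun xi => complex.Re ((sweight xi)%:C * fourier f xi)) = fun xi => sweight xi * complex.Re (fourier f xi).
    by apply/funext => xi; case: (fourier f xi) => a b /=; ring.
  exact: msrM msr_sweight (L2_msr rL).
have -> : (fun xi => complex.Im ((sweight xi)%:C * fourier f xi)) = fun xi => sweight xi * complex.Im (fourier f xi).
  by apply/funext => xi; case: (fourier f xi) => a b /=; ring.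
exact: msrM msr_sweight (L2_msr iL).
Qed.

End sobolev_hart.

End fourier_hartley.

(** * The linear group *)

Section linear_flow.
Context {R : realType}.
Local Notation mu := (@lebesgue_measure R).
Implicit Types (f g G : R -> R) (s t : R).
Variable alpha : R.
Hypothesis alpha1 : 1 < alpha.
Local Notation om := (om alpha).
Local Notation weight := (weight alpha).

Definition theta t xi : R := xi * t * ((1 + 3 / 4 * `|xi| `^ alpha) / weight xi).

(** Multiplication of the Fourier transform by the phase [exp (- i theta)], read on the Hartley
    side. *)
Definition flow t G : R -> R := fun xi => cos (theta t xi) * G xi + sin (theta t xi) * G (- xi).

Lemma thetaN t xi : theta t (- xi) = - theta t xi.
Proof. by rewrite /theta /weight normrN !mulNr. Qed.

Lemma thetaD s t xi : theta (s + t) xi = theta s xi + theta t xi.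
Proof. by rewrite /theta; ring. Qed.

Lemma theta0 xi : theta 0 xi = 0.
Proof. by rewrite /theta mulr0 mul0r. Qed.

Lemma theta_le t xi : `|theta t xi| <= `|t| * `|xi|.
Proof.
rewrite /theta !normrM mulrC (mulrC `|t|) ler_piMl ?mulr_ge0//.
rewrite normfV -ler_pdivlMr ?invr_gt0 ?normr_gt0 ?gt_eqF ?weight_gt0// invrK mul1r.
have := powR_ge0 `|xi| alpha; rewrite /weight => p0; rewrite [leLHS]ger0_norm ?[leRHS]ger0_norm; lra.
Qed.

Lemma msr_theta t : msr (theta t).
Proof.
apply: msrM; first by apply: msrM; [exact: msr_id|exact: msr_cst].
apply: msrM; last by apply: msr_inv; [exact: msr_weight|move=> x; exact: weight_gt0].
by apply: msrD; [exact: msr_cst|apply: msrM; [exact: msr_cst|exact: msr_absR]].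
Qed.

Lemma msr_cos_theta t : msr (fun xi => cos (theta t xi)).
Proof. by apply: msr_comp (msr_theta t); apply: msr_cont; exact: continuous_cos. Qed.

Lemma msr_sin_theta t : msr (fun xi => sin (theta t xi)).
Proof. by apply: msr_comp (msr_theta t); apply: msr_cont; exact: continuous_sin. Qed.

Lemma cos_norm1 (x : R) : `|cos x| <= 1.
Proof. by rewrite ler_norml cos_geN1 cos_le1. Qed.

Lemma sin_norm1 (x : R) : `|sin x| <= 1.
Proof. by rewrite ler_norml sin_geN1 sin_le1. Qed.

Lemma flow_L2 t G : L2 G -> L2 (flow t G).
Proof.
move=> GL; apply: L2D.
  exact: (L2_mulb GL (msr_cos_theta t) (fun x => cos_norm1 _)).
exact: (L2_mulb (L2_opp GL) (msr_sin_theta t) (fun x => sin_norm1 _)).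
Qed.

Lemma flowD s t G : flow s (flow t G) = flow (s + t) G.
Proof.
apply/funext => xi; rewrite /flow !thetaN thetaD cosN sinN opprK cosD sinD; ring.
Qed.

Lemma flow0 G : flow 0 G = G.
Proof. by apply/funext => xi; rewrite /flow theta0 cos0 sin0 mul1r mul0r addr0. Qed.

Lemma flowK t G : flow t (flow (- t) G) = G.
Proof. by rewrite flowD subrr flow0. Qed.

Lemma flowNK t G : flow (- t) (flow t G) = G.
Proof. by rewrite flowD addNr flow0. Qed.

Lemma flowB t f g : flow t (fun xi => f xi - g xi) = fun xi => flow t f xi - flow t g xi.
Proof. by apply/funext => xi; rewrite /flow; ring. Qed.

Lemma flowZ t (a : R) f : flow t (fun xi => a * f xi) = fun xi => a * flow t f xi.
Proof. by apply/funext => xi; rewrite /flow; ring. Qed.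

Lemma flow_zero t : flow t (fun=> 0) = fun=> 0.
Proof. by apply/funext => xi; rewrite /flow !mulr0 addr0. Qed.

Lemma flow_sum t n (a : nat -> R) (F : nat -> R -> R) :
  flow t (fun xi => \sum_(k < n) a k * F k xi) = fun xi => \sum_(k < n) a k * flow t (F k) xi.
Proof.
apply/funext => xi; rewrite /flow !mulr_sumr -big_split/=; apply: eq_bigr => k _; ring.
Qed.

Lemma flow_ae t f g : ae_eqR f g -> ae_eqR (flow t f) (flow t g).
Proof. by move=> fg; apply: ae_imp2 _ fg (ae_opp fg) => xi; rewrite /flow => -> ->. Qed.

Lemma n2_flow t G : L2 G -> n2 (flow t G) = n2 G.
Proof.
move=> GL; have [_ ->] := n2_even_odd (msr_cos_theta t) (msr_sin_theta t)
  (fun x => cos_norm1 _) (fun x => sin_norm1 _)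
  (fun x => etrans (congr1 cos (thetaN t x)) (cosN _))
  (fun x => etrans (congr1 sin (thetaN t x)) (sinN _)) GL.
by rewrite /n2 ip_sqr; apply: eq_Rintegral => x _; rewrite cos2Dsin2 mul1r.
Qed.

Lemma ip_flow t f g : L2 f -> L2 g -> ip (flow t f) (flow t g) = ip f g.
Proof.
move=> fL gL; have := n2_flow t (L2B fL gL).
by rewrite flowB (n2B (flow_L2 t fL) (flow_L2 t gL)) (n2B fL gL) !n2_flow//; lra.
Qed.

(** Frequencies up to [N] are turned by an angle of at most [|t| * N]. On the others, where no
    uniform rate is available, the squared symbol is at most 4. *)
Lemma flow_near0 t N G : L2 G -> n2 (fun xi => flow t G xi - G xi) <=
  4 * n2 (fun xi => trunc N G xi - G xi) + (t * N%:R) ^+ 2 * n2 G.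
Proof.
move=> GL.
have mc : msr (fun xi => cos (theta t xi) - 1) by apply: msrB; [exact: msr_cos_theta|exact: msr_cst].
have cb x : `|cos (theta t x) - 1| <= 2.
  by have := cos_norm1 (theta t x); rewrite !ler_norml; lra.
have sb x : `|sin (theta t x)| <= 2 by have := sin_norm1 (theta t x); lra.
have [] := n2_even_odd mc (msr_sin_theta t) cb sb _ _ GL.
- by move=> x; rewrite thetaN cosN.
- by move=> x; rewrite thetaN sinN.
move=> i1 E.
have -> : (fun xi => flow t G xi - G xi) =
   (fun xi => (cos (theta t xi) - 1) * G xi + sin (theta t xi) * G (- xi)).
  by apply/funext => xi; rewrite /flow; ring.
have dL := L2B (trunc_L2 N GL) GL.
rewrite E /n2 !ip_sqr -(int_Z _ dL.2) -(int_Z _ GL.2).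
rewrite -(int_D (intgZ _ dL.2) (intgZ _ GL.2)).
apply: int_le => //; first exact: (intgD (intgZ _ dL.2) (intgZ _ GL.2)).
move=> x; have -> : (cos (theta t x) - 1) ^+ 2 + sin (theta t x) ^+ 2 = 2 - 2 * cos (theta t x).
  by have := cos2Dsin2 (theta t x); lra.
have G0 : 0 <= G x ^+ 2 by exact: sqr_ge0.
have tN0 : 0 <= (t * N%:R) ^+ 2 * G x ^+ 2 by rewrite mulr_ge0// sqr_ge0.
rewrite /trunc indicE; have [xN|xN] := boolP (x \in `[- N%:R, N%:R]%classic).
  rewrite mulr1 subrr expr0n mulr0 add0r ler_wpM2r//.
  apply: le_trans (cos_quad _) _; rewrite -(real_normK (num_real (theta _ _))) -(real_normK (num_real (_ * _))).
  rewrite lerXn2r ?nnegrE// (le_trans (theta_le t x))// normrM ler_wpM2l//.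
  by move: xN; rewrite inE/= in_itv/= (ger0_norm (ler0n _ _)) ler_norml.
rewrite mulr0 sub0r sqrrN; have := cos_geN1 (theta t x); nra.
Qed.

(** Strong continuity is uniform in [s] and [t]: by the group law and the isometry only [s - t]
    matters. *)
Lemma flow_cont G : L2 G -> forall e : R, 0 < e -> exists2 d : R, 0 < d &
  forall s t, `|s - t| < d -> n2 (fun xi => flow s G xi - flow t G xi) <= e.
Proof.
move=> GL e e0; have e8 : 0 < e / 8 by rewrite divr_gt0.
have [N NP] := (cvgn_eps _ _).1 (trunc_cvg GL) _ e8.
have := NP N (leqnn N); rewrite subr0 ger0_norm ?n2_ge0// => hN.
pose c := 2 * (N%:R ^+ 2 * n2 G + 1).
have c1 : 1 <= c.
  by have := mulr_ge0 (sqr_ge0 (N%:R : R)) (n2_ge0 G); rewrite /c; lra.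
exists (Num.min 1 (e / c)); first by rewrite lt_min ltr01/= divr_gt0//; lra.
move=> s t; rewrite lt_min => /andP[h1 h2].
have -> : (fun xi => flow s G xi - flow t G xi) = flow t (fun xi => flow (s - t) G xi - G xi).
  by rewrite flowB flowD addrC subrK.
rewrite n2_flow; last by apply: L2B => //; exact: flow_L2.
apply: le_trans (flow_near0 (s - t) N GL) _.
rewrite ltr_pdivlMr in h2; last by lra.
have h3 : (s - t) ^+ 2 <= `|s - t| by rewrite -(real_normK (num_real _)) expr2 ler_piMl// ltW.
have n0 := n2_ge0 G; have N0 : 0 <= N%:R ^+ 2 :> R by rewrite sqr_ge0.
have h4 := ler_wpM2r (mulr_ge0 N0 n0) h3.
rewrite exprMn -mulrA; move: h2; rewrite /c; have := normr_ge0 (s - t); nra.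
Qed.

Lemma sweight_om : exists2 c : R, 0 < c & forall xi : R,
  sweight (alpha / 2) xi <= c * om xi /\ om xi <= c * sweight (alpha / 2) xi.
Proof.
have a0 : 0 < alpha by exact: lt_trans alpha1.
have W0 xi : 0 < sweight (alpha / 2) xi.
  by rewrite /sweight powR_gt0// ltr_pwDl// sqr_ge0.
have Wsq (xi : R) : sweight (alpha / 2) xi ^+ 2 = (1 + xi ^+ 2) `^ (alpha / 2).
  rewrite /sweight -powR_mulrn ?powR_ge0// -powRrM; congr powR; by field.
(* The power of 2 comes from [1 + xi^2 <= 2 max (1, xi^2)], and 9/4 is [1 + 5/4]. Since [1 <= c], a
   bound by [c] on the squares is one by [c^2]. *)
pose c := 2 `^ (alpha / 2) + 9 / 4; have p0 := powR_ge0 2 (alpha / 2).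
have c1 : 1 <= c by rewrite /c; lra.
have cc : c <= c ^+ 2 by rewrite expr2 ler_peMl//; lra.
exists c => [|xi]; first by lra.
have A0 := powR_ge0 `|xi| alpha.
have abs2 : `|xi| `^ alpha = (xi ^+ 2) `^ (alpha / 2).
  rewrite -(real_normK (num_real xi)) -powR_mulrn// -powRrM; congr powR; by field.
have k1 : sweight (alpha / 2) xi ^+ 2 <= c * om xi ^+ 2.
  rewrite Wsq om_sqr// /weight; have [x1|x1] := leP (xi ^+ 2) 1.
    have : (1 + xi ^+ 2) `^ (alpha / 2) <= 2 `^ (alpha / 2).
      by rewrite ge0_ler_powR ?nnegrE ?addr_ge0 ?sqr_ge0 ?divr_ge0 ?(ltW a0)//; lra.
    by rewrite /c; nra.
  have : (1 + xi ^+ 2) `^ (alpha / 2) <= (2 * xi ^+ 2) `^ (alpha / 2).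
    by rewrite ge0_ler_powR ?nnegrE ?divr_ge0 ?(ltW a0)//; lra.
  by rewrite powRM ?sqr_ge0// -abs2 /c; nra.
have k2 : om xi ^+ 2 <= c * sweight (alpha / 2) xi ^+ 2.
  rewrite Wsq om_sqr// /weight abs2.
  have x2 : 0 <= xi ^+ 2 by exact: sqr_ge0.
  have q1 : (xi ^+ 2) `^ (alpha / 2) <= (1 + xi ^+ 2) `^ (alpha / 2).
    by rewrite ge0_ler_powR ?nnegrE ?addr_ge0 ?divr_ge0 ?(ltW a0)//; lra.
  have q2 : 1 <= (1 + xi ^+ 2) `^ (alpha / 2).
    have : 1 `^ (alpha / 2) <= (1 + xi ^+ 2) `^ (alpha / 2).
      by rewrite ge0_ler_powR ?nnegrE ?addr_ge0 ?divr_ge0 ?(ltW a0)//; lra.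
    by rewrite powR1.
  by rewrite /c; nra.
have o0 := om_gt0 alpha xi; have w0 := W0 xi.
split; rewrite -(ler_pXn2r (n := 2)) ?nnegrE ?mulr_ge0 ?(ltW o0) ?(ltW w0)//; try lra.
  by rewrite exprMn (le_trans k1)// ler_wpM2r// sqr_ge0.
by rewrite exprMn (le_trans k2)// ler_wpM2r// sqr_ge0.
Qed.

(* The state attached to a function; its L^2 norm is equivalent to the
   H^(alpha/2) norm and is conserved by the equation. *)
Definition st f : R -> R := fun xi => om xi * hart f xi.

Lemma msr_st f : L2 f -> msr (st f).
Proof. by move=> fL; apply: msrM; [exact: msr_om|exact: L2_msr (hart_L2 fL)]. Qed.

Lemma sobolev_st f : sobolev (alpha / 2) f <-> L2 f /\ L2 (st f).
Proof.
have [c c0 cP] := sweight_om; split=> [/sobolevP[fL WL]|[fL sL]].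
  split => //; apply: L2_le (msr_st fL) (L2Z c WL) _ => x.
  have [_ h] := cP x; rewrite /st mulrA !normrM ler_wpM2r//.
  by rewrite gtr0_norm ?om_gt0// (le_trans h)// -normrM ler_norm.
apply/sobolevP; split => //; apply: L2_le (L2Z c sL) _ => [|x].
  by apply: msrM; [exact: msr_sweight|exact: L2_msr (hart_L2 fL)].
have [h _] := cP x; rewrite /st mulrA !normrM ler_wpM2r//.
by rewrite ger0_norm ?powR_ge0// (le_trans h)// -normrM ler_norm.
Qed.

Lemma sobolev_norm_st : exists2 c : R, 0 < c & forall f, L2 f -> L2 (st f) ->
  exists2 r : R, 0 <= r & [/\ sobolev_norm (alpha / 2) f = r%:E,
    r <= c * Num.sqrt (n2 (st f)) & Num.sqrt (n2 (st f)) <= c * r].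
Proof.
have [c c0 cP] := sweight_om; exists c => // f fL sL.
have [_ WL] := (sobolevP (alpha / 2) f).1 ((sobolev_st f).2 (conj fL sL)).
have key (a b : R -> R) : L2 a -> L2 b -> (forall x, `|a x| <= c * `|b x|) ->
    Num.sqrt (n2 a) <= c * Num.sqrt (n2 b).
  move=> aL bL ab; rewrite -[c in leRHS](ger0_norm (ltW c0)) -sqrtr_sqr -sqrtrM ?sqr_ge0//.
  rewrite ler_wsqrtr// -n2Z// /n2 !ip_sqr; apply: int_le; [exact: aL.2|exact: (L2Z c bL).2|].
  move=> x; rewrite -(real_normK (num_real (a x))) -(real_normK (num_real (c * b x))).
  by rewrite lerXn2r ?nnegrE// normrM (gtr0_norm c0).
exists (Num.sqrt (n2 (fun xi => sweight (alpha / 2) xi * hart f xi))); first exact: sqrtr_ge0.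
split; first exact: sobolev_normE.
  apply: key => // x; have [h _] := cP x; rewrite /st !normrM mulrA ler_wpM2r//.
  by rewrite ger0_norm ?powR_ge0// gtr0_norm// om_gt0.
apply: key => // x; have [_ h] := cP x; rewrite /st !normrM mulrA ler_wpM2r//.
by rewrite gtr0_norm ?om_gt0// ger0_norm// powR_ge0.
Qed.

Lemma st_ae f g : L2 f -> L2 g -> ae_eqR f g -> ae_eqR (st f) (st g).
Proof. by move=> fL gL fg; apply: ae_imp (hart_ae fL gL fg) => xi; rewrite /st => ->. Qed.

Lemma st_inj f g : L2 f -> L2 g -> ae_eqR (st f) (st g) -> ae_eqR f g.
Proof.
move=> fL gL fg; apply: hart_inj => //; apply: ae_imp fg => xi /mulfI; apply.
exact: om_neq0.
Qed.

Lemma st_lin (a b : R) f g : L2 f -> L2 g ->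
  ae_eqR (st (fun x => a * f x + b * g x)) (fun xi => a * st f xi + b * st g xi).
Proof.
move=> fL gL; apply: ae_imp2 _ (hartD (L2Z a fL) (L2Z b gL))
  (_ : {ae mu, forall x, hart (fun y => a * f y) x = a * hart f x /\ hart (fun y => b * g y) x = b * hart g x}).
  by move=> xi; rewrite /st => -> [-> ->]; move: (hart f xi) (hart g xi) (om xi) => u v w; ring.
by apply: ae_imp2 _ (hartZ a fL) (hartZ b gL) => x; split.
Qed.

Lemma st_sum n (a : nat -> R) (F : nat -> R -> R) : (forall k, L2 (F k)) ->
  L2 (fun x => \sum_(k < n) a k * F k x) /\
  ae_eqR (st (fun x => \sum_(k < n) a k * F k x)) (fun xi => \sum_(k < n) a k * st (F k) xi).
Proof.
move=> FL; elim: n => [|n [ihL ih]].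
  have E (G : nat -> R -> R) : (fun x => \sum_(k < 0) a k * G k x) = fun=> 0.
    by apply/funext => x; rewrite big_ord0.
  rewrite !E; split; first exact: L20.
  have E0 : (fun=> 0 * 0 + 0 * 0 : R) = (fun=> 0) :> (R -> R).
    by apply/funext => x; rewrite mul0r addr0.
  have := st_lin 0 0 L20 L20; rewrite E0; apply: ae_imp => x ->.
  by rewrite big_ord0 !mul0r addr0.
have E (G : nat -> R -> R) : (fun x => \sum_(k < n.+1) a k * G k x) =
    fun x => 1 * \sum_(k < n) a k * G k x + a n * G n x.
  by apply/funext => x; rewrite big_ord_recr mul1r.
rewrite E (E (fun k => st (F k))); split; first by apply: L2D; apply: L2Z.
by apply: ae_imp2 _ (st_lin 1 (a n) ihL (FL n)) ih => x -> ->.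
Qed.

Lemma st_syn G : L2 G -> ae_eqR (st (syn alpha G)) G.
Proof.
move=> GL; apply: ae_imp (hart_syn alpha1 GL) => xi; rewrite /st => ->.
by rewrite mulrA mulfV ?mul1r// om_neq0.
Qed.

Lemma syn_st f : L2 f -> L2 (st f) -> ae_eqR (syn alpha (st f)) f.
Proof. by move=> fL sL; apply: st_inj => //; [exact: syn_L2|exact: st_syn]. Qed.

Lemma syn_ae G G' : L2 G -> L2 G' -> ae_eqR G G' -> syn alpha G = syn alpha G'.
Proof.
move=> GL GL' e; apply/funext => x; rewrite /syn /hartley1; congr (_ * _).
apply: int_ae; [exact: (intg_msr (intg_cas x (omV_mul_intg alpha1 GL)))|
  exact: (intg_msr (intg_cas x (omV_mul_intg alpha1 GL')))|].
by apply: ae_imp e => y ->.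
Qed.

Lemma propagator_st t f : L2 f -> L2 (st f) ->
  [/\ L2 (propagator alpha t f), L2 (st (propagator alpha t f)) &
   ae_eqR (st (propagator alpha t f)) (flow t (st f))].
Proof.
move=> fL sL; have mN (k : R -> R) : msr k -> msr (fun xi => - k xi) by exact: msrN.
have m1 : msr (fun xi => cos (- theta t xi)).
  by apply: msr_comp (mN _ (msr_theta t)); apply: msr_cont; exact: continuous_cos.
have m2 : msr (fun xi => sin (- theta t xi)).
  by apply: msr_comp (mN _ (msr_theta t)); apply: msr_cont; exact: continuous_sin.
have e1 x : cos (- theta t (- x)) = cos (- theta t x) by rewrite thetaN opprK cosN.
have e2 x : sin (- theta t (- x)) = - sin (- theta t x) by rewrite thetaN opprK sinN opprK.
have [pL ph] := fourier_mult_hart m1 m2 (fun x => cos_norm1 _) (fun x => sin_norm1 _) e1 e2 fL.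
have e : ae_eqR (st (propagator alpha t f)) (flow t (st f)).
  apply: ae_imp ph => xi h; rewrite /st /flow omN [hart _ xi]h cosN sinN; ring.
have sL' := L2_ae (msr_st pL) (ae_sym e) (flow_L2 t sL).
by split; [exact: pL|exact: sL'|exact: e].
Qed.

Lemma smoothed_st f : L2 f -> L2 (smoothed_dx alpha f) /\
  ae_eqR (st (smoothed_dx alpha f)) (fun xi => - (xi / om xi * hart f (- xi))).
Proof.
move=> fL.
have mb : msr (fun xi => xi / weight xi).
  by apply: msrM; [exact: msr_id|apply: msr_inv; [exact: msr_weight|move=> x; exact: weight_gt0]].
have b1 (x : R) : `|x / weight x| <= 1.
  rewrite normrM normfV (gtr0_norm (weight_gt0 _ _)) ler_pdivrMr ?weight_gt0// mul1r.
  have [x1|x1] := leP 1 `|x|; last by rewrite (le_trans (ltW x1))// weight_ge1.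
  have := le1r_powR x1 (ltW alpha1); rewrite /weight; have := powR_ge0 `|x| alpha; lra.
have z1 (x : R) : `|0 : R| <= 1 by rewrite normr0.
have od (x : R) : - x / weight (- x) = - (x / weight x) by rewrite /weight normrN mulNr.
have [pL ph] := fourier_mult_hart (msr_cst 0) mb z1 b1 (fun=> erefl) od fL.
split; first exact: pL.
apply: ae_imp ph => xi h; rewrite /st [hart _ xi]h mul0r sub0r mulrN -(om_sqr alpha).
by congr (- _); move: (om_neq0 alpha xi) (hart f (- xi)) => o a; field.
Qed.

Variable p : nat.
Local Notation nonlin := (nonlin alpha p).

Lemma pow_L2 f : L2 f -> L2 (st f) -> L2 (fun x => f x ^+ p.+1).
Proof.
move=> fL sL; apply: L2_ae (pow_syn_L2 alpha1 p sL); first exact: msrX (L2_msr fL).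
by apply: ae_imp (syn_st fL sL) => x ->.
Qed.

(** The factor -2 undoes the -1/2 of Duhamel's formula, which [nonlin] already contains. *)
Lemma duhamel_st t f : L2 f -> L2 (st f) ->
  L2 (propagator alpha t (smoothed_dx alpha (fun x => f x ^+ p.+1))) /\
  ae_eqR (st (propagator alpha t (smoothed_dx alpha (fun x => f x ^+ p.+1))))
    (fun xi => - 2 * flow t (nonlin (st f)) xi).
Proof.
move=> fL sL; have pL := pow_L2 fL sL; have [mL me] := smoothed_st pL.
have e : ae_eqR (st (smoothed_dx alpha (fun x => f x ^+ p.+1))) (fun xi => - 2 * nonlin (st f) xi).
  have h : ae_eqR (hart (fun x => f x ^+ p.+1)) (hart (fun x => syn alpha (st f) x ^+ p.+1)).
    apply: hart_ae => //; first exact: pow_syn_L2.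
    by apply: ae_imp (syn_st fL sL) => x ->.
  apply: ae_imp2 _ me (ae_opp h) => xi -> ->; rewrite /nonlin.
  by move: (hart _ _) (xi / om xi) => a b; field.
have NL := nonlin_L2 alpha1 p sL.
have [qL _ qe] := propagator_st t mL (L2_ae (msr_st mL) (ae_sym e) (L2Z (- 2) NL)).
split => //; apply: ae_trans qe _; apply: ae_trans (flow_ae t e) _.
by rewrite flowZ; exact: ae_refl.
Qed.

End linear_flow.

(** * The equation in the interaction picture *)

Section state_space.
Context {R : realType}.
Local Notation mu := (@lebesgue_measure R).
Implicit Types (f g G : R -> R).

(** Its elements are functions, not classes modulo null sets, so [Bv] below is only semidefinite. *)
Definition V2 := LfunType mu (lee1n 2).

Definition vl (v : V2) : R -> R := v.

Lemma vl_L2 v : L2 (vl v).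
Proof. by apply/Lfun_L2; exact: LfunP. Qed.

Definition toV f : V2 :=
  if pselect (f \in Lfun mu 2%:E) is left fL then Lfun_Sub (lee1n 2) fL else 0.

Lemma toVE f : L2 f -> vl (toV f) = f.
Proof. by move=> /Lfun_L2 fL; rewrite /toV; case: pselect. Qed.

Lemma vlD v w : vl (v + w) = fun x => vl v x + vl w x.
Proof. by []. Qed.

Lemma vlZ (a : R) v : vl (a *: v) = fun x => a * vl v x.
Proof. by []. Qed.

Lemma vlB v w : vl (v - w) = fun x => vl v x - vl w x.
Proof. by []. Qed.

Lemma vl0 : vl 0 = fun=> 0.
Proof. by []. Qed.

Lemma toVB f g : L2 f -> L2 g -> vl (toV f - toV g) = fun x => f x - g x.
Proof. by move=> fL gL; rewrite vlB !toVE. Qed.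

Lemma vl_sum n (a : nat -> R) (F : nat -> V2) :
  vl (\sum_(k < n) a k *: F k) = fun x => \sum_(k < n) a k * vl (F k) x.
Proof.
elim: n => [|n ih]; first by apply/funext => x; rewrite !big_ord0.
by rewrite big_ord_recr vlD vlZ ih; apply/funext => x; rewrite big_ord_recr.
Qed.

Definition Bv v w := ip (vl v) (vl w).

Lemma BvC v w : Bv v w = Bv w v. Proof. exact: ipC. Qed.

Lemma BvDl u v w : Bv (u + v) w = Bv u w + Bv v w.
Proof. by rewrite /Bv vlD ipDl//; exact: vl_L2. Qed.

Lemma BvZl (a : R) v w : Bv (a *: v) w = a * Bv v w.
Proof. by rewrite /Bv vlZ ipZl//; exact: vl_L2. Qed.

Lemma Bv_ge0 v : 0 <= Bv v v. Proof. exact: ip_ge0. Qed.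

Lemma nrmE v : nrm Bv v = Num.sqrt (n2 (vl v)). Proof. by []. Qed.

Lemma Bv_complete (u : nat -> V2) :
  (forall e : R, 0 < e -> exists N, forall m n, (N <= m)%N -> (N <= n)%N -> nrm Bv (u m - u n) <= e) ->
  exists l, forall e : R, 0 < e -> exists N, forall n, (N <= n)%N -> nrm Bv (u n - l) <= e.
Proof.
move=> uC; have [|g gL gP] := L2_complete (fun n => vl_L2 (u n)).
  move=> e e0; have s0 : 0 < Num.sqrt e by rewrite sqrtr_gt0.
  have [N NP] := uC _ s0; exists N => m n Nm Nn.
  by have := NP m n Nm Nn; rewrite nrmE ler_sqrt// ltW.
exists (toV g) => e e0; have [N NP] := gP _ (exprn_gt0 2 e0); exists N => n Nn.
rewrite nrmE vlB toVE// n2_sym -[leRHS](ger0_norm (ltW e0)) -sqrtr_sqr ler_wsqrtr//.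
exact: NP.
Qed.

Variable alpha : R.
Hypothesis alpha1 : 1 < alpha.
Variable p : nat.
Local Notation flow := (flow alpha).
Local Notation nonlin := (nonlin alpha p).
Local Notation st := (st alpha).

(* The nonlinearity in the interaction picture. *)
Definition Phi (t : R) (v : V2) : V2 := toV (flow (- t) (nonlin (flow t (vl v)))).

Lemma Phi_aux_L2 t v : L2 (nonlin (flow t (vl v))).
Proof. by apply: nonlin_L2 => //; apply: flow_L2; exact: vl_L2. Qed.

Lemma vl_Phi t v : vl (Phi t v) = flow (- t) (nonlin (flow t (vl v))).
Proof. by rewrite /Phi toVE//; apply: flow_L2; exact: Phi_aux_L2. Qed.

Lemma vl_PhiB s t v w : vl (Phi s v - Phi t w) =
  fun xi => flow (- s) (nonlin (flow s (vl v))) xi - flow (- t) (nonlin (flow t (vl w))) xi.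
Proof.
have NL r u := flow_L2 alpha (- r) (Phi_aux_L2 r u).
exact: (toVB (NL s v) (NL t w)).
Qed.

Lemma n2_PhiB t v w : n2 (vl (Phi t v - Phi t w)) =
  n2 (fun xi => nonlin (flow t (vl v)) xi - nonlin (flow t (vl w)) xi).
Proof.
have dL := L2B (Phi_aux_L2 t v) (Phi_aux_L2 t w).
by rewrite vl_PhiB -(flowB alpha (- t)) (n2_flow _ _ dL).
Qed.

Lemma nrm_le_sqr (v : V2) (K : R) : nrm Bv v <= K -> n2 (vl v) <= K ^+ 2.
Proof.
move=> h; have K0 := le_trans (nrm_ge0 _ _) h.
by rewrite -(sqr_sqrtr (n2_ge0 (vl v))) lerXn2r ?nnegrE ?sqrtr_ge0.
Qed.

Lemma Phi_lip (K : R) : 0 < K -> exists2 L : R, 0 < L & forall t v w, 0 <= t ->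
  nrm Bv v <= K -> nrm Bv w <= K -> nrm Bv (Phi t v - Phi t w) <= L * nrm Bv (v - w).
Proof.
move=> K0; have [C C0 CP] := nonlin_lip alpha1 p K0.
have L0 : 0 < Num.sqrt C + 1 by rewrite ltr_wpDl ?sqrtr_ge0.
exists (Num.sqrt C + 1) => // t v w _ vK wK.
apply: le_trans (_ : Num.sqrt C * nrm Bv (v - w) <= _); last first.
  by rewrite ler_wpM2r ?nrm_ge0// lerDl.
rewrite !nrmE n2_PhiB -sqrtrM// ler_wsqrtr//.
have vL := vl_L2 v; have wL := vl_L2 w.
have vK' : n2 (flow t (vl v)) <= K ^+ 2 by rewrite n2_flow//; exact: nrm_le_sqr.
have wK' : n2 (flow t (vl w)) <= K ^+ 2 by rewrite n2_flow//; exact: nrm_le_sqr.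
apply: le_trans (CP _ _ (flow_L2 alpha t vL) (flow_L2 alpha t wL) vK' wK') _.
by rewrite -flowB (n2_flow _ _ (L2B vL wL)).
Qed.

Lemma Phi0 t : 0 <= t -> nrm Bv (Phi t 0) = 0.
Proof.
move=> _; rewrite nrmE vl_Phi n2_flow//; last exact: Phi_aux_L2.
by rewrite vl0 flow_zero nonlin0// sqrtr0.
Qed.

Lemma Phi_ip0 t v : 0 <= t -> Bv v (Phi t v) = 0.
Proof.
move=> _; have vL := vl_L2 v; have NL := Phi_aux_L2 t v.
rewrite /Bv vl_Phi -(ip_flow alpha t vL (flow_L2 alpha (- t) NL)) flowK.
by apply: nonlin_ip0 => //; exact: flow_L2.
Qed.

Lemma flow_cont_sqrt G : L2 G -> forall e : R, 0 < e -> exists2 d : R, 0 < d &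
  forall s t, `|s - t| < d -> Num.sqrt (n2 (fun xi => flow s G xi - flow t G xi)) <= e.
Proof.
move=> GL e e0; have [d d0 dP] := flow_cont alpha GL (exprn_gt0 2 e0).
exists d => // s t st; rewrite -[leRHS](ger0_norm (ltW e0)) -sqrtr_sqr ler_wsqrtr//.
exact: dP.
Qed.

Lemma sqrt_n2D f g : L2 f -> L2 g ->
  Num.sqrt (n2 (fun x => f x + g x)) <= Num.sqrt (n2 f) + Num.sqrt (n2 g).
Proof.
move=> fL gL; have := nrmD BvC BvDl BvZl Bv_ge0 (toV f) (toV g).
by rewrite !nrmE vlD !toVE.
Qed.

(** Time enters twice. The inner flow is handled by the Lipschitz bound on [nonlin], the outer one
    by strong continuity at the fixed vector [nonlin (flow t v)]. *)
Lemma Phi_cont v : cont Bv (Phi ^~ v).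
Proof.
have vL := vl_L2 v; have rL t := flow_L2 alpha t vL.
move=> t t0 e e0; have K0 : 0 < nrm Bv v + 1 by rewrite ltr_wpDl ?nrm_ge0.
have [C C0 CP] := nonlin_lip alpha1 p K0.
have e2 : 0 < e / 2 by rewrite divr_gt0.
have ec : 0 < e / 2 / (Num.sqrt C + 1) by rewrite divr_gt0// ltr_wpDl ?sqrtr_ge0.
have NL := Phi_aux_L2 t v.
have [d1 d10 P1] := flow_cont_sqrt vL ec; have [d2 d20 P2] := flow_cont_sqrt NL e2.
exists (Num.min d1 d2) => [|s s0]; first by rewrite lt_min d10.
rewrite lt_min => /andP[h1 h2].
have NLs := Phi_aux_L2 s v; have dL := L2B NLs NL.
have E : vl (Phi s v - Phi t v) = fun xi =>
   flow (- s) (fun xi => nonlin (flow s (vl v)) xi - nonlin (flow t (vl v)) xi) xi +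
   (flow (- s) (nonlin (flow t (vl v))) xi - flow (- t) (nonlin (flow t (vl v))) xi).
  rewrite vl_PhiB (flowB alpha (- s)).
  apply/funext => xi.
  by rewrite addrA subrK.
rewrite nrmE E; apply: le_trans (sqrt_n2D (flow_L2 alpha _ dL) _) _.
  by apply: L2B; exact: flow_L2.
have k2 : Num.sqrt (n2 (fun xi => flow (- s) (nonlin (flow t (vl v))) xi -
    flow (- t) (nonlin (flow t (vl v))) xi)) <= e / 2.
  by apply: P2; rewrite opprK addrC distrC.
have k1 : Num.sqrt (n2 (flow (- s) (fun xi => nonlin (flow s (vl v)) xi - nonlin (flow t (vl v)) xi))) <= e / 2.
  rewrite n2_flow//.
  have vK r : n2 (flow r (vl v)) <= (nrm Bv v + 1) ^+ 2.
    by rewrite n2_flow//; apply: nrm_le_sqr; rewrite lerDl.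
  apply: le_trans (ler_wsqrtr (CP _ _ (rL s) (rL t) (vK s) (vK t))) _.
  rewrite sqrtrM//; have := P1 s t h1; rewrite ler_pdivlMr; last by rewrite ltr_wpDl ?sqrtr_ge0.
  apply: le_trans; rewrite mulrC ler_wpM2l ?sqrtr_ge0// lerDl//.
lra.
Qed.

Definition intpic (f : R -> R -> R) (t : R) : V2 := toV (flow (- t) (st (f t))).

Lemma vl_intpic (f : R -> R -> R) t : L2 (st (f t)) -> vl (intpic f t) = flow (- t) (st (f t)).
Proof. by move=> sL; rewrite /intpic toVE//; exact: flow_L2. Qed.

Lemma flow_intpic (f : R -> R -> R) t : L2 (st (f t)) -> flow t (vl (intpic f t)) = st (f t).
Proof. by move=> sL; rewrite vl_intpic// flowK. Qed.

Lemma ae_sum n (a : nat -> R) (F H : nat -> R -> R) :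
  (forall k, (k < n)%N -> ae_eqR (F k) (H k)) ->
  ae_eqR (fun x => \sum_(k < n) a k * F k x) (fun x => \sum_(k < n) a k * H k x).
Proof.
elim: n => [|n ih] FH; first by apply: aeW => x; rewrite !big_ord0.
apply: ae_imp2 _ (ih (fun k kn => FH k (ltnW kn))) (FH n (ltnSn n)) => x e1 e2.
by rewrite !big_ord_recr /= e1 e2.
Qed.

(** The bridge between the two kinds of Riemann sums. [D] is the Sobolev error when Duhamel's
    formula is solved for its integral, [J = 2 (S(t) u0 - g)]. By the group law its state is
    [- 2 * flow t] of the error in the interaction picture, and isometry leaves the factor 4. *)
Lemma duhamel_sum t n (w c : nat -> R) (f : R -> R -> R) g u0 :
  (forall k, (k < n)%N -> L2 (f (c k)) /\ L2 (st (f (c k)))) ->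
  L2 g -> L2 (st g) -> L2 u0 -> L2 (st u0) ->
  let D x := \sum_(k < n) w k * propagator alpha (t - c k) (smoothed_dx alpha (fun x => f (c k) x ^+ p.+1)) x
     - 2 * (propagator alpha t u0 x - g x) in
  [/\ L2 D, L2 (st D) & n2 (st D) = 4 * n2 (vl (\sum_(k < n) w k *: Phi (c k) (intpic f (c k)) -
     (toV (flow (- t) (st g)) - toV (st u0))))].
Proof.
move=> fL gL sgL uL suL D.
pose N k := propagator alpha (t - c k) (smoothed_dx alpha (fun x => f (c k) x ^+ p.+1)).
(* The hypotheses concern only [k < n], while [st_sum] asks for L^2 functions at every index. *)
pose F k := if (k < n)%N then N k else fun=> 0.
have FE k : (k < n)%N -> F k = N k by rewrite /F => ->.
have DE : D = fun x => 1 * (\sum_(k < n) w k * F k x) + - 2 * (1 * propagator alpha t u0 x + -1 * g x).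
  apply/funext => x; rewrite /D mul1r mulNr !mul1r mulN1r; congr (_ - _).
  by apply: eq_bigr => k _; rewrite FE.
have FL k : L2 (F k).
  have [kn|kn] := boolP (k < n)%N; last by rewrite /F (negbTE kn); exact: L20.
  have [h1 h2] := fL k kn; rewrite FE//; exact: (duhamel_st alpha1 p (t - c k) h1 h2).1.
have [pL psL pe] := propagator_st t uL suL.
have [SL Se] := st_sum alpha n w FL.
have qL : L2 (fun x => 1 * propagator alpha t u0 x + -1 * g x) by exact: L2D (L2Z 1 pL) (L2Z (-1) gL).
have DL : L2 D by rewrite DE; exact: L2D (L2Z 1 SL) (L2Z (-2) qL).
pose Y k := vl (Phi (c k) (intpic f (c k))).
set X := (X in n2 (vl X)).
have XE : flow t (vl X) = fun xi => \sum_(k < n) w k * flow t (Y k) xi - (st g xi - flow t (st u0) xi).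
  have -> : vl X = fun xi => (fun xi => \sum_(k < n) w k * Y k xi) xi -
      (fun xi => flow (- t) (st g) xi - st u0 xi) xi.
    have e3 := vl_sum n w (fun k => Phi (c k) (intpic f (c k))).
    have e4 := toVB (flow_L2 alpha (- t) sgL) suL.
    apply/funext => xi.
    rewrite -[LHS]/(vl (\sum_(k < n) w k *: Phi (c k) (intpic f (c k))) xi -
      vl (toV (flow (- t) (st g)) - toV (st u0)) xi).
    by rewrite e3 e4.
  by rewrite flowB flow_sum flowB flowK.
have e1 : ae_eqR (fun xi => \sum_(k < n) w k * st (F k) xi)
    (fun xi => \sum_(k < n) w k * (- 2 * flow t (Y k) xi)).
  apply: (@ae_sum n w (fun k => st (F k)) (fun k xi => - 2 * flow t (Y k) xi)) => k kn; rewrite FE//; have [h1 h2] := fL k kn.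
  have [_] := duhamel_st alpha1 p (t - c k) h1 h2.
  by rewrite /Y vl_Phi flow_intpic// flowD.
have e2 := ae_trans Se e1.
have E : ae_eqR (st D) (fun xi => - 2 * flow t (vl X) xi).
  rewrite DE; apply: ae_trans (st_lin alpha 1 (-2) SL qL) _.
  have e3 : ae_eqR (st (fun x => 1 * propagator alpha t u0 x + -1 * g x))
      (fun xi => flow t (st u0) xi - st g xi).
    by apply: ae_imp2 _ (st_lin alpha 1 (-1) pL gL) pe => xi -> ->; rewrite mul1r mulN1r.
  apply: ae_imp2 _ e2 e3 => xi -> ->; rewrite XE.
  have -> : \sum_(k < n) w k * (- 2 * flow t (Y k) xi) = - 2 * \sum_(k < n) w k * flow t (Y k) xi.
    by rewrite mulr_sumr; apply: eq_bigr => k _; ring.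
  by move: (bigop _ _ _) (flow t _ xi) (st g xi) => a b d; ring.
have rL := flow_L2 alpha t (vl_L2 X).
have sDL := L2_ae (msr_st alpha DL) (ae_sym E) (L2Z (- 2) rL).
split; [exact: DL|exact: sDL|].
rewrite (n2_ae sDL (L2Z (- 2) rL) E) (n2Z _ rL) (n2_flow _ _ (vl_L2 X)).
by congr (_ * _); ring.
Qed.

End state_space.

(** * Solutions of the Cauchy problem as integral curves in L^2 *)

Section global_solution.
Context {R : realType}.
Local Notation mu := (@lebesgue_measure R).
Variable alpha : R.
Hypothesis alpha1 : 1 < alpha.
Variable p : nat.
Local Notation flow := (flow alpha).
Local Notation st := (st alpha).
Local Notation Phi := (Phi alpha p).
Local Notation intpic := (intpic alpha).
Implicit Types (f w : R -> R -> R) (g : R -> R).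

Definition inS g := L2 g /\ L2 (st g).

Lemma partition_itv n (d c : nat -> R) (t r : R) : d 0%N = 0 -> d n = t ->
  (forall k, (k < n)%N -> [/\ d k <= c k, c k <= d k.+1 & d k.+1 - d k < r]) ->
  forall k, (k < n)%N -> 0 <= c k <= t.
Proof.
move=> d0 dn H.
have mono j k : (j <= k)%N -> (k <= n)%N -> d j <= d k.
  elim: k => [|k ih]; first by rewrite leqn0 => /eqP ->.
  rewrite leq_eqVlt => /predU1P[->//|]; rewrite ltnS => jk kn.
  by have [h1 h2 _] := H k kn; have := ih jk (ltnW kn); lra.
move=> k kn; have [h1 h2 _] := H k kn.
have := mono 0%N k (leq0n k) (ltnW kn); have := mono k.+1 n kn (leqnn n).
by rewrite d0 dn; lra.
Qed.

Lemma sqrt4 (X : R) : Num.sqrt (4 * X) = 2 * Num.sqrt X.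
Proof.
rewrite sqrtrM// (_ : 4 = 2 ^+ 2) ?sqrtr_sqr ?ger0_norm//; ring.
Qed.

Lemma integral_riem f t u0 J : (forall s, 0 <= s <= t -> inS (f s)) -> inS u0 -> 0 <= t ->
  ae_eqR (f t) (fun x => propagator alpha t u0 x - 1 / 2 * J x) ->
  is_sobolev_integral (alpha / 2) (fun tau => propagator alpha (t - tau)
     (smoothed_dx alpha (fun x => f tau x ^+ p.+1))) 0 t J ->
  riem (@Bv R) (fun tau => Phi tau (intpic f tau)) 0 t (intpic f t - toV (st u0)).
Proof.
move=> fS [uL suL] t0 fJ HJ e e0.
have [c c0 cP] := sobolev_norm_st alpha1.
have [delta delta0 dP] := HJ (e / c) (divr_gt0 e0 c0); exists delta => // n d k d0 dn H.
have := dP n d k d0 dn H; set D' := fun x => _ => hD.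
have [D'L sD'L] := (sobolev_st alpha1 D').1 (lt_trans hD (ltry _)).
have kS j : (j < n)%N -> inS (f (k j)) by move=> jn; apply: fS; exact: partition_itv d0 dn H j jn.
have [|ftL sftL] := fS t; first by rewrite t0 lexx.
have [DL sDL E] := duhamel_sum alpha1 p t (fun j => d j.+1 - d j) kS ftL sftL uL suL.
set D := fun x => _ in DL sDL E.
have DD : ae_eqR D' D.
  apply: ae_imp fJ => x h; rewrite /D' /D h; congr (_ - _).
  by move: (propagator _ _ _ _) (J x) => a b; field.
have e2 : n2 (st D') = n2 (st D) := n2_ae sD'L sDL (st_ae alpha D'L DL DD).
have [r r0 [h1 _ h3]] := cP _ D'L sD'L.
have {}hD : r < e / c by rewrite -lte_fin -h1.
rewrite (ltr_pdivlMr _ _ c0) in hD.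
rewrite e2 E sqrt4 in h3.
have hX (Y : R) : 0 <= Y -> 2 * Y <= c * r -> Y <= e by clear - hD; lra.
exact: (hX _ (sqrtr_ge0 _) h3).
Qed.

Lemma riem_integral f t u0 : (forall s, 0 <= s <= t -> inS (f s)) -> inS u0 -> 0 <= t ->
  riem (@Bv R) (fun tau => Phi tau (intpic f tau)) 0 t (intpic f t - toV (st u0)) ->
  is_sobolev_integral (alpha / 2) (fun tau => propagator alpha (t - tau)
     (smoothed_dx alpha (fun x => f tau x ^+ p.+1))) 0 t (fun x => 2 * (propagator alpha t u0 x - f t x)).
Proof.
move=> fS [uL suL] t0 HR e e0.
have [c c0 cP] := sobolev_norm_st alpha1.
(* The norm comparison costs [2 * c]; the extra factor 2 gives the strict inequality of
   [is_sobolev_integral]. *)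
have ec : 0 < e / (4 * c) by rewrite divr_gt0// mulr_gt0.
have [delta delta0 dP] := HR _ ec; exists delta => // n d k d0 dn H.
have := dP n d k d0 dn H => hX.
have kS j : (j < n)%N -> inS (f (k j)) by move=> jn; apply: fS; exact: partition_itv d0 dn H j jn.
have [|ftL sftL] := fS t; first by rewrite t0 lexx.
have [DL sDL E] := duhamel_sum alpha1 p t (fun j => d j.+1 - d j) kS ftL sftL uL suL.
have [r r0 [h1 h2 _]] := cP _ DL sDL; rewrite h1 lte_fin.
rewrite E sqrt4 in h2.
rewrite ler_pdivlMr ?mulr_gt0// in hX.
have hY (Y : R) : Y * (4 * c) <= e -> r <= c * (2 * Y) -> r < e.
  by clear - e0; lra.
exact: (hY _ hX h2).
Qed.

Lemma cvg_within_ereal (D : set R) (F : R -> \bar R) (t : R) (G : R -> R) :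
  (forall s, D s -> F s = (G s)%:E) -> (forall s, D s -> 0 <= G s) ->
  F @ within D (nbhs t) --> 0%E <->
  forall e : R, 0 < e -> exists2 d : R, 0 < d & forall s, D s -> `|s - t| < d -> G s <= e.
Proof.
move=> FG G0; split=> [h e e0|h].
  have /fine_cvgP[_ /cvgrPdist_le /(_ e e0)] := h.
  rewrite near_withinE => /nbhs_ballP[d /= d0 dP]; exists d => // s Ds sd.
  have := dP s; rewrite -ball_normE /= distrC => /(_ sd Ds).
  by rewrite FG//= sub0r normrN ger0_norm ?G0.
apply/fine_cvgP; split.
  by rewrite near_withinE; apply: nearW => s Ds; rewrite FG.
apply/cvgrPdist_le => e e0; have [d d0 dP] := h e e0.
rewrite near_withinE; apply/nbhs_ballP; exists d => //= s; rewrite -ball_normE /= distrC => sd Ds.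
by rewrite FG//= sub0r normrN ger0_norm ?G0// dP.
Qed.

Lemma st_sub g g' : inS g -> inS g' ->
  L2 (fun x => g x - g' x) /\ ae_eqR (st (fun x => g x - g' x)) (fun xi => st g xi - st g' xi).
Proof.
move=> [gL _] [gL' _]; split; first exact: L2B.
have -> : (fun x => g x - g' x) = fun x => 1 * g x + -1 * g' x by apply/funext => x; rewrite mul1r mulN1r.
by apply: ae_imp (st_lin alpha 1 (-1) gL gL') => xi ->; rewrite mul1r mulN1r.
Qed.

Lemma inS_sub g g' : inS g -> inS g' -> inS (fun x => g x - g' x).
Proof.
move=> gS gS'; have [dL de] := st_sub gS gS'; split => //.
by apply: L2_ae (msr_st alpha dL) (ae_sym de) (L2B gS.2 gS'.2).
Qed.

Lemma n2_st_sub g g' : inS g -> inS g' ->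
  n2 (st (fun x => g x - g' x)) = n2 (fun xi => st g xi - st g' xi).
Proof.
by move=> gS gS'; apply: n2_ae (inS_sub gS gS').2 (L2B gS.2 gS'.2) (st_sub gS gS').2.
Qed.

Lemma sobolev_continuousP (T : \bar R) f : sobolev_continuous (alpha / 2) T f <->
  forall t, 0 <= t -> (t%:E < T)%E -> inS (f t) /\ forall e : R, 0 < e ->
   exists2 d : R, 0 < d & forall s, 0 <= s -> (s%:E < T)%E -> `|s - t| < d ->
     Num.sqrt (n2 (fun xi => st (f s) xi - st (f t) xi)) <= e.
Proof.
have [c c0 cP] := sobolev_norm_st alpha1.
have main t : 0 <= t -> (t%:E < T)%E -> (forall s, 0 <= s -> (s%:E < T)%E -> inS (f s)) ->
   (fun s => sobolev_norm (alpha / 2) (fun x => f s x - f t x))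
      @ within [set s | 0 <= s /\ (s%:E < T)%E] (nbhs t) --> 0%E <->
   forall e : R, 0 < e ->
   exists2 d : R, 0 < d & forall s, 0 <= s -> (s%:E < T)%E -> `|s - t| < d ->
     Num.sqrt (n2 (fun xi => st (f s) xi - st (f t) xi)) <= e.
  move=> t0 tT fS; pose G s := fine (sobolev_norm (alpha / 2) (fun x => f s x - f t x)).
  have GP s : 0 <= s -> (s%:E < T)%E -> [/\ sobolev_norm (alpha / 2) (fun x => f s x - f t x) = (G s)%:E,
      0 <= G s, G s <= c * Num.sqrt (n2 (fun xi => st (f s) xi - st (f t) xi)) &
      Num.sqrt (n2 (fun xi => st (f s) xi - st (f t) xi)) <= c * G s].
    move=> s0 sT; have [dL sdL] := inS_sub (fS s s0 sT) (fS t t0 tT).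
    have [r r0 [h1 h2 h3]] := cP _ dL sdL; rewrite /G h1 /=.
    by rewrite -(n2_st_sub (fS s s0 sT) (fS t t0 tT)).
  have H := @cvg_within_ereal [set s | 0 <= s /\ (s%:E < T)%E] (fun s => sobolev_norm (alpha / 2) (fun x => f s x - f t x)) t G.
  have {}H := H (fun s Ds => let: And4 h _ _ _ := GP s Ds.1 Ds.2 in h)
                (fun s Ds => let: And4 _ h _ _ := GP s Ds.1 Ds.2 in h).
  split=> [/H h e e0|h].
    have [d d0 dP] := h _ (divr_gt0 e0 c0); exists d => // s s0 sT st.
    have [_ _ _ h4] := GP s s0 sT; apply: le_trans h4 _.
    by rewrite mulrC -ler_pdivlMr// dP.
  apply/H => e e0; have [d d0 dP] := h _ (divr_gt0 e0 c0); exists d => // s [s0 sT] st.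
  have [_ _ h3 _] := GP s s0 sT; apply: le_trans h3 _.
  by rewrite mulrC -ler_pdivlMr// dP.
split=> H t t0 tT.
  have fS s : 0 <= s -> (s%:E < T)%E -> inS (f s).
    by move=> s0 sT; apply/sobolev_st => //; have [] := H s s0 sT.
  by split; [exact: fS|apply/main => //; have [] := H t t0 tT].
have fS s : 0 <= s -> (s%:E < T)%E -> inS (f s) by move=> s0 sT; have [] := H s s0 sT.
by split; [apply/sobolev_st => //; exact: fS|apply/main => //; have [] := H t t0 tT].
Qed.

Lemma flow_joint g : L2 g -> forall (e : R), 0 < e -> forall t, exists2 d : R, 0 < d &
  forall s g', `|s - t| < d -> L2 g' -> Num.sqrt (n2 (fun xi => g' xi - g xi)) <= e / 2 ->
  Num.sqrt (n2 (fun xi => flow s g' xi - flow t g xi)) <= e.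
Proof.
move=> gL e e0 t; have e2 : 0 < e / 2 by rewrite divr_gt0.
have [d d0 dP] := flow_cont_sqrt alpha gL e2; exists d => // s g' st gL' h.
have -> : (fun xi => flow s g' xi - flow t g xi) = fun xi =>
    flow s (fun xi => g' xi - g xi) xi + (flow s g xi - flow t g xi).
  by apply/funext => xi; rewrite flowB addrA subrK.
have dL := L2B gL' gL.
apply: le_trans (sqrt_n2D (flow_L2 alpha s dL) (L2B (flow_L2 alpha s gL) (flow_L2 alpha t gL))) _.
by rewrite n2_flow//; have := dP s t st; lra.
Qed.

Lemma nrm0_ae (a b : V2) : nrm (@Bv R) (a - b) = 0 -> ae_eqR (vl a) (vl b).
Proof.
rewrite nrmE => h; apply: n2_eq0_ae; [exact: vl_L2|exact: vl_L2|].
have n0 := n2_ge0 (vl (a - b)).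
by have := sqr_sqrtr n0; rewrite h expr0n /= => /esym.
Qed.

Lemma ae_nrm0 (a b : V2) : ae_eqR (vl a) (vl b) -> nrm (@Bv R) (a - b) = 0.
Proof.
move=> ab; rewrite nrmE vlB (n2_ae (L2B (vl_L2 a) (vl_L2 b)) L20) ?n2_0 ?sqrtr0//.
by apply: ae_imp ab => x ->; rewrite subrr.
Qed.

Lemma nonlin_ae (G G' : R -> R) : L2 G -> L2 G' -> ae_eqR G G' -> nonlin alpha p G = nonlin alpha p G'.
Proof. by move=> GL GL' e; rewrite /nonlin (syn_ae alpha1 GL GL' e). Qed.

(** A true equality: the argument enters only through [syn], an integral that ignores null sets. *)
Lemma Phi_ae t (a b : V2) : ae_eqR (vl a) (vl b) -> Phi t a = Phi t b.
Proof.
move=> ab; have e := flow_ae alpha t ab.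
have E := nonlin_ae (flow_L2 alpha t (vl_L2 a)) (flow_L2 alpha t (vl_L2 b)) e.
exact: (congr1 (fun G => toV (flow (- t) G)) E).
Qed.

Lemma intpic_contT (T : \bar R) f (t : R) : (t%:E < T)%E -> sobolev_continuous (alpha / 2) T f ->
  contT (@Bv R) t (intpic f).
Proof.
move=> tT /sobolev_continuousP H s /andP[s0 st'] e e0.
have lt r : r <= t -> (r%:E < T)%E by move=> rt; apply: le_lt_trans tT; rewrite lee_fin.
have [[_ sL] h] := H s s0 (lt s st'); have e2 : 0 < e / 2 by rewrite divr_gt0.
have [d1 d10 P1] := h _ e2; have [d2 d20 P2] := flow_joint sL e0 (- s).
exists (Num.min d1 d2) => [|r /andP[r0 rt]]; first by rewrite lt_min d10.
rewrite lt_min => /andP[k1 k2]; have [[_ rL] _] := H r r0 (lt r rt).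
rewrite nrmE (toVB (flow_L2 alpha (- r) rL) (flow_L2 alpha (- s) sL)).
by apply: P2 => //; [rewrite opprK addrC distrC|exact: P1 (lt r rt) k1].
Qed.

Lemma global_solution_ex u0 : sobolev (alpha / 2) u0 ->
  exists u : R -> R -> R, is_maximal_solution alpha p u0 +oo%E u.
Proof.
move=> /(sobolev_st alpha1) u0S; have [uL suL] := u0S.
have [v [va vc vP vU]] := conservative_flow_ex (@BvC R) (@BvDl R) (@BvZl R) (@Bv_ge0 R)
  (@Bv_complete R) (Phi_lip alpha1 p) (Phi0 alpha1 p) (Phi_cont alpha1 p) (Phi_ip0 alpha1 p) (toV (st u0)).
have GL t : L2 (flow t (vl (v t))) by apply: flow_L2; exact: vl_L2.
(* The solution is read off the curve [v] by undoing the interaction picture and then passing from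
   states to functions. *)
pose u t := syn alpha (flow t (vl (v t))).
have su t : ae_eqR (st (u t)) (flow t (vl (v t))) := st_syn alpha1 (GL t).
have uS t : inS (u t).
  have h := syn_L2 alpha1 (GL t); split; first exact: h.
  exact: L2_ae (msr_st alpha h) (ae_sym (su t)) (GL t).
have vi t : ae_eqR (vl (v t)) (vl (intpic u t)).
  rewrite (vl_intpic (uS t).2); apply: ae_sym.
  by apply: ae_trans (flow_ae alpha (- t) (su t)) _; rewrite flowNK; exact: ae_refl.
have FE : (fun t => Phi t (v t)) = (fun t => Phi t (intpic u t)) := funext (fun t => Phi_ae t (vi t)).
exists u; split; first by rewrite ltry.
  split.
    apply/sobolev_continuousP => t t0 _; split; first exact: uS.
    move=> e e0; have e2 : 0 < e / 2 by rewrite divr_gt0.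
    have [d1 d10 P1] := vc t t0 _ e2; have [d2 d20 P2] := flow_joint (vl_L2 (v t)) e0 t.
    exists (Num.min d1 d2) => [|s s0 _]; first by rewrite lt_min d10.
    rewrite lt_min => /andP[k1 k2].
    rewrite (n2_ae (L2B (uS s).2 (uS t).2) (L2B (GL s) (GL t))); last first.
      by apply: ae_imp2 _ (su s) (su t) => x -> ->.
    exact: (P2 s _ k2 (vl_L2 (v s)) (P1 s s0 k1)).
  (* The candidate integral is Duhamel's formula solved for [J]; it remains to show that the Riemann
     sums converge to it. *)
  move=> t t0 _; exists (fun x => 2 * (propagator alpha t u0 x - u t x)); last first.
    by apply: aeW => x; move: (propagator _ _ _ _) (u t x) => a b; field.
  have tt : 0 <= t <= t by rewrite t0 lexx.
  have h := primT_riem (@BvC R) (@BvDl R) (@BvZl R) (@Bv_ge0 R) (vP t) tt.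
  rewrite va FE in h; apply: (riem_integral (fun s _ => uS s) u0S t0).
  apply: (riem_null (@BvC R) (@BvDl R) (@BvZl R) (@Bv_ge0 R) h); apply: ae_nrm0.
  by apply: ae_imp (vi t) => x e; rewrite !vlB e.
(* For any solution [w], Duhamel's formula at every earlier time makes its interaction picture an
   integral curve of [Phi], to which the uniqueness part [vU] applies. *)
move=> T1 w T10 [wc wD]; split; first exact: leey.
move=> t t0 tT; have lt s : s <= t -> (s%:E < T1)%E.
  by move=> st'; apply: le_lt_trans tT; rewrite lee_fin.
have wS s : 0 <= s <= t -> inS (w s).
  by move=> /andP[s0 st']; exact: ((sobolev_continuousP T1 w).1 wc s s0 (lt s st')).1.
have ic := intpic_contT tT wc.
have wR s : 0 <= s <= t -> riem (@Bv R) (fun tau => Phi tau (intpic w tau)) 0 s (intpic w s - toV (st u0)).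
  move=> /andP[s0 st']; have [J JP1 JP2] := wD s s0 (lt s st').
  have wSs r : 0 <= r <= s -> inS (w r).
    by move=> /andP[r0 rs]; apply: wS; rewrite r0 (le_trans rs).
  exact: (integral_riem wSs u0S s0 JP2 JP1).
have Pc := contT_Phi (@BvC R) (@BvDl R) (@BvZl R) (@Bv_ge0 R) (Phi_lip alpha1 p) (Phi_cont alpha1 p) t0 ic.
have wP := riem_primT (@BvC R) (@BvDl R) (@BvZl R) (@Bv_ge0 R) Pc wR.
have wP' := primT_subr wP.
have t00 : 0 <= (0 : R) <= t by rewrite lexx t0.
(* Duhamel's formula at time 0, where the integral vanishes, gives the initial value up to norm
   0. *)
have w0 := riem_trivial (@BvC R) (@BvZl R) (wR 0 t00).
have tt : 0 <= t <= t by rewrite t0 lexx.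
have := nrm0_ae (vU t (intpic w) t0 ic wP' w0 t tt).
rewrite (vl_intpic (wS t tt).2) => h.
apply: (st_inj (wS t tt).1 (uS t).1).
apply: ae_trans _ (ae_sym (su t)); rewrite -[X in ae_eqR X](flowK alpha t).
exact: flow_ae h.
Qed.

End global_solution.

Theorem theorem2p4 (R : realType) (alpha : R) (p : nat)
    (halpha : 1 < alpha) (hp : (0 < p)%N)
    (u0 : R -> R) (hu0 : sobolev (alpha / 2) u0) :
  exists u : R -> R -> R, is_maximal_solution alpha p u0 +oo%E u.
Proof. exact: global_solution_ex. Qed.
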